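(* Assume that the IET $T$ satisfies the FDC. For any $0\le a<1$ take $2\le j\le g+1$ so that $\lambda_j\le\lambda_1a<\lambda_{j-1}$. There exists a bounded linear operator $\mathfrak h_j:\mathrm{P_aG}(\sqcup_{\alpha\in\mathcal A}I_\alpha)\to U_j$ such that for any $\tau>0$ there exists a constant $C=C_\tau\ge1$ such that for every $\varphi\in\mathrm{P_aG}(\sqcup_{\alpha\in\mathcal A}I_\alpha)$ with $\mathfrak h_j(\varphi)=0$ and every $k\ge0$ we have $$\|\mathcal M^{(k)}(S(k)\varphi)\|\le C\left(\big(K^{a,j,\tau}_k+C^{a,j,\tau}_k\big)p_a(\varphi)+\|Q|_{E_j}(0,k)\|\,\frac{\|\varphi\|_{L^1(I^{(0)})}}{|I^{(0)}|}\right),$$ all quantities being taken along the FDC-acceleration corresponding to $\tau$.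
   Context: IETs. Let $\mathcal A$ be a set with $d$ elements, $\pi=(\pi_0,\pi_1)$ a pair of bijections $\pi_\varepsilon:\mathcal A\to\{1,\dots,d\}$ which is irreducible, i.e. $\pi_1\circ\pi_0^{-1}\{1,\dots,k\}\ne\{1,\dots,k\}$ for $1\le k<d$. For $\lambda\in\mathbb R_{>0}^{\mathcal A}$ let $|\lambda|=\sum_\alpha\lambda_\alpha$, $I=[0,|\lambda|)$, $I_\alpha=[l_\alpha,r_\alpha)$ with $l_\alpha=\sum_{\pi_0(\beta)<\pi_0(\alpha)}\lambda_\beta$, $r_\alpha=l_\alpha+\lambda_\alpha$, and $I'_\alpha=[l'_\alpha,r'_\alpha)$ defined in the same way with $\pi_1$ in place of $\pi_0$. $T=T_{(\pi,\lambda)}:I\to I$ translates each $I_\alpha$ onto $I'_\alpha$. $T$ satisfies Keane's condition if $T^ml_\alpha\ne l_\beta$ for all $m\ge1$ and all $\alpha,\beta$ with $\pi_0(\beta)\ne1$. $H(\pi)=\Omega_\pi(\mathbb R^{\mathcal A})$, where $\Omega_{\alpha\beta}=+1$ if $\pi_1(\alpha)>\pi_1(\beta)$ and $\pi_0(\alpha)<\pi_0(\beta)$, $-1$ if $\pi_1(\alpha)<\pi_1(\beta)$ and $\pi_0(\alpha)>\pi_0(\beta)$, and $0$ otherwise; $\dim H(\pi)=2g$. $\Gamma\cong\mathbb R^{\mathcal A}$ is the space of functions constant on each $I_\alpha$. Rauzy–Veech induction. $\mathcal R(T)$ is the first return map of $T$ to the interval obtained from $I$ by removing the shorter of its last subintervals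 $I_{\pi_0^{-1}(d)}$, $I'_{\pi_1^{-1}(d)}$; under Keane's condition it is again an IET of $d$ intervals satisfying Keane's condition, labelled by $\mathcal A$ in the standard way. An accelerating sequence is an increasing sequence of integers $(n_k)_{k\ge0}$ with $n_0=0$; $T^{(k)}=\mathcal R^{n_k}(T):I^{(k)}\to I^{(k)}$ exchanges intervals $I^{(k)}_\alpha$ with lengths $\lambda^{(k)}_\alpha$ and is the first return map of $T$ to $I^{(k)}$ ($I^{(0)}=I$). For $0\le k\le l$, $Q(k,l)\in SL_{\mathcal A}(\mathbb Z)$ has entries $Q_{\alpha\beta}(k,l)=$ number of visits to $I^{(k)}_\beta$ of the $T^{(k)}$-orbit of a point of $I^{(l)}_\alpha$ before its first return to $I^{(l)}$. $Q(k)=Q(0,k)$, $Z(k+1)=Q(k,k+1)$, $Q_\alpha(k)=\sum_\beta Q_{\alpha\beta}(k)$ (first return time of $I^{(k)}_\alpha$ to $I^{(k)}$ under $T$). Vector norms are $\ell^1$, $\|B\|=\max_\alpha\sum_\beta|B_{\alpha\beta}|$. Oseledets genericity. Let $\lambda_1>\dots>\lambda_g>\lambda_{g+1}=0$ be the Lyapunov exponents of a fixed reference acceleration of the Kontsevich–Zorich (Rauzy–Veech) cocycle to which the Oseledets theorem applies. Write $Q^*(n)$ for the matrices $Q(n)$ of this reference acceleration. $T$ is Oseledets generic if there is a filtration $\{0\}=E_0\subset E_{-1}\subset\dots\subset E_{-g}\subset E_{cs}=E_{g+1}\subset E_g\subset\dots\subset E_1=\Gamma$ with $\dim E_{-i}-\dim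 E_{-i+1}=\dim E_i-\dim E_{i+1}=1$ for $1\le i\le g$, such that $\frac1n\log\|Q^*(n)h\|\to-\lambda_i$ for $h\in E_{-i}\setminus E_{-i+1}$, $\to0$ for $h\in E_{cs}\setminus E_{-g}$, $\to\lambda_i$ for $h\in E_i\setminus E_{i+1}$. A complementary filtration is $\{0\}=U_1\subset U_2\subset\dots\subset U_{g+1}\subset H(\pi)$ with $E_j\oplus U_j=\Gamma$ for $1\le j\le g+1$. Given an accelerating sequence, $E_j^{(k)}=Q(k)E_j$, $U_j^{(k)}=Q(k)U_j$, and $Q|_{E_j}(k,l):E_j^{(k)}\to E_j^{(l)}$, $Q|_{U_j}(k,l):U_j^{(k)}\to U_j^{(l)}$ are the restrictions of $Q(k,l)$. FDC. $T$ satisfies the Filtration Diophantine Condition (FDC) if it satisfies Keane's condition, is Oseledets generic, and for every $\tau>0$ there are constants $c>0$, $C,\kappa\ge1$, $0<\delta<1$, an accelerating sequence $(n_k)$, a sequence of natural numbers $(r_n)_{n\ge0}$ with $r_0=0$ (write $r(k,l)=\sum_{k\le j<l}r_j$), and a complementary filtration $(U_j)$ such that: - for every $k\ge1$ there is $0<p_k\le\min_\alpha Q_\alpha(k)$ such that $\{T^iI^{(k)}:0\le i<p_k\}$ is a Rokhlin tower of (disjoint) intervals of total measure $\ge\delta|I|$; - $\lim_{n\to\infty} r(0,n)/n\in(1,1+\tau)$; - $\|Q|_{E_j}(k,l)\|\le Ce^{(\lambda_j+\tau)r(k,l)}$ for $0\le k<l$, $1\le j\le g+1$; - $\|Q|_{U_j}(k,l)^{-1}\|\le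 Ce^{(-\lambda_{j-1}+\tau)r(k,l)}$ for $0\le k<l$, $2\le j\le g+1$; - $\|Z(k+1)\|\le Ce^{\tau k}$ and $ce^{\lambda_1k}\le\|Q(k)\|\le Ce^{\lambda_1(1+\tau)k}$ for $k\ge0$; - $\max_\alpha|I^{(k)}|/|I^{(k)}_\alpha|\le\kappa$ for $k\ge0$; - $|\sin\angle(E_j^{(k)},U_j^{(k)})|\ge c\|Q(k)\|^{-\tau}$ for $k\ge0$, $2\le j\le g+1$. An accelerating sequence (with its data) as in the FDC for $\tau$ is called an FDC-acceleration corresponding to $\tau$. The complementary filtration $(U_j)$ is regarded as fixed, the same for all $\tau$. Functions with polynomial singularities. For $0\le a<1$, $m_\alpha=(l_\alpha+r_\alpha)/2$ and $\varphi$ of class $C^1$ on $\bigcup_\alpha(l_\alpha,r_\alpha)$ put $$p_a(\varphi)=\max_\alpha\Big\{\sup_{x\in(l_\alpha,m_\alpha]}|\varphi'(x)(x-l_\alpha)^{1+a}|,\ \sup_{x\in[m_\alpha,r_\alpha)}|\varphi'(x)(r_\alpha-x)^{1+a}|\Big\}.$$ $\mathrm{P_aG}(\sqcup_\alpha I_\alpha)$ is the space of such $\varphi$ with $p_a(\varphi)<\infty$, for which the limits $C_\alpha^+=-\lim_{x\searrow l_\alpha}\varphi'(x)(x-l_\alpha)^{1+a}$, $C_\alpha^-=\lim_{x\nearrow r_\alpha}\varphi'(x)(r_\alpha-x)^{1+a}$ exist for all $\alpha$ and satisfy $C^-_{\pi_0^{-1}(d)}C^-_{\pi_1^{-1}(d)}=0$,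 $C^+_{\pi_0^{-1}(1)}C^+_{\pi_1^{-1}(1)}=0$; it is a Banach space with norm $\|\varphi\|_a=\|\varphi\|_{L^1(I)}+p_a(\varphi)$. Operators. Special Birkhoff sums: $S(k)\varphi(x)=\sum_{0\le i<Q_\alpha(k)}\varphi(T^ix)$ for $x\in I^{(k)}_\alpha$. Mean value projection: for integrable $\varphi$ on $I^{(k)}$, $\mathcal M^{(k)}(\varphi)=\sum_\alpha m(\varphi,I^{(k)}_\alpha)\chi_{I^{(k)}_\alpha}$, where $m(\varphi,J)=\frac1{|J|}\int_J\varphi$; it is identified with a vector of $\mathbb R^{\mathcal A}$ (norm $\ell^1$). Diophantine sequences. $\langle s\rangle^a=s^a$ if $a>0$, $\langle s\rangle^a=1+\log s$ if $a=0$; $K^{a,j,\tau}_k=\sum_{m\ge k}\|Q|_{U_j}(k,m+1)^{-1}\|\,\|Z(m+1)\|\,\langle\|Q(m)\|\rangle^a\,\|Q(m+1)\|^\tau$ (possibly $+\infty$) and $C^{a,j,\tau}_k=\sum_{1\le l\le k}\|Q|_{E_j}(l,k)\|\,\|Z(l)\|\,\langle\|Q(l-1)\|\rangle^a\,\|Q(l)\|^\tau$. *)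

(* Defs.v *)
From HB Require Import structures.
From mathcomp Require Import all_boot all_order all_algebra finmap.
From mathcomp Require Import all_classical all_reals all_analysis.

Set Implicit Arguments.
Unset Strict Implicit.
Unset Printing Implicit Defensive.

Import Order.TTheory GRing.Theory Num.Theory.
Import numFieldNormedType.Exports.

Local Open Scope classical_set_scope.
Local Open Scope ring_scope.

(** * Linear algebra on R^A *)

Section RA.
Variables (R : realType) (A : finType).

Definition RA := {ffun A -> R^o}.

Definition l1norm (h : RA) : R := \sum_a `|h a|.

Definition dot (u v : RA) : R := \sum_a (u a : R) * (v a : R).

(** A matrix indexed by A is a function of two letters; it acts on columns. *)
Definition mxact (B : A -> A -> R) (h : RA) : RA :=
  [ffun a => \sum_b B a b * (h b : R)].

Lemma mxact_is_linear (B : A -> A -> R) : linear (mxact B).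
Proof.
move=> c u v; apply/ffunP => a; rewrite !ffunE /GRing.scale /= mulr_sumr.
rewrite -big_split /=; apply: eq_bigr => b _; rewrite !ffunE mulrDr; congr (_ + _).
exact: mulrCA.
Qed.

HB.instance Definition _ (B : A -> A -> R) :=
  GRing.isLinear.Build R RA RA _ (mxact B) (mxact_is_linear B).

Definition mxlin (B : A -> A -> R) : 'End(RA) := linfun (mxact B).

Definition mxnorm (B : A -> A -> R) : R :=
  \big[Num.max/0]_a \sum_b `|B a b|.

(** Norm of the restriction of f to V, with respect to the l^1 norm. *)
Definition opnorm_on (V : {vspace RA}) (f : 'End(RA)) : R :=
  sup [set l1norm (f h) | h in [set h | h \in V /\ l1norm h <= 1]].

Definition angle (u v : RA) : R :=
  acos (dot u v / (Num.sqrt (dot u u) * Num.sqrt (dot v v))).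

(** |sin| of the angle between two subspaces, the smallest angle made by
    nonzero vectors of the two spaces. *)
Definition sin_angle (V W : {vspace RA}) : R :=
  inf [set s | exists v w, [/\ v \in V, v != 0, w \in W, w != 0
                             & s = `|sin (angle v w)|]].

End RA.

(** * Interval exchange transformations and Rauzy-Veech induction *)

(** The alphabet A has d.+1 letters and positions are numbered from 0, so the
    first position is [ord0] and the last one is [ord_max].  A pair of
    bijections (pi_0, pi_1) is given by its components [.1] and [.2]. *)
Definition comb (A : finType) (d : nat) : Type :=
  ({ffun A -> 'I_d.+1} * {ffun A -> 'I_d.+1})%type.

Record iet (R : realType) (A : finType) (d : nat) := Iet {
  perm_of : comb A d;
  len : RA R A }.

HB.instance Definition _ R A d := gen_eqMixin (iet R A d).
HB.instance Definition _ R A d := gen_choiceMixin (iet R A d).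
HB.instance Definition _ R A d := isPointed.Build (iet R A d)
  (Iet ([ffun=> ord0], [ffun=> ord0]) 0).

Section Iet.
Variables (R : realType) (A : finType) (d : nat).
Implicit Types (pi : comb A d) (x y z : iet R A d).

Definition irreducible pi : Prop :=
  forall k : nat, (0 < k <= d)%N ->
    pi.2 @: (pi.1 @^-1: [set i : 'I_d.+1 | (i < k)%N]%SET)
      != [set i : 'I_d.+1 | (i < k)%N]%SET.

Definition is_iet x : Prop :=
  [/\ bijective (perm_of x).1, bijective (perm_of x).2,
      irreducible (perm_of x) & forall a, 0 < (len x a : R)].

Definition total_len x : R := \sum_a (len x a : R).

Definition itv_all x : set R := `[0, total_len x[%classic.

Definition left0 x (a : A) : R :=
  \sum_(b | ((perm_of x).1 b < (perm_of x).1 a)%N) (len x b : R).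
Definition right0 x (a : A) : R := left0 x a + len x a.
Definition left1 x (a : A) : R :=
  \sum_(b | ((perm_of x).2 b < (perm_of x).2 a)%N) (len x b : R).

Definition itv x (a : A) : set R := `[left0 x a, right0 x a[%classic.

(** Only the summand with t in I_a is nonzero; outside I this is the identity. *)
Definition iet_map x (t : R) : R :=
  t + \sum_(a | (left0 x a <= t < right0 x a)%R) (left1 x a - left0 x a).

Definition keane x : Prop :=
  forall (m : nat) (a b : A), (0 < m)%N -> (perm_of x).1 b != ord0 ->
    iter m (iet_map x) (left0 x a) != left0 x b.

Definition omega pi (a b : A) : R :=
  if (pi.2 b < pi.2 a)%N && (pi.1 a < pi.1 b)%N then 1
  else if (pi.2 a < pi.2 b)%N && (pi.1 b < pi.1 a)%N then -1
  else 0.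

Definition Hspace pi : {vspace RA R A} := limg (mxlin (omega pi)).

Definition last_letter (p : {ffun A -> 'I_d.+1}) : option A :=
  [pick a | p a == ord_max].

(** Moves the last letter l of p to the position just after the letter w. *)
Definition rauzy_row (p : {ffun A -> 'I_d.+1}) (w l : A) : {ffun A -> 'I_d.+1} :=
  [ffun a => if a == l then inord (p w).+1
             else if (p w < p a)%N then inord (p a).+1 else p a].

Definition rauzy_top pi (a0 a1 : A) : comb A d := (pi.1, rauzy_row pi.2 a0 a1).
Definition rauzy_bot pi (a0 a1 : A) : comb A d := (rauzy_row pi.1 a1 a0, pi.2).

(** One step of Rauzy-Veech induction.  The removed interval is the shorter of
    I_{a0} and I'_{a1}; the case of equal lengths is excluded by Keane's
    condition, and then the value is irrelevant. *)
Definition rauzy x : iet R A d :=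
  match last_letter (perm_of x).1, last_letter (perm_of x).2 with
  | Some a0, Some a1 =>
    if (len x a1 : R) < (len x a0 : R) then
      Iet (rauzy_top (perm_of x) a0 a1)
        [ffun a => if a == a0 then len x a0 - len x a1 else len x a]
    else
      Iet (rauzy_bot (perm_of x) a0 a1)
        [ffun a => if a == a1 then len x a1 - len x a0 else len x a]
  | _, _ => x
  end.

Definition rauzy_move : rel (comb A d) := fun pi pi' =>
  [exists a0, [exists a1, [&& pi.1 a0 == ord_max, pi.2 a1 == ord_max
     & (pi' == rauzy_top pi a0 a1) || (pi' == rauzy_bot pi a0 a1)]]].

Definition rauzy_class pi : pred (comb A d) := connect rauzy_move pi.

(** For z an induced IET of y (on an initial interval): the number of visits to
    the b-th interval of y of the orbit, under y, of a point of the a-th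
    interval of z, before its first return to the interval of z.  The number
    does not depend on the point; the left endpoint is used.  The set of visit
    times is finite under Keane's condition. *)
Definition visits y z (a b : A) : nat :=
  #|` fset_set [set i : nat |
      (forall j : nat, (0 < j <= i)%N ->
         ~ itv_all z (iter j (iet_map y) (left0 z a)))
      /\ itv y b (iter i (iet_map y) (left0 z a))] |%fset.

Definition visit_mx y z (a b : A) : R := (visits y z a b)%:R.

End Iet.

(** * The reference acceleration and Oseledets genericity *)

Section Reference.
Variables (R : realType) (A : finType) (d : nat).
Implicit Types (x : iet R A d) (N : iet R A d -> nat).

Definition normalize x : iet R A d := Iet (perm_of x) ((total_len x)^-1 *: len x).

(** An acceleration of Rauzy-Veech induction is given by a number N of
    elementary steps, a function on the space of IETs of total length 1. *)
Definition accel N x : iet R A d := normalize (iter (N x) (@rauzy R A d) x).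

Definition accel_cocycle N x : A -> A -> R :=
  visit_mx x (iter (N x) (@rauzy R A d) x).

Fixpoint accel_time N x (n : nat) : nat :=
  if n is n'.+1 then
    (accel_time N x n' +
     N (normalize (iter (accel_time N x n') (@rauzy R A d) x)))%N
  else 0%N.

Definition Qref N x (n : nat) : 'End(RA R A) :=
  mxlin (visit_mx x (iter (accel_time N x n) (@rauzy R A d) x)).

(** Borel sigma-algebra: discrete in the permutations, generated by the
    coordinates in the lengths. *)
Definition iet_events : set (set (iet R A d)) :=
  [set B | (exists pi, B = [set x | perm_of x = pi]) \/
           (exists a (t : R), B = [set x | ((len x a : R) < t)%R])].

Definition iet_space := g_sigma_algebraType iet_events.

(** The Kontsevich-Zorich cocycle accelerated by N satisfies the assumptions of
    the Oseledets theorem on the Rauzy class of pi: mu is an invariant ergodic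
    probability measure on the normalized Keane IETs over this class, and the
    logarithm of the norm of the cocycle is integrable. *)
Record reference_acceleration (pi : comb A d) N
    (mu : probability iet_space R) : Prop := ReferenceAcceleration {
  ref_pos : forall x, (0 < N x)%N;
  ref_meas : forall n : nat,
    measurable [set x : iet_space | N x = n];
  ref_supp : {ae mu, forall x : iet_space,
    [/\ is_iet x, keane x, total_len x = 1 & rauzy_class pi (perm_of x)]};
  ref_inv : forall B : set iet_space, measurable B ->
    mu [set x : iet_space | B (accel N x)] = mu B;
  ref_erg : forall B : set iet_space, measurable B ->
    [set x : iet_space | B (accel N x)] = B -> mu B = 0%E \/ mu B = 1%E;
  ref_int : mu.-integrable [set: iet_space]
    (fun x : iet_space => (ln (mxnorm (accel_cocycle N x)))%:E) }.

Variables (N : iet R A d -> nat) (g : nat) (lam : nat -> R).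

Definition has_exponent x (h : RA R A) (c : R) : Prop :=
  (fun n : nat => n%:R^-1 * ln (l1norm (Qref N x n h))) @ \oo --> c.

(** [F i] stands for E_{-i}, 0 <= i <= g, and [E j], 1 <= j <= g+1, for E_j;
    E_cs is [E g.+1].  The values of F and E at other indices are irrelevant. *)
Record oseledets_filtration x (F E : nat -> {vspace RA R A}) : Prop :=
  OseledetsFiltration {
  osel_F0 : F 0%N = 0%VS;
  osel_F : forall i : nat, (1 <= i <= g)%N ->
    (F i.-1 <= F i)%VS /\ \dim (F i) = (\dim (F i.-1)).+1;
  osel_FE : (F g <= E g.+1)%VS;
  osel_E : forall i : nat, (1 <= i <= g)%N ->
    (E i.+1 <= E i)%VS /\ \dim (E i) = (\dim (E i.+1)).+1;
  osel_E1 : E 1%N = fullv;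
  osel_stable : forall (i : nat) h, (1 <= i <= g)%N ->
    h \in F i -> h \notin F i.-1 -> has_exponent x h (- lam i);
  osel_central : forall h,
    h \in E g.+1 -> h \notin F g -> has_exponent x h 0;
  osel_unstable : forall (i : nat) h, (1 <= i <= g)%N ->
    h \in E i -> h \notin E i.+1 -> has_exponent x h (lam i) }.

(** lam_1 > ... > lam_g > lam_{g+1} = 0 are the Lyapunov exponents of the
    reference acceleration, i.e. its almost sure exponents. *)
Definition lyapunov_exponents (mu : probability iet_space R) : Prop :=
  [/\ forall i : nat, (1 <= i <= g)%N -> lam i.+1 < lam i,
      lam g.+1 = 0
    & {ae mu, forall x : iet_space, exists F E, oseledets_filtration x F E}].

End Reference.

(** * The Filtration Diophantine Condition *)

Section FDC.
Variables (R : realType) (A : finType) (d : nat).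
Variable T : iet R A d.

Definition complementary_filtration (g : nat) (E U : nat -> {vspace RA R A}) :=
  [/\ U 1%N = 0%VS,
      forall j : nat, (1 <= j <= g)%N -> (U j <= U j.+1)%VS,
      (U g.+1 <= Hspace R (perm_of T))%VS
    & forall j : nat, (1 <= j <= g.+1)%N ->
        (E j + U j)%VS = fullv /\ (E j :&: U j)%VS = 0%VS].

Definition accelerating (n : nat -> nat) : Prop :=
  n 0%N = 0%N /\ forall k, (n k < n k.+1)%N.

Section Acceleration.
Variable n : nat -> nat.

Definition stage (k : nat) : iet R A d := iter (n k) (@rauzy R A d) T.

Definition Qn (k l : nat) : A -> A -> nat := visits (stage k) (stage l).
Definition Qmx (k l : nat) : A -> A -> R := visit_mx (stage k) (stage l).
Definition Qnorm (k : nat) : R := mxnorm (Qmx 0 k).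
Definition Znorm (k : nat) : R := mxnorm (Qmx k.-1 k).

Definition return_time (k : nat) (a : A) : nat := (\sum_b Qn 0 k a b)%N.

(** V^{(k)} = Q(k) V *)
Definition push (V : {vspace RA R A}) (k : nat) : {vspace RA R A} :=
  (mxlin (Qmx 0 k) @: V)%VS.

(** The norms of Q(k,l) : V^{(k)} -> V^{(l)} and of its inverse
    V^{(l)} -> V^{(k)}; Q(k,l) is invertible. *)
Definition Qnorm_on (V : {vspace RA R A}) (k l : nat) : R :=
  opnorm_on (push V k) (mxlin (Qmx k l)).
Definition Qinvnorm_on (V : {vspace RA R A}) (k l : nat) : R :=
  opnorm_on (push V l) ((mxlin (Qmx k l))^-1)%VF.

Definition rokhlin_tower (delta : R) (k p : nat) : Prop :=
  [/\ (0 < p)%N, forall a, (p <= return_time k a)%N,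
      forall i, (i < p)%N -> is_interval (iter i (iet_map T) @` itv_all (stage k)),
      trivIset `I_p (fun i => iter i (iet_map T) @` itv_all (stage k))
    & ((delta * total_len T)%:E <= lebesgue_measure
        (\bigcup_(i in `I_p) (iter i (iet_map T) @` itv_all (stage k))))%E].

End Acceleration.

Definition rsum (r : nat -> nat) (k l : nat) : nat := (\sum_(k <= i < l) r i)%N.

Variables (g : nat) (lam : nat -> R) (E U : nat -> {vspace RA R A}).

Record FDC_data (tau c C kappa delta : R) (n r : nat -> nat) : Prop := FDCData {
  fdc_c : 0 < c;
  fdc_C : 1 <= C;
  fdc_kappa : 1 <= kappa;
  fdc_delta : 0 < delta < 1;
  fdc_accel : accelerating n;
  fdc_r0 : r 0%N = 0%N;
  fdc_tower : forall k, (1 <= k)%N -> exists p, rokhlin_tower n delta k p;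
  fdc_rlim : exists2 L : R, 1 < L < 1 + tau &
    (fun m : nat => (rsum r 0 m)%:R / m%:R : R) @ \oo --> L;
  fdc_E : forall k l j : nat, (k < l)%N -> (1 <= j <= g.+1)%N ->
    Qnorm_on n (E j) k l <= C * expR ((lam j + tau) * (rsum r k l)%:R);
  fdc_U : forall k l j : nat, (k < l)%N -> (2 <= j <= g.+1)%N ->
    Qinvnorm_on n (U j) k l <= C * expR ((- lam j.-1 + tau) * (rsum r k l)%:R);
  fdc_Z : forall k, Znorm n k.+1 <= C * expR (tau * k%:R);
  fdc_Q : forall k, c * expR (lam 1%N * k%:R) <= Qnorm n k
                    <= C * expR (lam 1%N * (1 + tau) * k%:R);
  fdc_bal : forall k a, total_len (stage n k) / (len (stage n k) a : R) <= kappa;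
  fdc_angle : forall k j : nat, (2 <= j <= g.+1)%N ->
    c * Qnorm n k `^ (- tau) <= sin_angle (push n (E j) k) (push n (U j) k) }.

Definition FDC_acceleration (tau : R) (n : nat -> nat) : Prop :=
  exists c C kappa delta r, FDC_data tau c C kappa delta n r.

(** The complementary filtration U is the same for all tau; E is determined by T
    as part of its Oseledets filtration. *)
Definition FDC (N : iet R A d -> nat) (F : nat -> {vspace RA R A}) : Prop :=
  [/\ keane T, oseledets_filtration N g lam T F E,
      complementary_filtration g E U
    & forall tau : R, 0 < tau -> exists n, FDC_acceleration tau n].

End FDC.

(** * Functions with polynomial singularities *)

Section PaG.
Variables (R : realType) (A : finType) (d : nat).
Variables (T : iet R A d) (a : R).
Implicit Types (phi : R -> R) (b : A).

Definition mid b : R := (left0 T b + right0 T b) / 2.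

Definition sing_left phi b (t : R) : R :=
  derive1 phi t * (t - left0 T b) `^ (1 + a).
Definition sing_right phi b (t : R) : R :=
  derive1 phi t * (right0 T b - t) `^ (1 + a).

Definition pa phi : \bar R :=
  \big[maxe/0%E]_b maxe
    (ereal_sup [set (`|sing_left phi b t|)%:E | t in `]left0 T b, mid b]%classic])
    (ereal_sup [set (`|sing_right phi b t|)%:E | t in `[mid b, right0 T b[%classic]).

Definition Cplus phi b : R := - lim (sing_left phi b @ (left0 T b)^'+).
Definition Cminus phi b : R := lim (sing_right phi b @ (right0 T b)^'-).

(** phi is a function on the union of the open intervals (l_b, r_b); its values
    elsewhere are irrelevant. *)
Record PaG phi : Prop := InPaG {
  pag_C1 : forall b t, left0 T b < t < right0 T b ->
    derivable phi t 1 /\ {for t, continuous (derive1 phi)};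
  pag_fin : (pa phi < +oo)%E;
  pag_Cplus : forall b, cvg (sing_left phi b @ (left0 T b)^'+);
  pag_Cminus : forall b, cvg (sing_right phi b @ (right0 T b)^'-);
  pag_geom_right : forall b0 b1, (perm_of T).1 b0 = ord_max ->
    (perm_of T).2 b1 = ord_max -> Cminus phi b0 * Cminus phi b1 = 0;
  pag_geom_left : forall b0 b1, (perm_of T).1 b0 = ord0 ->
    (perm_of T).2 b1 = ord0 -> Cplus phi b0 * Cplus phi b1 = 0 }.

Definition L1norm phi : \bar R :=
  (\int[lebesgue_measure]_(t in itv_all T) (`|phi t|)%:E)%E.

Definition PaG_norm phi : \bar R := (L1norm phi + pa phi)%E.

(** Two functions of PaG that agree on the open intervals have the same image,
    by linearity and boundedness. *)
Definition bounded_linear_operator (V : {vspace RA R A})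
    (h : (R -> R) -> RA R A) : Prop :=
  [/\ forall phi, PaG phi -> h phi \in V,
      forall (s : R) phi psi, PaG phi -> PaG psi ->
        h (fun t => s * phi t + psi t) = s *: h phi + h psi
    & exists M : R, forall phi, PaG phi ->
        ((l1norm (h phi))%:E <= M%:E * PaG_norm phi)%E].

End PaG.

(** * Special Birkhoff sums, mean values, Diophantine sequences *)

Section Operators.
Variables (R : realType) (A : finType) (d : nat).

Definition special_birkhoff (T : iet R A d) (n : nat -> nat) (k : nat)
    (phi : R -> R) (t : R) : R :=
  \sum_(b | (left0 (stage T n k) b <= t < right0 (stage T n k) b)%R)
    \sum_(i < return_time T n k b) phi (iter i (iet_map T) t).

Definition mean_proj (y : iet R A d) (f : R -> R) : RA R A :=
  [ffun b => (len y b : R)^-1 *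
     (\int[@lebesgue_measure R]_(t in itv y b) f t)%R].

(** <s>^a *)
Definition bracket (a s : R) : R := if a == 0 then 1 + ln s else s `^ a.

Variables (T : iet R A d) (n : nat -> nat) (a tau : R).

(** K^{a,j,tau}_k for V = U_j *)
Definition Kseq (V : {vspace RA R A}) (k : nat) : \bar R :=
  (\sum_(k <= m <oo)
     (Qinvnorm_on T n V k m.+1 * Znorm T n m.+1 * bracket a (Qnorm T n m)
      * Qnorm T n m.+1 `^ tau)%:E)%E.

(** C^{a,j,tau}_k for V = E_j *)
Definition Cseq (V : {vspace RA R A}) (k : nat) : R :=
  \sum_(1 <= l < k.+1)
     Qnorm_on T n V l k * Znorm T n l * bracket a (Qnorm T n l.-1)
      * Qnorm T n l `^ tau.

End Operators.

(* Main.v *)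
(* Write M_N for the vector of mean values, over the intervals of the N-th Rauzy
   iterate, of the Birkhoff sums of phi, and Q(N) for the matrix of visits.  The
   error M_N' - Q(N,N') M_N compares averages of phi over nested levels of the
   towers.  For x and y at distance at most L in the same I_c one has
   |phi x - phi y| <= p_a(phi) (K_L x + K_L y) with a kernel K_L whose integral is
   O(L^(1-a)), up to a logarithm when a = 0; since the levels of the towers are
   disjoint, summing these bounds costs a single integral of K_L over I, so that
   the error is O(|Q(N,N')| <|Q(N)|>^a p_a(phi)).

   The correction is h phi = lim_N P_U Q(N)^-1 M_N, where P_U is the projection
   onto U_j along E_j.  Along an acceleration for a small tau, the expansion of Q
   on U_j beats the error because lam_1 a < lam_(j-1).  Comparing an arbitrary
   Rauzy time N with the two times of this acceleration around it, the limit
   exists over all N, and thus is the same for every acceleration.  When h phi = 0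
   the U_j-component of M_k is the sum of the errors of all later steps, bounded by
   K_k, and the E_j-component is the sum of those of the earlier steps, bounded by
   C_k; the angle condition controls the projections. *)

Require Import Defs.
From mathcomp Require Import all_boot all_order all_algebra finmap.
From mathcomp Require Import all_classical all_reals all_analysis.
From mathcomp Require Import measurable_realfun ring lra zify.

Set Implicit Arguments.
Unset Strict Implicit.
Unset Printing Implicit Defensive.

Import Order.TTheory GRing.Theory Num.Theory.
Import numFieldNormedType.Exports.

Local Open Scope classical_set_scope.
Local Open Scope ring_scope.

(** * Itineraries under Rauzy induction *)

Section Row.
Variables (R : realType) (A : finType) (d : nat).
Implicit Types (p : {ffun A -> 'I_d.+1}) (l : RA R A).

(** The intervals are balanced only at the times of an acceleration, while the limit defining the
    operator runs over all Rauzy times. The error bound allows this because it uses the balance at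
    the later time N' alone. With L = |I^(N)|, the integral of K_L is divided by the length of one
    interval at time N', and the quotient of L by this length is at most kappa times the norm of
    Q(N,N'). At time N only the ratio |I|/|I^(N)| enters, and it grows with N. Hence, for N between
    two consecutive times n_l and n_(l+1), both N and n_l are compared with n_(l+1).

    Rauzy induction is handled through words. The itinerary of an interval up to its return records
    at once the visits, the levels of its tower and the relation between the lengths, and composing
    inductions concatenates words, so that only one elementary step has to be computed.

    Since K_k may be infinite, the estimate is first proved in [R] with a partial sum of K_k and a
    remainder, the correction at a late time pushed to time k. The remainder tends to 0 when the
    limit vanishes, and the series enters at the very end. *)

Definition row_left p l (a : A) : R := \sum_(b | (p b < p a)%N) (l b : R).

Lemma row_left_ge0 p l a : (forall b, 0 < (l b : R)) -> 0 <= row_left p l a.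
Proof. by move=> l0; apply: sumr_ge0 => b _; apply: ltW. Qed.

Lemma row_right p l a : injective p ->
  row_left p l a + l a = \sum_(b | (p b <= p a)%N) (l b : R).
Proof.
move=> ip; rewrite [RHS](bigD1 a) //= addrC; congr (_ + _).
apply: eq_bigl => b; rewrite ltn_neqAle andbC; congr (_ && _).
by rewrite (inj_eq val_inj) (inj_eq ip).
Qed.

Lemma le_row_sum (P Q : pred A) l : (forall b, 0 < (l b : R)) -> subpred P Q ->
  \sum_(b | P b) (l b : R) <= \sum_(b | Q b) (l b : R).
Proof.
move=> l0 PQ; rewrite [leLHS]big_mkcond [leRHS]big_mkcond /=.
apply: ler_sum => b _; have := PQ b; case: (P b) => [->//|_].
by case: (Q b) => //; apply: ltW.
Qed.

Lemma row_right_le p l a : injective p -> (forall b, 0 < (l b : R)) ->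
  row_left p l a + l a <= \sum_b (l b : R).
Proof. by move=> ip l0; rewrite row_right //; apply: le_row_sum. Qed.

Lemma row_right_last p l a : injective p -> p a = ord_max ->
  row_left p l a + l a = \sum_b (l b : R).
Proof.
move=> ip pa; rewrite row_right //; apply: eq_bigl => b.
by rewrite pa /= -ltnS ltn_ord.
Qed.

Lemma row_right_lt p l a b : injective p -> (forall b, 0 < (l b : R)) ->
  (p a < p b)%N -> row_left p l a + l a <= row_left p l b.
Proof.
move=> ip l0 ab; rewrite row_right //; apply: le_row_sum => // c /=.
by move=> ca; apply: leq_ltn_trans ab.
Qed.

Lemma row_disjoint p l a b x : injective p -> (forall b, 0 < (l b : R)) ->
  row_left p l a <= x < row_left p l a + l a ->
  row_left p l b <= x < row_left p l b + l b -> a = b.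
Proof.
move=> ip l0 /andP[ax xa] /andP[bx xb].
suff : p a = p b :> nat by move/val_inj/ip.
case: (ltngtP (p a) (p b)) => //.
  move/(row_right_lt ip l0) => h.
  by have := le_lt_trans (le_trans h bx) xa; rewrite ltxx.
move/(row_right_lt ip l0) => h.
by have := le_lt_trans (le_trans h ax) xb; rewrite ltxx.
Qed.

Lemma ord_ltn_max p a c : injective p -> p a = ord_max -> c <> a ->
  (p c < d)%N.
Proof.
move=> ip pa ca; have := ltn_ord (p c); rewrite ltnS leq_eqVlt => /orP[/eqP e|//].
by case: ca; apply: ip; apply: val_inj; rewrite pa.
Qed.

Section Move.
Variables (p : {ffun A -> 'I_d.+1}) (l : RA R A) (w o : A).
Hypotheses (ip : injective p) (po : p o = ord_max) (wo : w <> o).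

Let p' := rauzy_row p w o.
Let l' : RA R A := [ffun a => if a == w then (l w : R) - l o else l a].

Lemma rauzy_rowE b : p' b = (if b == o then (p w).+1
  else if (p w < p b)%N then (p b).+1 else p b) :> nat.
Proof.
have pwd : (p w < d)%N by apply: ord_ltn_max po _.
rewrite /p' ffunE; case: eqP => [_|bo]; first by rewrite inordK.
case: ifP => // _; rewrite inordK //; apply: (ord_ltn_max ip po) => //.
Qed.

Lemma rauzy_row_inj : injective p'.
Proof.
move=> b c /(congr1 val) /=; rewrite !rauzy_rowE.
have pwd : (p w < d)%N by apply: ord_ltn_max po _.
case: eqP => [->|bo]; case: eqP => [->|co] //.
- by case: ltnP => h e; move: e h; [move=> [->]|move=> <-]; rewrite ?ltnn ?ltnNge ?leqnSn ?ltnS.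
- by case: ltnP => h e; move: e h; [move=> [->]|move=> ->]; rewrite ?ltnn ?ltnS.
- move=> e; apply: ip; apply: val_inj => /=; move: e.
  by case: ltnP => h; case: ltnP => h'; lia.
Qed.

(** Only [o] changes its place and only [w] its length, so their contributions are isolated; the
    order of the other letters is unchanged. *)
Lemma row_move_aux b : \sum_(c | (p' c < p' b)%N) (l' c : R) =
  \sum_(c | (p' c < p' b)%N && (c != o)) (l c : R) +
  ((p' o < p' b)%N)%:R * l o - ((p' w < p' b)%N)%:R * l o.
Proof.
have E c : (l' c : R) = l c - (c == w)%:R * l o.
  by rewrite ffunE; case: eqP => [->|_]; rewrite ?mul1r ?mul0r ?subr0.
under eq_bigr do rewrite E.
rewrite big_split /= sumrN; congr (_ - _).
  rewrite (bigID (fun c => c != o)) /=; congr (_ + _).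
  case: (boolP (p' o < p' b)%N) => h.
    rewrite (bigD1 o) /= ?h ?eqxx // mul1r big1 ?addr0 // => c.
    by case: (c == o); rewrite /= ?andbF.
  rewrite mul0r big1 // => c /andP[hc]; rewrite negbK => /eqP co.
  by move: h; rewrite -co hc.
case: (boolP (p' w < p' b)%N) => h.
  rewrite (bigD1 w) //= eqxx /= big1 ?addr0 // => c /andP[_ co].
  by rewrite (negPf co) mul0r.
rewrite mul0r big1 // => c hc; case: eqP => // [co|_]; last by rewrite mul0r.
by move: h; rewrite -co hc.
Qed.

(** The loser [o] is reinserted just after the winner [w], which is shortened by [l o]. A letter
    other than [o] has [o] on its left exactly when it has [w] there, and the two changes cancel. *)
Lemma row_left_move b : b <> o -> row_left p' l' b = row_left p l b.
Proof.
move=> bo; rewrite /row_left row_move_aux.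
have -> : (p' o < p' b)%N = (p' w < p' b)%N.
  rewrite !rauzy_rowE eqxx ltnn; case: eqP => // _; case: eqP => // _.
  by case: ifP; lia.
rewrite addrK; apply: eq_bigl => c.
case: (eqVneq c o) => [->|/eqP co] /=.
  by rewrite andbF po /= ltnNge -ltnS ltn_ord.
rewrite andbT !rauzy_rowE; case: eqP => // _; case: eqP => // _.
by case: ifP; case: ifP; lia.
Qed.

Lemma row_left_moved : row_left p' l' o = row_left p l w + l w - l o.
Proof.
rewrite row_right // /row_left row_move_aux ltnn mul0r addr0.
have -> : (p' w < p' o)%N by rewrite !rauzy_rowE eqxx ltnn; case: eqP.
rewrite mul1r; congr (_ - _); apply: eq_bigl => c.
case: (eqVneq c o) => [->|/eqP co] /=.
  rewrite andbF po; apply/esym/negbTE; rewrite -ltnNge.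
  by apply: (ord_ltn_max ip po).
by rewrite andbT !rauzy_rowE eqxx; case: eqP => // _; case: ifP; lia.
Qed.

Lemma total_move : \sum_b (l' b : R) = \sum_b (l b : R) - l o.
Proof.
rewrite (bigD1 w) //= ffunE eqxx [in RHS](bigD1 w) //= addrAC; congr (_ + _ - _).
by apply: eq_bigr => c; rewrite ffunE => /negPf ->.
Qed.

Lemma move_gt0 : (forall b, 0 < (l b : R)) -> (l o : R) < l w ->
  forall b, 0 < (l' b : R).
Proof. by move=> l0 ow b; rewrite ffunE; case: ifP => // _; rewrite subr_gt0. Qed.

(** In the other row the winner is last, so shortening it moves no left endpoint. *)
Lemma row_left_shorten (q : {ffun A -> 'I_d.+1}) b :
  q w = ord_max -> row_left q l' b = row_left q l b.
Proof.
move=> qw; apply: eq_bigr => c cb; rewrite ffunE; case: eqP => // cw.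
by move: cb; rewrite cw qw ltnNge -ltnS ltn_ord.
Qed.

Lemma rauzy_row0 b : (0 < d)%N -> p b = ord0 -> p' b = ord0.
Proof.
move=> d0 pb; apply: val_inj; rewrite /= rauzy_rowE pb ltn0.
case: eqP => // bo; exfalso; move: po; rewrite -bo pb => /(congr1 val) /= e.
by move: d0; rewrite -e.
Qed.

End Move.
End Row.

(** * Induced maps and concatenation of itineraries *)

Section Dynamics.
Variables (R : realType) (A : finType) (d : nat).
Implicit Types (x y z : iet R A d) (a b c : A) (W : A -> seq A).

(** The part of [is_iet] carried along Rauzy induction; last letters are recovered from injectivity
    and the cardinality of [A]. *)
Definition regular y := [/\ injective (perm_of y).1, injective (perm_of y).2
  & forall a, 0 < (len y a : R)].

Lemma itvE y a (t : R) : itv y a t = (left0 y a <= t < left0 y a + len y a).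
Proof. by rewrite /itv /right0 /= in_itv. Qed.

Lemma itv_allE y (t : R) : itv_all y t = (0 <= t < total_len y).
Proof. by rewrite /itv_all /= in_itv. Qed.

Lemma left1E y a : left1 y a = row_left (perm_of y).2 (len y) a.
Proof. by []. Qed.

Lemma itv_disjoint y a b t : regular y -> itv y a t -> itv y b t -> a = b.
Proof. by case=> i1 i2 l0; rewrite !itvE; apply: row_disjoint. Qed.

Lemma iet_mapE y a t : regular y -> itv y a t ->
  iet_map y t = t + (left1 y a - left0 y a).
Proof.
move=> ry at_; rewrite /iet_map (bigD1 a) /=; last by rewrite -itvE.
rewrite big1 ?addr0 // => b /andP[]; rewrite -itvE => bt /eqP[].
exact: itv_disjoint bt at_.
Qed.

Lemma itv_in_all y a t : regular y -> itv y a t -> itv_all y t.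
Proof.
case=> i1 i2 l0; rewrite itvE itv_allE => /andP[h1 h2]; apply/andP; split.
  by apply: le_trans h1; apply: row_left_ge0.
by apply: lt_le_trans h2 _; apply: row_right_le.
Qed.

Lemma iet_map_all y a t : regular y -> itv y a t -> itv_all y (iet_map y t).
Proof.
move=> ry at_; rewrite (iet_mapE ry at_); move: at_.
have [i1 i2 l0] := ry; rewrite itvE itv_allE => /andP[h1 h2].
have h3 := row_left_ge0 (perm_of y).2 a l0.
have := row_right_le a i2 l0; rewrite -/(total_len y) -left1E in h3 *.
by move=> h4; apply/andP; split; lra.
Qed.

Lemma iet_map_inj y a b s t : regular y -> itv y a s -> itv y b t ->
  iet_map y s = iet_map y t -> s = t.
Proof.
move=> ry sa tb; rewrite (iet_mapE ry sa) (iet_mapE ry tb) => e.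
have ab : a = b.
  have [i1 i2 l0] := ry; apply: (row_disjoint (x := s + (left1 y a - left0 y a)) i2 l0).
    by move: sa; rewrite itvE -left1E; lra.
  by rewrite e; move: tb; rewrite itvE -left1E; lra.
by move: e; rewrite ab => /addIr.
Qed.

Lemma left0_itv y a : regular y -> itv y a (left0 y a).
Proof. by case=> _ _ l0; rewrite itvE lexx ltrDl l0. Qed.

(* [W a] is the itinerary, under y, of the points of the interval of z labelled
   a up to their first return to the interval of z.  The last two fields, on the
   left endpoints, carry Keane's condition from y to z. *)
Record induced y z W : Prop := Induced {
  ind_nil : forall a, W a != [::];
  ind_total : total_len z <= total_len y;
  ind_visit : forall a t i, itv z a t -> (i < size (W a))%N ->
    itv y (nth a (W a) i) (iter i (iet_map y) t);
  ind_out : forall a t i, itv z a t -> (0 < i < size (W a))%N ->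
    ~ itv_all z (iter i (iet_map y) t);
  ind_return : forall a t, itv z a t ->
    iter (size (W a)) (iet_map y) t = iet_map z t;
  ind_len : forall b, len y b = \sum_a (len z a : R) * (count_mem b (W a))%:R;
  ind_left : forall b, exists2 i, (i < size (W b))%N &
    iter i (iet_map y) (left0 z b) = left0 y b;
  ind_first : forall b, (perm_of y).1 b = ord0 -> (perm_of z).1 b = ord0 }.

Lemma induced_refl y : regular y -> induced y y (fun a => [:: a]).
Proof.
move=> ry; split => //.
- by move=> a t [|i].
- by move=> a t [|i].
- move=> b; rewrite (bigD1 b) //= eqxx mulr1 big1 ?addr0 // => c.
  by move=> /negPf ->; rewrite mulr0.
- by move=> b; exists 0%N.
Qed.

(** Composition of substitutions: each visit to an interval of the intermediate map is expanded into
    the itinerary of that interval. *)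
Definition concat W W' (a : A) : seq A := flatten [seq W c | c <- W' a].

Section Concat.
Variables (T y : iet R A d) (W : A -> seq A).
Hypotheses (ry : regular y) (ind : induced T y W).

Lemma iter_flatten (s : seq A) a t :
  (forall i, (i < size s)%N -> itv y (nth a s i) (iter i (iet_map y) t)) ->
  iter (size (flatten [seq W c | c <- s])) (iet_map T) t =
  iter (size s) (iet_map y) t.
Proof.
elim: s t => //= c s IH t h; rewrite size_cat addnC iterD.
rewrite (ind_return ind (h 0%N _)) //= -iterS [RHS]iterSr.
by apply: IH => i si; have := h i.+1 si; rewrite iterSr.
Qed.

Lemma sum_flatten (s : seq A) a t :
  (forall i, (i < size s)%N -> itv y (nth a s i) (iter i (iet_map y) t)) ->
  forall G : R -> R,
  \sum_(i < size (flatten [seq W c | c <- s])) G (iter i (iet_map T) t) =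
  \sum_(i < size s) \sum_(j < size (W (nth a s i)))
     G (iter j (iet_map T) (iter i (iet_map y) t)).
Proof.
move=> h G; elim: s t h => [|c s IH] t h; first by rewrite /= !big_ord0.
rewrite [RHS]big_ord_recl /= size_cat big_split_ord /=; congr (_ + _).
transitivity (\sum_(i < size (flatten [seq W c | c <- s]))
    G (iter i (iet_map T) (iet_map y t))).
  apply: eq_bigr => i _; congr G.
  by rewrite addnC iterD (ind_return ind (h 0%N _)).
rewrite IH; last by move=> i si; rewrite -iterSr; apply: (h i.+1).
by apply: eq_bigr => i _; apply: eq_bigr => j _; rewrite -iterSr.
Qed.

(** A time of the orbit under [T] consists of [k] complete towers over the interval of [y] and a
    height [j] in the next one. *)
Lemma flatten_split (s : seq A) a t i :
  (forall i, (i < size s)%N -> itv y (nth a s i) (iter i (iet_map y) t)) ->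
  (i < size (flatten [seq W c | c <- s]))%N ->
  exists k j, [/\ (k < size s)%N, (j < size (W (nth a s k)))%N,
    i = (size (flatten [seq W c | c <- take k s]) + j)%N,
    nth a (flatten [seq W c | c <- s]) i = nth (nth a s k) (W (nth a s k)) j
    & iter i (iet_map T) t = iter j (iet_map T) (iter k (iet_map y) t)].
Proof.
elim: s t i => //= c s IH t i h; rewrite size_cat => si.
have [ic|ci] := ltnP i (size (W c)).
  exists 0%N, i; split => //=; rewrite nth_cat ic.
  by apply: set_nth_default.
have [||k [j [ks js ij nk it]]] := IH (iet_map y t) (i - size (W c))%N.
- by move=> k ks; rewrite -iterSr; apply: (h k.+1).
- by rewrite ltn_subLR.
exists k.+1, j; split => //=.
- by rewrite size_cat -addnA -ij subnKC.
- by rewrite nth_cat ltnNge ci /= nk.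
by rewrite -[in LHS](subnK ci) iterD (ind_return ind (h 0%N _)) // it -iterSr.
Qed.

End Concat.

Lemma count_flatten_map W (s : seq A) b :
  count_mem b (flatten [seq W c | c <- s]) =
  (\sum_c count_mem c s * count_mem b (W c))%N.
Proof.
elim: s => [|c s IH] /=; first by rewrite big1.
rewrite count_cat IH; under [RHS]eq_bigr do rewrite mulnDl.
rewrite big_split /=; congr (_ + _)%N.
by rewrite (bigD1 c) //= eqxx mul1n big1 ?addn0 // => e; rewrite eq_sym => /negPf ->.
Qed.

Lemma induced_trans T y z W W' : regular y -> regular z ->
  induced T y W -> induced y z W' -> induced T z (concat W W').
Proof.
move=> ry rz i1 i2; split.
- move=> a; have := ind_nil i2 a; rewrite /concat; case: (W' a) => //= c s _.
  by have := ind_nil i1 c; case: (W c).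
- exact: le_trans (ind_total i2) (ind_total i1).
- move=> a t i at_ ilt.
  have hv k : (k < size (W' a))%N -> _ := ind_visit i2 (i := k) at_.
  have [k [j [ks js _ -> ->]]] := flatten_split i1 hv ilt.
  exact: (ind_visit i1 (hv _ ks)).
- move=> a t i at_ /andP[i0 ilt].
  have hv k : (k < size (W' a))%N -> _ := ind_visit i2 (i := k) at_.
  have [k [j [ks js ij _ ->]]] := flatten_split i1 hv ilt.
  (* At positive height the point is outside the interval of [y], which contains that of [z]; at
     height 0 it is an iterate of [y], to which [i2] applies. *)
  have [j0|j0] := posnP j; last first.
    move=> /(fun h => h) hz; apply: (ind_out i1 (hv _ ks) (i := j)); first by rewrite j0.
    move: hz; rewrite !itv_allE => /andP[-> h]; exact: lt_le_trans h (ind_total i2).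
  have k0 : (0 < k)%N.
    by rewrite lt0n; apply/eqP => k0; move: i0; rewrite ij k0 j0 take0.
  by rewrite j0; apply: (ind_out i2 at_); rewrite k0.
- move=> a t at_.
  have hv k : (k < size (W' a))%N -> _ := ind_visit i2 (i := k) at_.
  by rewrite /concat (iter_flatten i1 hv) (ind_return i2 at_).
- move=> b; rewrite (ind_len i1 b).
  under [RHS]eq_bigr do rewrite count_flatten_map natr_sum mulr_sumr.
  rewrite exchange_big /=; apply: eq_bigr => c _; rewrite (ind_len i2 c) mulr_suml.
  by apply: eq_bigr => a _; rewrite natrM mulrA.
- move=> b; have [k ks kE] := ind_left i2 b; have [j js jE] := ind_left i1 b.
  have hv k' : (k' < size (W' b))%N -> _ := ind_visit i2 (i := k') (left0_itv b rz).
  (* The orbit is at the left endpoint of the interval [b] of [y], so the letter read there is [b],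
     and the time [j] provided for [b] by [i1] can be added. *)
  have nb : nth b (W' b) k = b.
    by apply: (itv_disjoint ry (hv _ ks)); rewrite kE; apply: left0_itv.
  exists (size (flatten [seq W c | c <- take k (W' b)]) + j)%N.
    rewrite /concat -{2}(cat_take_drop k (W' b)) map_cat flatten_cat size_cat ltn_add2l.
    by rewrite (drop_nth b ks) /= size_cat nb ltn_addr.
  rewrite addnC iterD (@iter_flatten T y W i1 _ b); last first.
    move=> i; rewrite size_take ks => ik; rewrite nth_take //; apply: hv.
    exact: ltn_trans ik ks.
  by rewrite size_take ks kE jE.
- by move=> b /(ind_first i1)/(ind_first i2).
Qed.

(** The return at time [size (W a)] bounds the visit times, so [fset_set] is applied to a finite
    set. *)
Lemma visits_count y z W a b : regular y -> regular z -> induced y z W ->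
  visits y z a b = count_mem b (W a).
Proof.
move=> ry rz ind; rewrite /visits.
set S := (X in fset_set X).
pose s := [seq i <- iota 0 (size (W a)) | nth a (W a) i == b].
have SE : S = [set` [fset i in s]%fset].
  apply/seteqP; split => i /=; rewrite !inE /= mem_filter mem_iota add0n /=.
    move=> [h1 h2]; have ilt : (i < size (W a))%N.
      rewrite ltnNge; apply/negP => le; apply: (h1 (size (W a))).
        by rewrite le lt0n size_eq0 (ind_nil ind).
      rewrite (ind_return ind (left0_itv a rz)).
      exact: iet_map_all (left0_itv a rz).
    rewrite ilt andbT; apply/eqP; apply: (itv_disjoint ry _ h2).
    by apply: (ind_visit ind) => //; apply: left0_itv.
  move=> /andP[/eqP nb ilt]; split.
    move=> j /andP[j0 ji]; apply: (ind_out ind (left0_itv a rz)).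
    by rewrite j0 (leq_ltn_trans ji).
  by rewrite -nb; apply: (ind_visit ind) => //; apply: left0_itv.
rewrite SE set_fsetK card_fseq undup_id ?filter_uniq ?iota_uniq // size_filter.
by rewrite -[in RHS](mkseq_nth a (W a)) count_map.
Qed.

End Dynamics.

(** * One Rauzy step, and Keane's condition along the induction *)

Section Rauzy.
Variables (R : realType) (A : finType) (d : nat).
Implicit Types (x y z : iet R A d) (a b c : A) (W : A -> seq A).

Lemma last_letterE (p : {ffun A -> 'I_d.+1}) a : injective p -> p a = ord_max ->
  last_letter p = Some a.
Proof.
move=> ip pa; rewrite /last_letter; case: pickP => [b /eqP pb|/(_ a)].
  by congr Some; apply: ip; rewrite pb pa.
by rewrite pa eqxx.
Qed.

Lemma last_letter_ex (p : {ffun A -> 'I_d.+1}) : #|A| = d.+1 -> injective p ->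
  exists a, p a = ord_max.
Proof.
move=> cA ip; have [|q _ qK] := inj_card_bij ip; first by rewrite card_ord cA.
by exists (q ord_max).
Qed.

Definition loser y a0 a1 : A := if (len y a1 : R) < len y a0 then a1 else a0.

(** If [a1] loses, its points pass through the old interval of [a0] before returning. If [a0] loses,
    its new interval is the right end of the old interval of [a1], mapped onto the old interval of
    [a0]. The word is the same. *)
Definition step_word y : A -> seq A :=
  match last_letter (perm_of y).1, last_letter (perm_of y).2 with
  | Some a0, Some a1 =>
    fun a => if a == loser y a0 a1 then [:: a1; a0] else [:: a]
  | _, _ => fun a => [:: a]
  end.

Section Step.
Variables (y : iet R A d) (a0 a1 : A).
Hypotheses (ry : regular y) (d0 : (0 < d)%N)
  (la0 : (perm_of y).1 a0 = ord_max) (la1 : (perm_of y).2 a1 = ord_max)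
  (a01 : a0 <> a1) (l01 : len y a0 <> len y a1).

Let ip1 : injective (perm_of y).1. Proof. by case: ry. Qed.
Let ip2 : injective (perm_of y).2. Proof. by case: ry. Qed.
Let l0 : forall a, 0 < (len y a : R). Proof. by case: ry. Qed.

Let E0 : left0 y a0 + len y a0 = total_len y.
Proof. exact: row_right_last. Qed.
Let E1 : left1 y a1 + len y a1 = total_len y.
Proof. exact: row_right_last. Qed.

Lemma step_wordE a :
  step_word y a = if a == loser y a0 a1 then [:: a1; a0] else [:: a].
Proof. by rewrite /step_word (last_letterE ip1 la0) (last_letterE ip2 la1). Qed.

Lemma rauzy_topE : (len y a1 : R) < len y a0 -> rauzy y =
  Iet (rauzy_top (perm_of y) a0 a1)
      [ffun a => if a == a0 then (len y a0 : R) - len y a1 else len y a].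
Proof.
by move=> h; rewrite /rauzy (last_letterE ip1 la0) (last_letterE ip2 la1) h.
Qed.

Lemma rauzy_botE : (len y a0 : R) < len y a1 -> rauzy y =
  Iet (rauzy_bot (perm_of y) a0 a1)
      [ffun a => if a == a1 then (len y a1 : R) - len y a0 else len y a].
Proof.
move=> h; rewrite /rauzy (last_letterE ip1 la0) (last_letterE ip2 la1).
by rewrite ltNge (ltW h).
Qed.

(* The two types of Rauzy induction give the same itineraries, and only differ
   by the endpoints of the intervals. *)
Lemma step_induced (l := loser y a0 a1) z : regular z ->
  total_len z = total_len y - len y l ->
  (forall b, (len z b : R) = if (b == a0) || (b == a1) then
     (if b == l then len y l else `|(len y a0 : R) - len y a1|) else len y b) ->
  (forall b, b != a0 \/ l = a1 -> left0 z b = left0 y b) ->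
  (l = a0 -> left0 z a0 = left0 y a1 + len y a1 - len y a0) ->
  (forall b, b != a1 \/ l = a0 -> left1 z b = left1 y b) ->
  (l = a1 -> left1 z a1 = left1 y a0 + len y a0 - len y a1) ->
  (forall b, (perm_of y).1 b = ord0 -> (perm_of z).1 b = ord0) ->
  induced y z (step_word y).
Proof.
move=> rz tz lz z0 z0' z1 z1' zf.
have lz0 : forall b, 0 < (len z b : R) by case: rz.
have lE : (l = a1 /\ (len y a1 : R) < len y a0) \/ (l = a0 /\ (len y a0 : R) < len y a1).
  rewrite /l /loser; case: ltgtP => h; [by left|by right|by case: l01].
have n01 : a0 != a1 by apply/eqP.
have sub b t : b != l -> itv z b t -> itv y b t.
  rewrite !itvE => bl; rewrite lz; have := l0 a0; have := l0 a1.
  case: lE bl => -[le ll]; rewrite le => bl p1 p0.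
    rewrite z0; last by right.
    case: eqP => [->|b0] /=; last by rewrite (negPf bl).
    by rewrite (negPf n01) gtr0_norm ?subr_gt0 //; lra.
  rewrite z0; last by left.
  rewrite (negPf bl) /=; case: eqP => [->|//].
  by rewrite ltr0_norm ?subr_lt0 //; lra.
have map_l t : itv z l t -> [/\ itv y a1 t, itv y a0 (iet_map y t),
    ~ itv_all z (iet_map y t) & iet_map y (iet_map y t) = iet_map z t].
  move=> lt; have h := lt; rewrite itvE lz eqxx in h.
  have y1 : itv y a1 t.
    move: h; rewrite itvE; have := l0 a0; have := l0 a1.
    case: lE => -[le ll]; rewrite le.
      by rewrite eqxx orbT z0 //; right.
    by rewrite eqxx /= z0' //; lra.
  have y2 : itv y a0 (iet_map y t).
    rewrite itvE (iet_mapE ry y1); move: h E0 E1; have := l0 a0; have := l0 a1.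
    case: lE => -[le ll]; rewrite le.
      by rewrite eqxx orbT z0 ?le; [lra|right].
    by rewrite eqxx /= z0' //; lra.
  split=> //.
  - rewrite itv_allE tz (iet_mapE ry y1) => /andP[_]; move: h E0 E1.
    have := l0 a0; have := l0 a1.
    case: lE => -[le ll]; rewrite le.
      by rewrite eqxx orbT z0 ?le; [lra|right].
    by rewrite eqxx /= z0' //; lra.
  - rewrite (iet_mapE ry y2) (iet_mapE ry y1) (iet_mapE rz lt).
    move: E0 E1; case: lE => -[le ll]; rewrite le.
      by rewrite z0 ?z1' //; [lra|right].
    by rewrite z0' // z1; [lra|right].
have map_n b t : b != l -> itv z b t -> iet_map y t = iet_map z t.
  move=> bl bt; rewrite (iet_mapE ry (sub _ _ bl bt)) (iet_mapE rz bt).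
  case: lE => -[le ll]; rewrite le in bl.
    by rewrite z0 ?z1 //; [left|right].
  by rewrite z0 ?z1 //; [right|left].
split.
- by move=> a; rewrite step_wordE; case: ifP.
- by rewrite tz lerBlDr lerDl ltW.
- move=> a t i; rewrite step_wordE; case: eqP => [->|/eqP al] at_.
    by have [? ? _ _] := map_l _ at_; case: i => [|[|]].
  by case: i => // _; apply: sub.
- move=> a t i; rewrite step_wordE; case: eqP => [->|/eqP al] at_.
    by have [_ _ ? _] := map_l _ at_; case: i => [|[|]].
  by case: i => // i; rewrite ltnS ltn0 andbF.
- move=> a t; rewrite step_wordE; case: eqP => [->|/eqP al] at_.
    by have [_ _ _] := map_l _ at_.
  exact: map_n al at_.
- move=> b; under eq_bigr do rewrite step_wordE.
  rewrite (bigD1 l) //= eqxx.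
  have -> : \sum_(i | i != l) (len z i : R) *
      (count_mem b (if i == loser y a0 a1 then [:: a1; a0] else [:: i]))%:R =
      \sum_(i | i != l) (if i == b then len z i : R else 0).
    apply: eq_bigr => i il; rewrite (negPf il) /= addn0.
    by case: eqP; rewrite ?mulr1 ?mulr0.
  rewrite -big_mkcondr /= lz eqxx; case: lE => -[le ll]; rewrite le.
    rewrite eqxx orbT addn0.
    have [->|b1] := eqVneq b a1.
      rewrite (negPf n01) addn0 mulr1 big1 ?addr0 // => i /andP[].
      by move=> /negPf->.
    rewrite (big_pred1 b) => [|i]; last first.
      by rewrite andbC /=; case: eqP => // ->; rewrite b1.
    rewrite lz le (negPf b1) orbF add0n.
    have [->|b0] := eqVneq b a0; last by rewrite mulr0 add0r.
    by rewrite mulr1 gtr0_norm ?subr_gt0 // addrC subrK.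
  rewrite eqxx addn0.
  have [->|b0] := eqVneq b a0.
    rewrite [a1 == a0]eq_sym (negPf n01) add0n mulr1 big1 ?addr0 // => i /andP[].
    by move=> /negPf->.
  rewrite (big_pred1 b) => [|i]; last first.
    by rewrite andbC /=; case: eqP => // ->; rewrite b0.
  rewrite lz le (negPf b0) /= addn0.
  have [->|b1] := eqVneq b a1; last by rewrite mulr0 add0r.
  by rewrite mulr1 ltr0_norm ?subr_lt0 // opprB addrC subrK.
- move=> b; rewrite step_wordE; case: eqP => [->|/eqP bl].
    case: lE => -[le ll]; rewrite -/l le.
      by exists 0%N => //=; apply: z0; right.
    (* When [a0] loses, its new left endpoint lies in the old interval of [a1] and reaches its old
       left endpoint after one step. *)
    exists 1%N => //=; have := left0_itv l rz => h.
    have [y1 _ _ _] := map_l _ h; rewrite le in y1; rewrite (iet_mapE ry y1) z0' //.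
    by move: E0 E1; lra.
  exists 0%N => //=; apply: z0.
  by case: lE => -[le ll]; [right|left; rewrite -le].
- exact: zf.
Qed.

Lemma rauzy_induced : regular (rauzy y) /\ induced y (rauzy y) (step_word y).
Proof.
have a10 : a1 <> a0 by move/esym.
case: (ltgtP (len y a1 : R) (len y a0)) => h; last by case: l01.
  have rE := rauzy_topE h.
  have rr : regular (rauzy y).
    rewrite rE; split => //=; first exact: rauzy_row_inj.
    exact: move_gt0.
  split => //; have lo : loser y a0 a1 = a1 by rewrite /loser h.
  apply: step_induced => //; rewrite ?lo rE.
  - exact: total_move.
  - move=> b; rewrite /= ffunE; case: eqP => [->|b0] /=.
      by case: eqP => // _; rewrite gtr0_norm ?subr_gt0.
    by case: eqP => // ->.
  - by move=> b _; apply: row_left_shorten.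
  - by [].
  - move=> b [/eqP b1|//]; exact: row_left_move.
  - by move=> _; apply: row_left_moved.
  - by [].
have rE := rauzy_botE h.
have rr : regular (rauzy y).
  rewrite rE; split => //=; first exact: rauzy_row_inj.
  exact: move_gt0.
split => //; have lo : loser y a0 a1 = a0 by rewrite /loser ltNge (ltW h).
apply: step_induced => //; rewrite ?lo rE.
- exact: total_move.
- move=> b; rewrite /= ffunE; case: eqP => [->|b1] /=.
    by rewrite orbT; case: eqP => // _; rewrite ltr0_norm ?subr_lt0 // opprB.
  by rewrite orbF; case: eqP => // ->.
- by move=> b [/eqP b0|//]; apply: row_left_move.
- by move=> _; apply: row_left_moved.
- by move=> b _; apply: row_left_shorten.
- by [].
- by move=> b; apply: rauzy_row0.
Qed.

End Step.

(** The action of the visit matrix read on words, where composition becomes concatenation. *)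
Definition word_sum W (h : RA R A) : RA R A := [ffun a => \sum_(c <- W a) (h c : R)].

(** A step adds the winner's coordinate to the loser's, which can be undone; in the degenerate case
    [a0 = a1] it doubles one coordinate. *)
Lemma step_word_inj y : regular y -> injective (word_sum (step_word y)).
Proof.
move=> ry h k hk; rewrite /step_word in hk.
have E a : word_sum (step_word y) h a = word_sum (step_word y) k a by rewrite hk.
move: E; rewrite /step_word.
case: (last_letter (perm_of y).1) => [a0|];
  case: (last_letter (perm_of y).2) => [a1|] E; apply/ffunP => a;
  have := E a; rewrite !ffunE ?big_seq1 //.
case: eqP => [->|_]; last by rewrite !big_seq1.
have [e01|n01] := eqVneq a0 a1.
  have := E a1; rewrite !ffunE /loser e01 if_same eqxx !big_cons !big_nil.
  by rewrite !addr0 => e; lra.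
have lo : loser y a0 a1 = a1 \/ loser y a0 a1 = a0.
  by rewrite /loser; case: ifP; [left|right].
have := E a0; have := E a1; rewrite !ffunE; case: lo => ->.
  rewrite eqxx (negPf n01) !big_seq1 !big_cons !big_nil !addr0 => e1 e2.
  by lra.
rewrite eqxx [a1 == a0]eq_sym (negPf n01) !big_seq1 !big_cons !big_nil !addr0.
by move=> e1 e2; lra.
Qed.

(** If the lengths agree, the induced map sends the left endpoint of [a1] to that of [a0]. The
    orbits of these points under [T] pass through the left endpoints of [a1] and [a0] in [T], before
    the return for the first one, which yields a connection forbidden by Keane's condition. *)
Lemma keane_last y (T : iet R A d) W a0 a1 : regular T -> regular y -> (0 < d)%N ->
  keane T -> induced T y W ->
  (perm_of y).1 a0 = ord_max -> (perm_of y).2 a1 = ord_max -> len y a0 <> len y a1.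
Proof.
move=> rT ry d0 kT ind la0 la1 e.
have [i1 i2 l0] := ry.
have E0 : left0 y a0 + len y a0 = total_len y by apply: row_right_last.
have E1 : left1 y a1 + len y a1 = total_len y by apply: row_right_last.
have ya1 := left0_itv a1 ry.
have m10 : iet_map y (left0 y a1) = left0 y a0.
  by rewrite (iet_mapE ry ya1); move: E0 E1; rewrite e; lra.
have [i isz iE] := ind_left ind a1; have [j jsz jE] := ind_left ind a0.
have := ind_return ind ya1; rewrite m10 => ret.
(* The first letter of [T] stays first, whereas [a0] is last in [y] and there are at least two
   positions. *)
have ne0 : (perm_of T).1 a0 != ord0.
  apply/eqP => /(ind_first ind); rewrite la0 => /(congr1 val) /= de.
  by rewrite de in d0.
have := kT (j + (size (W a1) - i))%N a1 a0.
rewrite addn_gt0 subn_gt0 isz orbT => /(_ isT ne0) /eqP; apply.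
rewrite -iE -jE -ret iterD; congr (iter j _ _).
by rewrite -iterD subnK // ltnW.
Qed.

Fixpoint words y m : A -> seq A :=
  if m is m'.+1 then concat (words y m') (step_word (iter m' (@rauzy R A d) y))
  else fun a => [:: a].

Section Orbit.
Variable T : iet R A d.
Hypotheses (T_iet : is_iet T) (kT : keane T) (d0 : (0 < d)%N).

Lemma iet_card : #|A| = d.+1.
Proof. by case: T_iet => b1 _ _ _; rewrite (bij_eq_card b1) card_ord. Qed.

Lemma iet_regular : regular T.
Proof. by case: T_iet => b1 b2 _ l0; split => //; apply: bij_inj. Qed.

Local Notation S N := (iter N (@rauzy R A d) T).

Lemma step_stage N W : regular (S N) -> induced T (S N) W ->
  regular (S N.+1) /\ induced (S N) (S N.+1) (step_word (S N)).
Proof.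
move=> rS ind; have [i1 i2 l0] := rS.
have [a0 la0] := last_letter_ex iet_card i1.
have [a1 la1] := last_letter_ex iet_card i2.
have ne := keane_last iet_regular rS d0 kT ind la0 la1.
(* Equal letters would have equal lengths, so [ne] excludes [a0 = a1] as well. *)
by apply: (rauzy_induced rS d0 la0 la1) => // e; apply: ne; rewrite e.
Qed.

(** Both claims are proved together: the next step is legitimate by Keane's condition for [T], which
    is accessible only through the itineraries from [T]. *)
Lemma stage_from0 N : regular (S N) /\ induced T (S N) (words T N).
Proof.
elim: N => [|N [rS ind]].
  by split; [exact: iet_regular|apply: induced_refl; exact: iet_regular].
have [rS' ind'] := step_stage rS ind; split => //=.
exact: (induced_trans rS rS' ind ind').
Qed.

Lemma stage_regular N : regular (S N).
Proof. by case: (stage_from0 N). Qed.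

Lemma stage_induced N m : induced (S N) (S (N + m)%N) (words (S N) m).
Proof.
elim: m => [|m IH]; first by rewrite addn0; apply: induced_refl; exact: stage_regular.
have [rS ind] := stage_from0 (N + m)%N.
have [rS' ind'] := step_stage rS ind.
rewrite addnS /=; apply: (induced_trans rS rS' IH).
by rewrite -iterD [(m + N)%N]addnC; exact: ind'.
Qed.

End Orbit.
End Rauzy.

(** * The visit cocycle and the disjointness of towers *)

Section Cocycle.
Variables (R : realType) (A : finType) (d : nat).
Implicit Types (x y z : iet R A d) (a b c : A) (W : A -> seq A) (h : RA R A).

Lemma sum_count (s : seq A) (f : A -> R) :
  \sum_b (count_mem b s)%:R * f b = \sum_(c <- s) f c.
Proof.
elim: s => [|c s IH] /=; first by rewrite big_nil big1 // => b _; rewrite mul0r.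
rewrite big_cons -IH (eq_bigr (fun b => (c == b)%:R * f b + (count_mem b s)%:R * f b)).
  rewrite big_split /=; congr (_ + _).
  rewrite (bigD1 c) //= eqxx mul1r big1 ?addr0 // => b.
  by rewrite eq_sym => /negPf ->; rewrite mul0r.
by move=> b _; rewrite natrD mulrDl.
Qed.

Lemma sum_count_size (s : seq A) : (\sum_b count_mem b s)%N = size s.
Proof.
elim: s => [|c s IH] /=; first by rewrite big1.
rewrite big_split /= IH (bigD1 c) //= eqxx big1 ?addn0 // => b.
by rewrite eq_sym => /negPf ->.
Qed.

Lemma mxnorm_ge (B : A -> A -> R) a : \sum_b `|B a b| <= mxnorm B.
Proof. by rewrite /mxnorm; apply: (le_bigmax_cond _ (fun a => \sum_b `|B a b|)). Qed.

Lemma mxnorm_ge0 (B : A -> A -> R) : 0 <= mxnorm B.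
Proof. by rewrite /mxnorm; apply: bigmax_ge_id. Qed.

Lemma word_sum_concat W W' h :
  word_sum (concat W W') h = word_sum W' (word_sum W h).
Proof.
apply/ffunP => a; rewrite !ffunE /concat big_flatten /= big_map.
by apply: eq_bigr => c _; rewrite ffunE.
Qed.

Section Pair.
Variables (y z : iet R A d) (W : A -> seq A).
Hypotheses (ry : regular y) (rz : regular z) (ind : induced y z W).

Lemma mxact_visit h : mxlin (visit_mx y z) h = word_sum W h.
Proof.
rewrite lfunE; apply/ffunP => a; rewrite !ffunE -(sum_count (W a) h).
by apply: eq_bigr => b _; rewrite /visit_mx (visits_count a b ry rz ind).
Qed.

Lemma visit_row a : \sum_b `|visit_mx y z a b| = (size (W a))%:R :> R.
Proof.
rewrite -sum_count_size natr_sum; apply: eq_bigr => b _.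
by rewrite /visit_mx ger0_norm ?ler0n // (visits_count a b ry rz ind).
Qed.

Lemma size_le_mxnorm a : (size (W a))%:R <= mxnorm (visit_mx y z).
Proof. by rewrite -visit_row; apply: mxnorm_ge. Qed.

Lemma mxnorm_visit_ge1 a : 1 <= mxnorm (visit_mx y z).
Proof.
apply: le_trans (size_le_mxnorm a); rewrite ler1n lt0n size_eq0.
exact: (ind_nil ind).
Qed.

(** Each letter of [z] contributes its length times the height of its tower. This turns ratios of
    lengths into norms of the cocycle. *)
Lemma total_le_mxnorm : total_len y <= mxnorm (visit_mx y z) * total_len z.
Proof.
rewrite /total_len (eq_bigr _ (fun b _ => ind_len ind b)) exchange_big /= mulr_sumr.
apply: ler_sum => a _; rewrite -mulr_sumr -natr_sum sum_count_size mulrC.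
by rewrite ler_wpM2r ?size_le_mxnorm // ltW //; case: rz.
Qed.

Lemma count_len_le a b : (count_mem b (W a))%:R * len z a <= (len y b : R).
Proof.
have [_ _ l0] := rz; rewrite (ind_len ind b) (bigD1 a) //= mulrC lerDl.
by apply: sumr_ge0 => c _; rewrite mulr_ge0 // ltW.
Qed.

Lemma iter_shift a t i : itv z a t -> (i <= size (W a))%N ->
  iter i (iet_map y) t = t + (iter i (iet_map y) (left0 z a) - left0 z a).
Proof.
move=> at_; elim: i => [|i IH] ilt; first by rewrite /= subrr addr0.
rewrite !iterS (iet_mapE ry (ind_visit ind at_ ilt)).
rewrite (iet_mapE ry (ind_visit ind (left0_itv a rz) ilt)).
by rewrite (IH (ltnW ilt)); ring.
Qed.

(** Cancelling [i] steps by injectivity puts [t] on the orbit of [t'] at time [i' - i]; a positive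
    time would be a return before the end of the itinerary. *)
Lemma towers_disjoint a a' t t' i i' : itv z a t -> itv z a' t' ->
  (i < size (W a))%N -> (i' < size (W a'))%N ->
  iter i (iet_map y) t = iter i' (iet_map y) t' -> [/\ a = a', i = i' & t = t'].
Proof.
wlog ii' : a a' t t' i i' / (i <= i')%N.
  move=> H at_ at' si si' e; case: (leqP i i') => [ii|/ltnW ii]; first exact: H.
  by have [-> -> ->] := H a' a t' t i' i ii at' at_ si' si (esym e).
move=> at_ at' si si' e.
have : t = iter (i' - i) (iet_map y) t'.
  move: e; rewrite -{1}(subnK ii') addnC iterD.
  have : (i + (i' - i) < size (W a'))%N by rewrite subnKC.
  move: (i' - i)%N si => k {ii' si'}.
  elim: i => [//|i IH] si sk; rewrite !iterS.
  move=> e; apply: IH; [exact: ltnW|exact: ltnW|].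
  apply: (iet_map_inj ry (ind_visit ind at_ (ltnW si)) _ e).
  rewrite -iterD; apply: (ind_visit ind at'); exact: ltnW.
move=> tE; have e' : i' = i.
  apply/eqP; rewrite eqn_leq ii' andbT leqNgt; apply/negP => lt.
  apply: (ind_out ind at' (i := i' - i)).
    by rewrite subn_gt0 lt (leq_ltn_trans (leq_subr _ _)).
  by rewrite -tE; apply: itv_in_all at_.
move: tE; rewrite e' subnn /= => tt'; split => //.
by rewrite tt' in at_; exact: (itv_disjoint rz at_ at').
Qed.

End Pair.

Section Stages.
Variable T : iet R A d.
Hypotheses (T_iet : is_iet T) (kT : keane T) (d0 : (0 < d)%N).

Local Notation S N := (iter N (@rauzy R A d) T).

Definition cocy (N N' : nat) : 'End(RA R A) := mxlin (visit_mx (S N) (S N')).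

Lemma stage_induced_le N N' : (N <= N')%N ->
  induced (S N) (S N') (words (S N) (N' - N)).
Proof. by move=> le; have := stage_induced T_iet kT d0 N (N' - N); rewrite subnKC. Qed.

Lemma cocyE N N' h : (N <= N')%N -> cocy N N' h = word_sum (words (S N) (N' - N)) h.
Proof.
by move=> le; apply: (mxact_visit _ _ (stage_induced_le le)); apply: stage_regular.
Qed.

Lemma cocy_comp N N' N'' h : (N <= N')%N -> (N' <= N'')%N ->
  cocy N N'' h = cocy N' N'' (cocy N N' h).
Proof.
move=> le le'; have rs := stage_regular T_iet kT d0.
have ind := induced_trans (rs N') (rs N'') (stage_induced_le le) (stage_induced_le le').
by rewrite /cocy (mxact_visit (rs _) (rs _) ind) word_sum_concat -!cocyE.
Qed.

Lemma cocy_id N h : cocy N N h = h.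
Proof.
by rewrite cocyE // subnn /=; apply/ffunP => a; rewrite ffunE big_seq1.
Qed.

Lemma words_inj y m : (forall i, regular (iter i (@rauzy R A d) y)) ->
  injective (@word_sum R A (words y m)).
Proof.
move=> ry; elim: m => [|m IH] h k /=.
  by move=> /ffunP e; apply/ffunP => a; have := e a; rewrite !ffunE !big_seq1.
by rewrite !word_sum_concat => /(step_word_inj (ry m)) /IH.
Qed.

Lemma cocy_inj N N' : (N <= N')%N -> injective (cocy N N').
Proof.
move=> le h k; rewrite !cocyE //; apply: words_inj => i; rewrite -iterD.
exact: stage_regular.
Qed.

Lemma cocy_lker N N' : (N <= N')%N -> lker (cocy N N') == 0%VS.
Proof. by move=> le; apply/lker0P; apply: cocy_inj. Qed.

Lemma cocyK N N' : (N <= N')%N -> cancel (cocy N N') ((cocy N N')^-1)%VF.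
Proof. by move=> le h; rewrite lker0_lfunK // cocy_lker. Qed.

Lemma cocy_surj N N' h : (N <= N')%N -> cocy N N' (((cocy N N')^-1)%VF h) = h.
Proof.
by move=> le; rewrite lker0_lfunVK // cocy_lker.
Qed.

(** Starting from an earlier stage replaces each letter of the itinerary by a nonempty word. *)
Lemma mxnorm_mono N N' N'' : (N <= N')%N -> (N' <= N'')%N ->
  mxnorm (visit_mx (S N') (S N'')) <= mxnorm (visit_mx (S N) (S N'')).
Proof.
move=> le le'; have rs := stage_regular T_iet kT d0.
have i1 := stage_induced_le le; have i2 := stage_induced_le le'.
have ind := induced_trans (rs N') (rs N'') i1 i2.
apply/bigmax_leP; split => [|a _]; first exact: mxnorm_ge0.
rewrite (visit_row (rs N') (rs N'') i2).
apply: le_trans (size_le_mxnorm (rs N) (rs N'') ind a).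
rewrite ler_nat /concat; elim: (words _ _ a) => //= c s IH.
rewrite size_cat -add1n leq_add // lt0n size_eq0; exact: (ind_nil i1).
Qed.

Lemma return_timeE n k a : (n 0%N = 0)%N ->
  return_time T n k a = size (words T (n k) a).
Proof.
move=> n0; have rs := stage_regular T_iet kT d0; rewrite -sum_count_size.
apply: eq_bigr => b _; rewrite /Qn /stage n0 /=.
have := stage_induced_le (leq0n (n k)); rewrite subn0 /= => ind.
exact: visits_count (rs 0%N) (rs (n k)) ind.
Qed.

End Stages.
End Cocycle.

(** * Projections and angles *)

Section Norms.
Variables (R : realType) (A : finType).
Implicit Types (u v w h : RA R A) (V W : {vspace RA R A}) (f : 'End(RA R A)).

Lemma l1norm_ge0 h : 0 <= l1norm h.
Proof. by apply: sumr_ge0 => a _. Qed.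

Lemma l1norm0 : l1norm (0 : RA R A) = 0.
Proof. by rewrite /l1norm big1 // => a _; rewrite ffunE normr0. Qed.

Lemma l1normD u v : l1norm (u + v) <= l1norm u + l1norm v.
Proof.
rewrite /l1norm -big_split /=; apply: ler_sum => a _; rewrite ffunE.
exact: ler_normD.
Qed.

Lemma l1normN u : l1norm (- u) = l1norm u.
Proof. by apply: eq_bigr => a _; rewrite ffunE normrN. Qed.

Lemma l1normB u v : l1norm (u - v) <= l1norm u + l1norm v.
Proof. by rewrite -(l1normN v); apply: l1normD. Qed.

Lemma l1normZ (c : R) u : l1norm (c *: u) = `|c| * l1norm u.
Proof. by rewrite /l1norm mulr_sumr; apply: eq_bigr => a _; rewrite ffunE normrM. Qed.

Lemma l1norm_sum (I : Type) (s : seq I) (P : pred I) (F : I -> RA R A) :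
  l1norm (\sum_(i <- s | P i) F i) <= \sum_(i <- s | P i) l1norm (F i).
Proof.
elim/big_rec2: _ => [|i u v _ le]; first by rewrite l1norm0.
by apply: le_trans (l1normD _ _) _; rewrite lerD2l.
Qed.

Lemma l1norm_coord h a : `|h a : R| <= l1norm h.
Proof. by rewrite /l1norm (bigD1 a) //= lerDl; apply: sumr_ge0. Qed.

Lemma l1norm_eq0 h : l1norm h = 0 -> h = 0.
Proof.
move=> h0; apply/ffunP => a; rewrite ffunE; apply/eqP; rewrite -normr_le0.
by rewrite -h0; apply: l1norm_coord.
Qed.

Lemma lfun_bounded f : exists2 M : R, 0 <= M &
  forall h, l1norm (f h) <= M * l1norm h.
Proof.
pose e a : RA R A := [ffun b => (b == a)%:R].
exists (\sum_a l1norm (f (e a))); first by apply: sumr_ge0 => a _; apply: l1norm_ge0.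
move=> h; have -> : h = \sum_a (h a : R) *: e a.
  apply/ffunP => b; rewrite sum_ffunE (bigD1 b) //= !ffunE eqxx /GRing.scale /= mulr1.
  rewrite big1 ?addr0 // => a ab; rewrite !ffunE eq_sym (negPf ab).
  by rewrite /GRing.scale /= mulr0.
rewrite linear_sum; apply: le_trans (l1norm_sum _ _ _) _.
rewrite mulr_suml; apply: ler_sum => a _; rewrite linearZ l1normZ mulrC.
rewrite ler_wpM2l ?l1norm_ge0 //; apply: le_trans (l1norm_coord _ a).
rewrite sum_ffunE (bigD1 a) //= !ffunE eqxx /GRing.scale /= mulr1.
rewrite big1 ?addr0 // => b ab; rewrite !ffunE eq_sym (negPf ab).
by rewrite /GRing.scale /= mulr0.
Qed.

Lemma opnorm_has_ubound V f :
  has_ubound [set l1norm (f h) | h in [set h | h \in V /\ l1norm h <= 1]].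
Proof.
have [M M0 fM] := lfun_bounded f; exists M => _ [h [_ h1] <-].
by apply: le_trans (fM h) _; rewrite ler_piMr.
Qed.

Lemma opnorm_on_ge0 V f : 0 <= opnorm_on V f.
Proof.
apply: (@le_trans _ _ (l1norm (f 0))); first exact: l1norm_ge0.
apply: ub_le_sup; first exact: opnorm_has_ubound.
by exists 0 => //; rewrite /= mem0v l1norm0.
Qed.

Lemma opnorm_onP V f h : h \in V -> l1norm (f h) <= opnorm_on V f * l1norm h.
Proof.
move=> hV; have [h0|h0] := eqVneq (l1norm h) 0.
  by rewrite (l1norm_eq0 h0) linear0 l1norm0 mulr0.
have hp : 0 < l1norm h by rewrite lt_neqAle eq_sym h0 l1norm_ge0.
rewrite -ler_pdivrMr // mulrC -{1}(gtr0_norm hp) -normfV -l1normZ -linearZ.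
apply: ub_le_sup; first exact: opnorm_has_ubound.
exists ((l1norm h)^-1 *: h) => //=; split; first exact: memvZ.
by rewrite l1normZ normfV gtr0_norm // mulVf.
Qed.

Lemma dotC u v : dot u v = dot v u.
Proof. by apply: eq_bigr => a _; rewrite mulrC. Qed.

Lemma dot_ge0 u : 0 <= dot u u.
Proof. by apply: sumr_ge0 => a _; rewrite -expr2 sqr_ge0. Qed.

Lemma dotDZ (t : R) u v :
  dot (u + t *: v) (u + t *: v) = dot u u + 2 * t * dot u v + t ^+ 2 * dot v v.
Proof.
rewrite /dot !mulr_sumr -!big_split /=; apply: eq_bigr => a _.
by rewrite !ffunE /GRing.scale /=; ring.
Qed.

Lemma dot_gt0 u : u != 0 -> 0 < dot u u.
Proof.
move=> u0; rewrite lt_neqAle dot_ge0 andbT eq_sym; apply: contra u0 => /eqP e.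
apply/eqP/ffunP => a; rewrite ffunE; apply/eqP; rewrite -sqrf_eq0 expr2.
move/eqP: e; rewrite psumr_eq0 => [/allP /(_ a)|b _]; last by rewrite -expr2 sqr_ge0.
by rewrite mem_index_enum => /(_ isT).
Qed.

(* The component of w orthogonal to v is no longer than v + w. *)
Lemma dot_schwarz v w : v != 0 ->
  0 <= dot w w - dot v w ^+ 2 / dot v v <= dot (v + w) (v + w).
Proof.
move=> v0; have vp := dot_gt0 v0; have vn : dot v v != 0 by rewrite gt_eqF.
apply/andP; split.
  have := dot_ge0 (w + (- (dot v w / dot v v)) *: v); rewrite dotDZ (dotC w v).
  by congr (_ <= _); field.
have -> : dot (v + w) (v + w) = dot v v + 2 * dot v w + dot w w.
  by have := dotDZ 1 v w; rewrite scale1r mulr1 expr1n mul1r.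
have : 0 <= (dot v v + dot v w) ^+ 2 / dot v v.
  by rewrite divr_ge0 ?sqr_ge0 // ltW.
have -> : (dot v v + dot v w) ^+ 2 / dot v v =
  dot v v + 2 * dot v w + dot v w ^+ 2 / dot v v by field.
by lra.
Qed.

(** The left-hand side is the squared length of the component of [w] orthogonal to [v]. *)
Lemma sin_angle_sqr v w : v != 0 -> w != 0 ->
  sin (angle v w) ^+ 2 * dot w w <= dot (v + w) (v + w).
Proof.
move=> v0 w0; have vp := dot_gt0 v0; have wp := dot_gt0 w0.
have /andP[sc0 sc1] := dot_schwarz w v0.
have sv : Num.sqrt (dot v v) ^+ 2 = dot v v by rewrite sqr_sqrtr // ltW.
have sw : Num.sqrt (dot w w) ^+ 2 = dot w w by rewrite sqr_sqrtr // ltW.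
set t := dot v w / (Num.sqrt (dot v v) * Num.sqrt (dot w w)).
have t2 : t ^+ 2 * dot w w = dot v w ^+ 2 / dot v v.
  rewrite /t expr_div_n exprMn sv sw; field.
  by rewrite !gt_eqF.
have t1 : t ^+ 2 <= 1.
  by rewrite -(ler_pM2r wp) t2 mul1r; move: sc0; rewrite subr_ge0.
have tb : -1 <= t <= 1 by rewrite -ler_norml -(@expr_le1 _ 2) ?normr_ge0 // real_normK ?num_real.
rewrite /angle -/t sin_acos // sqr_sqrtr ?subr_ge0 // mulrBl mul1r t2.
exact: sc1.
Qed.

Lemma l1norm_le_dot u : l1norm u <= #|A|%:R * Num.sqrt (dot u u).
Proof.
rewrite mulr_natl -sumr_const /=; apply: ler_sum => a _.
rewrite -(ger0_norm (normr_ge0 (u a))) -sqrtr_sqr ler_wsqrtr //.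
rewrite real_normK ?num_real // /dot (bigD1 a) //= expr2 lerDl.
by apply: sumr_ge0 => b _; rewrite -expr2 sqr_ge0.
Qed.

Lemma dot_le_l1norm u : Num.sqrt (dot u u) <= l1norm u.
Proof.
rewrite -(ger0_norm (l1norm_ge0 u)) -sqrtr_sqr ler_wsqrtr // expr2.
rewrite {1}/l1norm mulr_suml; apply: ler_sum => a _.
apply: le_trans (ler_norm _) _; rewrite normrM ler_wpM2l //.
exact: l1norm_coord.
Qed.

Lemma sin_angle_has_lbound V W : has_lbound [set s : R | exists v w,
  [/\ v \in V, v != 0, w \in W, w != 0 & s = `|sin (angle v w)|]].
Proof. by exists 0 => _ [v [w [_ _ _ _ ->]]]. Qed.

Lemma sin_angle_le V W v w : v \in V -> v != 0 -> w \in W -> w != 0 ->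
  sin_angle V W <= `|sin (angle v w)|.
Proof.
move=> vV v0 wW w0; apply: ge_inf; first exact: sin_angle_has_lbound.
by exists v, w.
Qed.

Lemma sin_angle_le1 V W : sin_angle V W <= 1.
Proof.
have [ne|e] := pselect (exists v w : RA R A, [/\ v \in V, v != 0, w \in W & w != 0]).
  have [v [w [vV v0 wW w0]]] := ne.
  by apply: le_trans (sin_angle_le vV v0 wW w0) _; rewrite ler_norml sin_geN1 sin_le1.
(* If one of the spaces is zero, the set is empty and its infimum is 0 by convention. *)
rewrite /sin_angle (_ : [set s | _] = set0) ?inf0 //.
apply/seteqP; split => // s [v [w [vV v0 wW w0 _]]].
by apply: e; exists v, w.
Qed.

(** A lower bound on the angle controls the projection onto [W] along [V]. The factor [#|A|] is the
    price of passing between the l^1 norm and the Euclidean norm that defines angles. *)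
Lemma sin_angle_proj V W v w (s : R) : v \in V -> w \in W -> 0 <= s ->
  s <= sin_angle V W -> s * l1norm w <= #|A|%:R * l1norm (v + w).
Proof.
move=> vV wW s0 sle.
suff : s * Num.sqrt (dot w w) <= Num.sqrt (dot (v + w) (v + w)).
  move=> h; apply: (@le_trans _ _ (s * (#|A|%:R * Num.sqrt (dot w w)))).
    by rewrite ler_wpM2l ?l1norm_le_dot.
  rewrite mulrCA ler_wpM2l ?ler0n //; apply: le_trans h _.
  exact: dot_le_l1norm.
have [->|w0] := eqVneq w 0.
  by rewrite (_ : dot 0 0 = 0) ?sqrtr0 ?mulr0 ?sqrtr_ge0 // /dot big1 // => a _; rewrite !ffunE mul0r.
have [->|v0] := eqVneq v 0.
  by rewrite add0r ler_piMl ?sqrtr_ge0 // (le_trans sle) ?sin_angle_le1.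
rewrite -(ger0_norm s0) -sqrtr_sqr -sqrtrM ?sqr_ge0 // ler_wsqrtr //.
apply: le_trans (sin_angle_sqr v0 w0); rewrite ler_wpM2r ?dot_ge0 //.
rewrite -(real_normK (num_real (sin _))) lerXn2r ?nnegrE //.
exact: le_trans sle (sin_angle_le _ _ _ _).
Qed.

End Norms.

(** * Oscillation of functions with polynomial singularities *)

Section Kernel.
Variable R : realType.
Implicit Types (f F : R -> R) (a L x y s t : R).
Local Notation mu := (@lebesgue_measure R).

(** Both [F - f] and [F + f] have a nonnegative derivative, and the mean value theorem applies to
    each. *)
Lemma derive_le_increment f F (df dF : R -> R) x y : x < y ->
  (forall t, x <= t <= y -> is_derive t 1 f (df t)) ->
  (forall t, x <= t <= y -> is_derive t 1 F (dF t)) ->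
  (forall t, x <= t <= y -> `|df t| <= dF t) ->
  `|f y - f x| <= F y - F x.
Proof.
move=> xy hf hF le.
have H (G dG : R -> R) : (forall t, x <= t <= y -> is_derive t 1 G (dG t)) ->
    (forall t, x <= t <= y -> 0 <= dG t) -> 0 <= G y - G x.
  move=> hG G0; have [||t tI] := @MVT_segment _ G dG x y (ltW xy).
  - by move=> t; rewrite in_itv /= => /andP[h1 h2]; apply: hG; rewrite (ltW h1) (ltW h2).
  - apply: derivable_within_continuous => t; rewrite in_itv /= => tI.
    by have [] := hG t tI.
  - move=> ->; apply: mulr_ge0; last by rewrite subr_ge0 ltW.
    by apply: G0; rewrite in_itv /= in tI.
have h1 := H (F - f) (dF - df) (fun t ti => is_deriveB (hF t ti) (hf t ti)).
have h2 := H (F + f) (dF + df) (fun t ti => is_deriveD (hF t ti) (hf t ti)).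
have {}h1 : 0 <= (F - f) y - (F - f) x.
  apply: h1 => t ti; have := le t ti; rewrite ler_norml => /andP[_ h].
  by rewrite !fctE; lra.
have {}h2 : 0 <= (F + f) y - (F + f) x.
  apply: h2 => t ti; have := le t ti; rewrite ler_norml => /andP[h _].
  by rewrite !fctE; lra.
move: h1 h2; rewrite !fctE ler_norml => h1 h2; apply/andP; split; lra.
Qed.

(* [kern a L s] bounds the integral of t^(-1-a) over [s, s + L]; the exponent
   (1+a)/2, strictly between a and 1, avoids a logarithm when a = 0. *)
Definition kern a L s : R :=
  if s < L then 4 * L `^ ((1 - a) / 2) * s `^ (- ((1 + a) / 2))
  else L * s `^ (- (1 + a)).

Lemma kern_ge0 a L s : 0 < L -> 0 <= kern a L s.
Proof.
by move=> L0; rewrite /kern; case: ifP => _; rewrite !mulr_ge0 ?powR_ge0 // ltW.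
Qed.

Lemma is_derive_affine (e c t : R) : is_derive t 1 (fun u : R => e * (u - c)) e.
Proof.
have -> : (fun u : R => e * (u - c)) = (e \*: (id - cst c)).
  by apply/funext => u; rewrite /= !fctE.
have h : is_derive t 1 (e \*: (id - cst c)) (e *: (1 - 0)).
  by apply: is_deriveZ.
by apply: (is_derive_eq h); rewrite subr0 /GRing.scale /= mulr1.
Qed.

Lemma powR_2L L (b : R) : 0 < L -> 0 <= b <= 1 -> (2 * L) `^ b <= 2 * L `^ b.
Proof.
move=> L0 /andP[b0 b1]; rewrite powRM ?(ltW L0) // ler_wpM2r ?powR_ge0 //.
by rewrite -[leRHS]powRr1 // ler_powR // ler1n.
Qed.

(* The sign e distinguishes the singularity at a left endpoint c (e = 1) from
   the one at a right endpoint (e = -1). *)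
Lemma kern_majorant a L x y (e c : R) : 0 <= a < 1 -> 0 < L -> x < y ->
  e = 1 \/ e = -1 ->
  0 < e * (x - c) -> 0 < e * (y - c) -> y - x <= L ->
  exists G dG : R -> R, [/\ forall t, x <= t <= y -> is_derive t 1 G (dG t),
    forall t, x <= t <= y -> (e * (t - c)) `^ (- (1 + a)) <= dG t &
    G y - G x <= kern a L (if e == 1 then x - c else c - y)].
Proof.
move=> /andP[a0 a1] L0 xy ee px py yxL.
set s0 := if e == 1 then x - c else c - y.
have s0p : 0 < s0.
  rewrite /s0; case: ee px py => ->; first by rewrite eqxx !mul1r.
  by rewrite lt_eqF //; lra.
have st t : x <= t <= y -> s0 <= e * (t - c) <= s0 + L.
  move=> ti; rewrite /s0; case: ee => ->; first by rewrite eqxx mul1r; lra.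
  by rewrite lt_eqF //; lra.
rewrite /kern; case: ltP => sL; last first.
  (* Far from the singularity the integrand is bounded by its value at the smallest distance
     [s0]. *)
  pose K := s0 `^ (- (1 + a)).
  exists (fun t => K * (t - 0)), (fun=> K); split.
  - by move=> t _; apply: is_derive_affine.
  - move=> t /st /andP[h _]; rewrite /K !powRN lef_pV2 ?posrE ?powR_gt0 //.
      by apply: ge0_ler_powR => //; rewrite ?nnegrE; lra.
    exact: lt_le_trans h.
  - rewrite !subr0 -mulrBr mulrC -/K ler_wpM2r ?powR_ge0 //.
(* Near the singularity distances stay below [2 * L]. As g - b = -a, one has s^(-1-a) = s^g s^(-b-1)
   <= (2L)^g s^(-b-1), whose primitive is a multiple of s^(-b). *)
set b := (1 + a) / 2; set g := (1 - a) / 2.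
have b0 : 0 < b by rewrite /b; lra.
have g01 : 0 <= g <= 1 by rewrite /g; lra.
pose K := (2 * L) `^ g.
have K0 : 0 <= K by apply: powR_ge0.
exists (fun t => - e * (K / b) * (e * (t - c)) `^ (- b)).
exists (fun t => K * (e * (t - c)) `^ (- b - 1)).
have e2 : e * e = 1 by case: ee => ->; lra.
split.
- move=> t /st /andP[h _]; have sp := lt_le_trans s0p h.
  have h1 : is_derive t 1 ((fun u => u `^ (- b)) \o (fun u => e * (u - c)))
      (- b * (e * (t - c)) `^ (- b - 1) * e).
    apply: is_derive1_comp; last exact: is_derive_affine.
    exact: is_derive1_powR.
  have -> : (fun t => - e * (K / b) * (e * (t - c)) `^ (- b)) =
     (- e * (K / b)) \*: ((fun u => u `^ (- b)) \o (fun u => e * (u - c))).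
    by apply/funext => u.
  apply: (is_derive_eq (is_deriveZ _ h1)); rewrite /GRing.scale /=.
  rewrite (_ : - e * (K / b) * (- b * (e * (t - c)) `^ (- b - 1) * e) =
    e * e * (K * (e * (t - c)) `^ (- b - 1))); last by field; rewrite gt_eqF.
  by rewrite e2 mul1r.
- move=> t /st /andP[h h']; have sp := lt_le_trans s0p h.
  rewrite (_ : - (1 + a) = g + (- b - 1)); last by rewrite /g /b; field.
  rewrite powRD ?(gt_eqF sp) ?implybT // ler_wpM2r ?powR_ge0 //.
  by apply: ge0_ler_powR; rewrite ?nnegrE; lra.
- have H u v : 0 < u -> 0 < v ->
      - (K / b) * v `^ (- b) - (- (K / b) * u `^ (- b)) <= 4 * L `^ g * u `^ (- b).
    move=> u0 v0; apply: (@le_trans _ _ (K / b * u `^ (- b))).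
      have : 0 <= K / b * v `^ (- b) by rewrite mulr_ge0 ?powR_ge0 // divr_ge0 // ltW.
      by lra.
    rewrite ler_wpM2r ?powR_ge0 // ler_pdivrMr //.
    (* The factor 4 in [kern] comes from (2L)^g <= 2 L^g and 1/b <= 2. *)
    apply: (le_trans (powR_2L L0 g01)).
    have := powR_ge0 L g; move: (L `^ g) => p p0.
    rewrite (_ : 4 * p * b = 2 * p * (2 * b)); last by ring.
    by rewrite ler_peMr ?mulr_ge0 //; rewrite /b; lra.
  rewrite /s0; case: ee px py => -> px py.
    rewrite eqxx; have := H _ _ px py; rewrite !mulN1r !mul1r !mulNr /=; lra.
  rewrite lt_eqF; last lra.
  have := H _ _ py px; rewrite !mulN1r opprK !opprB; lra.
Qed.

(** On [[x, y]] the left singularity is closest to [x] and the right one to [y], so each kernel is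
    evaluated at a single endpoint. *)
Lemma singular_oscillation f a L P l r x y : 0 <= a < 1 -> 0 < L -> 0 <= P ->
  (forall t, l < t < r -> derivable f t 1) ->
  (forall t, l < t < r -> `|derive1 f t| <=
     P * ((t - l) `^ (- (1 + a)) + (r - t) `^ (- (1 + a)))) ->
  l < x -> x < y -> y < r -> y - x <= L ->
  `|f y - f x| <= P * (kern a L (x - l) + kern a L (r - y)).
Proof.
move=> a01 L0 P0 df bf lx xy yr yxL.
have [|||G [dG [h1 h2 h3]]] := @kern_majorant a L x y 1 l a01 L0 xy (or_introl erefl).
- by lra.
- by lra.
- by [].
have [|||G' [dG' [h1' h2' h3']]] := @kern_majorant a L x y (-1) r a01 L0 xy (or_intror erefl).
- by lra.
- by lra.
- by [].
rewrite eqxx in h3; rewrite lt_eqF in h3'; last by lra.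
have h t : x <= t <= y -> l < t < r by move=> /andP[? ?]; apply/andP; split; lra.
have H : `|f y - f x| <= (P \*: (G + G')) y - (P \*: (G + G')) x.
  apply: (@derive_le_increment f _ (derive1 f) (P \*: (dG + dG'))) => //.
  - by move=> t /h lt; rewrite derive1E; apply/derivableP/df.
  - by move=> t ti; apply: is_deriveZ; apply: is_deriveD; [apply: h1|apply: h1'].
  - move=> t ti; apply: le_trans (bf t (h t ti)) _; rewrite /= ler_wpM2l // fctE.
    apply: lerD; first by have := h2 t ti; rewrite mul1r.
    by have := h2' t ti; rewrite mulN1r opprB.
apply: (le_trans H); rewrite /= !fctE -mulrBr ler_wpM2l //.
by lra.
Qed.

End Kernel.

(** * Integrals of the kernel *)

Section KernelIntegral.
Variable R : realType.
Implicit Types (f F : R -> R) (a L x y s t : R).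
Local Notation mu := (@lebesgue_measure R).

Lemma measurable_fun_derivable f (l r : R) :
  (forall t, l < t < r -> derivable f t 1) -> measurable_fun `]l, r[ f.
Proof.
move=> df; apply: subspace_continuous_measurable_fun => //.
by apply: derivable_within_continuous => t; rewrite in_itv /= => /df.
Qed.

(** The primitive is available only to the right of [c]: the fundamental theorem is applied on
    [c + 1/(n+1), e], and these intervals exhaust []c, e]]. *)
Lemma integral_le_primitive f F (c e B : R) : c < e -> 0 <= B ->
  (forall t, c < t -> 0 <= f t) ->
  (forall t, c < t -> {for t, continuous f}) ->
  (forall t, c < t -> is_derive t 1 F (f t)) ->
  (forall t, c < t -> t <= e -> F e - F t <= B) ->
  (\int[mu]_(t in `]c, e]) (f t)%:E <= B%:E)%E.
Proof.
move=> ce B0 f0 fc fF FB.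
have mf : measurable_fun `]c, e] f.
  apply: subspace_continuous_measurable_fun => //.
  apply: continuous_in_subspaceT => t; rewrite inE /= in_itv /= => /andP[ct _].
  exact: fc.
rewrite itv_open_bnd_bigcup.
have key n : (\int[mu]_(t in `[(c + n.+1%:R^-1)%R, e]) (f t)%:E <= B%:E)%E.
  have cn : c < c + n.+1%:R^-1 by rewrite ltrDl invr_gt0 ltr0n.
  case: (ltP (c + n.+1%:R^-1) e) => ne; last first.
    have [->|ne'] := eqVneq (c + n.+1%:R^-1) e.
      by rewrite set_itv1 integral_set1 lee_fin.
    rewrite set_itv_ge ?integral_set0 ?lee_fin //= bnd_simp -ltNge.
    by rewrite lt_neqAle eq_sym ne' ne.
  rewrite (@continuous_FTC2 _ f F) //.
  - by rewrite -EFinB lee_fin FB // ltW.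
  - apply: continuous_in_subspaceT => t; rewrite inE /= in_itv /= => /andP[ct _].
    by apply: fc; apply: lt_le_trans ct.
  - have dF t : c < t -> derivable F t 1 by move=> /fF[].
    split.
    + by move=> t; rewrite in_itv /= => /andP[h _]; apply: dF; apply: lt_trans h.
    + apply: cvg_at_right_filter; apply/differentiable_continuous/derivable1_diffP.
      exact: dF.
    + apply: cvg_at_left_filter; apply/differentiable_continuous/derivable1_diffP.
      exact: dF.
  - move=> t; rewrite in_itv /= => /andP[h _]; rewrite derive1E.
    by apply: derive_val; apply: fF; apply: lt_trans h.
have nd : nondecreasing_seq (fun n => `[c + n.+1%:R^-1, e]%classic).
  move=> m n mn; apply/subsetPset; apply: subset_itvr; rewrite bnd_simp lerD2l.
  by rewrite lef_pV2 ?posrE ?ltr0n // ler_nat.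
have cv := @ge0_nondecreasing_set_cvg_integral _ (measurableTypeR R) R
  (fun n => `[c + n.+1%:R^-1, e]%classic) (EFin \o f) mu nd.
apply: (cvge_to_le (cv _ _ _)).
- by move=> n; apply: measurable_itv.
- move=> n; apply/measurable_EFinP; apply: measurable_funS mf => //.
  by apply: subset_itvr; rewrite bnd_simp ltrDl invr_gt0 ltr0n.
- move=> n t; rewrite /= in_itv /= => /andP[h _]; rewrite lee_fin f0 //.
  by apply: lt_le_trans h; rewrite ltrDl invr_gt0 ltr0n.
- by apply: nearW.
Qed.

Lemma measurable_kern a L : measurable_fun setT (kern a L).
Proof.
apply: measurable_fun_ifT.
- exact: measurable_fun_ltr.
- apply: measurable_funM => //; exact: measurable_powR.
- apply: measurable_funM => //; exact: measurable_powR.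
Qed.

Lemma continuous_powRr (p t : R) : 0 < t -> {for t, continuous (fun s => s `^ p)}.
Proof.
move=> t0; apply/differentiable_continuous/derivable1_diffP.
by have [] := is_derive1_powR p t0.
Qed.

Lemma bracket_ge0 a s : 1 <= s -> 0 <= bracket a s.
Proof.
move=> s1; rewrite /bracket; case: ifP => _; last exact: powR_ge0.
by rewrite addr_ge0 // ln_ge0.
Qed.

Lemma le_bracket a s t : 0 <= a -> 1 <= s -> s <= t -> bracket a s <= bracket a t.
Proof.
move=> a0 s1 st; rewrite /bracket; case: ifP => _.
  by rewrite lerD2l ler_ln ?posrE //; lra.
by apply: ge0_ler_powR; rewrite ?nnegrE //; lra.
Qed.

(** With g = (1-a)/2, integrating 4 L^g s^(g-1) gives 4 L^(2g) / g, hence the constant 8/(1-a). *)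
Lemma integral_kern_near0 a L : 0 <= a < 1 -> 0 < L ->
  (\int[mu]_(s in `]0%R, L]) (kern a L s)%:E <= (8 / (1 - a) * L `^ (1 - a))%:E)%E.
Proof.
move=> a01 L0; set g := (1 - a) / 2.
have g0 : 0 < g by rewrite /g; lra.
apply: (@le_trans _ _ (\int[mu]_(s in `]0%R, L]) (4 * L `^ g * s `^ (g - 1))%:E)%E).
  apply: ge0_le_integral => //.
  - by move=> s _; rewrite lee_fin kern_ge0.
  - by apply/measurable_EFinP; apply: measurable_funTS; apply: measurable_kern.
  - apply/measurable_EFinP; apply: measurable_funTS.
    by apply: measurable_funM; [exact: measurable_cst|exact: measurable_powR].
  move=> s; rewrite /= in_itv /= => /andP[s0 sL]; rewrite lee_fin /kern.
  have e : - ((1 + a) / 2) = g - 1 by rewrite /g; field.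
  rewrite -/g e; case: ltP => // Ls.
  (* Only at this endpoint does the other branch of [kern] apply. *)
  have -> : s = L by apply/eqP; rewrite eq_le sL Ls.
  rewrite -mulrA -powRD ?(gt_eqF L0) ?implybT //.
  rewrite -{1}(powRr1 (ltW L0)) -powRD ?(gt_eqF L0) ?implybT //.
  have -> : 1 + - (1 + a) = g + (g - 1) by rewrite /g; field.
  by rewrite ler_peMl ?powR_ge0 // ler1n.
apply: (@integral_le_primitive (fun s => 4 * L `^ g * s `^ (g - 1))
  (fun s => 4 * L `^ g / g * s `^ g) 0 L _ L0).
- by rewrite mulr_ge0 ?powR_ge0 // divr_ge0 //; lra.
- by move=> t t0; rewrite !mulr_ge0 // powR_ge0.
- move=> t t0; apply: cvgM; first exact: cvg_cst.
  exact: continuous_powRr.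
- move=> t t0; have h := is_deriveZ (4 * L `^ g / g) (is_derive1_powR g t0).
  apply: (is_derive_eq h); rewrite /GRing.scale /=; field.
  by rewrite gt_eqF.
- move=> t t0 tL; apply: (@le_trans _ _ (4 * L `^ g / g * L `^ g)).
    by rewrite lerBlDr lerDl !mulr_ge0 ?powR_ge0 // invr_ge0 ltW.
  have -> : 1 - a = g + g by rewrite /g; field.
  rewrite powRD ?(gt_eqF L0) ?implybT //.
  rewrite (_ : 4 * L `^ g / g * L `^ g = 8 / (g + g) * (L `^ g * L `^ g)) //.
  by field; rewrite !gt_eqF ?addr_gt0.
Qed.

Lemma integral_kern_far a L X : 0 <= a < 1 -> 0 < L -> L <= X ->
  (\int[mu]_(s in `]L, X]) (kern a L s)%:E <=
   (L * if a == 0%R then ln (X / L) else L `^ (- a) / a)%:E)%E.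
Proof.
move=> a01 L0; rewrite le_eqVlt => /predU1P[<-|LX].
  rewrite set_itv_ge ?integral_set0 ?bnd_simp ?ltxx // lee_fin mulr_ge0 ?(ltW L0) //.
  case: ifP => _; first by rewrite ln_ge0 // divff ?gt_eqF.
  by rewrite divr_ge0 ?powR_ge0 //; lra.
have X0 : 0 < X by lra.
under eq_integral => s.
  rewrite inE /= in_itv /= => /andP[sL _]; rewrite /kern ltNge (ltW sL) /=.
  over.
have hc t : L < t -> {for t, continuous (fun s => L * s `^ (- (1 + a)))}.
  move=> Lt; apply: cvgM; first exact: cvg_cst.
  by apply: continuous_powRr; apply: lt_trans Lt.
have h0 t : L < t -> 0 <= L * t `^ (- (1 + a)).
  by move=> _; rewrite mulr_ge0 ?powR_ge0 // ltW.
have [a0|a0] := eqVneq a 0.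
  apply: (@integral_le_primitive (fun s => L * s `^ (- (1 + a)))
    (fun s => L * ln s) L X _ LX _ h0 hc).
  - by rewrite mulr_ge0 ?ln_ge0 ?(ltW L0) // ler_pdivlMr // mul1r ltW.
  - move=> t Lt; have t0 := lt_trans L0 Lt.
    apply: (is_derive_eq (is_deriveZ L (is_derive1_ln t0))).
    by rewrite /GRing.scale /= a0 addr0 powR_inv1 // ltW.
  - move=> t Lt tX; have t0 := lt_trans L0 Lt.
    rewrite -mulrBr ler_wpM2l ?(ltW L0) // ln_div ?posrE // lerD2l lerN2.
    by rewrite ler_ln ?posrE // ltW.
have ap : 0 < a by rewrite lt_neqAle eq_sym a0; case/andP: a01.
apply: (@integral_le_primitive (fun s => L * s `^ (- (1 + a)))
  (fun s => - (L / a) * s `^ (- a)) L X _ LX _ h0 hc).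
- by rewrite !mulr_ge0 ?powR_ge0 ?invr_ge0 // ltW.
- move=> t Lt; have t0 := lt_trans L0 Lt.
  apply: (is_derive_eq (is_deriveZ (- (L / a)) (is_derive1_powR (- a) t0))).
  by rewrite /GRing.scale /= -opprD [a + 1]addrC; field.
- move=> t Lt tX; have t0 := lt_trans L0 Lt.
  apply: (@le_trans _ _ (L / a * t `^ (- a))).
    have : 0 <= L / a * X `^ (- a) by rewrite mulr_ge0 ?powR_ge0 // divr_ge0 // ltW.
    by lra.
  rewrite -mulrA ler_wpM2l ?(ltW L0) // mulrC ler_wpM2r ?invr_ge0 ?(ltW ap) //.
  rewrite !powRN lef_pV2 ?posrE ?powR_gt0 //.
  by apply: ge0_ler_powR; rewrite ?nnegrE ltW.
Qed.

(** For a > 0 the bound is C L^(1-a). It is written with the ratio [X / L] because that ratio is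
    what the norm of the cocycle bounds, and because this form also covers the logarithm at a =
    0. *)
Lemma integral_kern a : 0 <= a < 1 -> exists2 C, 0 <= C & forall L X : R,
  0 < L -> L <= X -> (\int[mu]_(s in `]0%R, X[) (kern a L s)%:E <=
    (C * L * X `^ (- a) * bracket a (X / L))%:E)%E.
Proof.
move=> a01; have /andP[a0 a1] := a01.
exists (8 / (1 - a) + if a == 0 then 1 else a^-1).
  rewrite addr_ge0 ?divr_ge0 //; first lra.
  by case: ifP => // _; rewrite invr_ge0.
move=> L X L0 LX; have X0 : 0 < X by lra.
have mk D : measurable_fun D (fun s => (kern a L s)%:E).
  by apply/measurable_EFinP; apply: measurable_funTS; apply: measurable_kern.
apply: (@le_trans _ _ (\int[mu]_(s in `]0%R, L] `|` `]L, X]) (kern a L s)%:E)%E).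
  apply: ge0_subset_integral => //; first exact: measurableU.
  - exact: mk.
  - by move=> s _; rewrite lee_fin kern_ge0.
  move=> s; rewrite /= !in_itv /= => /andP[s0 sX].
  by case: (leP s L) => h; [left; rewrite s0|right; rewrite ltW].
rewrite ge0_integral_setU //.
- apply: le_trans (leeD (integral_kern_near0 a01 L0) (integral_kern_far a01 L0 LX)) _.
  rewrite -EFinD lee_fin /bracket.
  have L1 : L `^ (1 - a) = L * L `^ (- a).
    by rewrite powRD ?(gt_eqF L0) ?implybT // powRr1 // ltW.
  have h8 : 0 <= 8 / (1 - a) by rewrite divr_ge0 //; lra.
  have [e|e] := eqVneq a 0.
    rewrite L1 e oppr0 !powRr0 !mulr1 addr0 divr1.
    have : 0 <= L * ln (X / L).
      by rewrite mulr_ge0 ?(ltW L0) // ln_ge0 // ler_pdivlMr // mul1r.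
    by lra.
  have E : X `^ (- a) * (X / L) `^ a = L `^ (- a).
    rewrite powRM ?invr_ge0 ?(ltW X0) ?(ltW L0) // mulrA.
    rewrite -powRD ?(gt_eqF X0) ?implybT // addNr powRr0 mul1r.
    by rewrite -powR_inv1 ?(ltW L0) // -powRrM mulN1r.
  rewrite -[_ * X `^ (- a) * _]mulrA E L1; move: (L `^ (- a)) (8 / (1 - a)) => p q.
  by have -> : q * (L * p) + L * (p / a) = (q + a^-1) * L * p by ring.
- exact: mk.
- by move=> s _; rewrite lee_fin kern_ge0.
- apply/disj_setPS => s [] /=; rewrite !in_itv /= => /andP[_ h] /andP[h' _].
  by have := lt_le_trans h' h; rewrite ltxx.
Qed.

End KernelIntegral.

(** * Changes of variables and averages over intervals *)

Section Averages.
Variable R : realType.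
Implicit Types (f g h : R -> R) (u v q x y s t : R).
Local Notation mu := (@lebesgue_measure R).

Section Isometry.
Variable u : R -> R.
Hypothesis mu_ : measurable_fun setT u.
Hypothesis uP : forall p q : R, mu (u @^-1` `]p, q]) = mu `]p, q].

(** Lebesgue measure is determined by half-open intervals. This serves translations, for tower
    levels, and reflections, for singularities at right endpoints. *)
Lemma pushforward_isometry (D : set R) : measurable D ->
  pushforward mu (u : _ -> measurableTypeR R) D = mu D.
Proof.
move=> mD; apply/esym/lebesgue_measure_unique => //= _ [[p q]] _ <-.
by rewrite /pushforward uP.
Qed.

Lemma ge0_integral_isometry (D : set R) (f : R -> \bar R) : measurable D ->
  measurable_fun D f -> (forall x, 0 <= f x)%E ->
  (\int[mu]_(x in u @^-1` D) f (u x) = \int[mu]_(x in D) f x)%E.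
Proof.
move=> mD mf f0.
transitivity (\int[pushforward mu (u : _ -> measurableTypeR R)]_(y in D) f y)%E.
  by rewrite ge0_integral_pushforward.
by apply: eq_measure_integral => //= E mE _; apply: pushforward_isometry.
Qed.

Lemma integral_isometry (D : set R) (f : R -> \bar R) : measurable D ->
  measurable_fun D f ->
  (\int[mu]_(x in u @^-1` D) f (u x) = \int[mu]_(x in D) f x)%E.
Proof.
move=> mD mf; rewrite integralE [RHS]integralE.
rewrite -(ge0_integral_isometry mD (measurable_funepos mf)); last first.
  by move=> x; apply: funepos_ge0.
rewrite -(ge0_integral_isometry mD (measurable_funeneg mf)); last first.
  by move=> x; apply: funeneg_ge0.
have -> : (fun x => f (u x)) = f \o u by [].
by rewrite funepos_comp funeneg_comp.
Qed.

End Isometry.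

Lemma shift_isometry (c p q : R) :
  mu ((fun x => x + c) @^-1` `]p, q]) = mu `]p, q].
Proof.
have -> : (fun x => x + c) @^-1` `]p, q] = `]p - c, q - c]%classic.
  by apply/seteqP; split => x /=; rewrite !in_itv /= ltrBlDr lerBrDr.
rewrite !lebesgue_measure_itv /= !lte_fin ltrD2r -!EFinB.
by case: ifP => // _; congr (_%:E); lra.
Qed.

Lemma reflect_isometry (c p q : R) :
  mu ((fun x => c - x) @^-1` `]p, q]) = mu `]p, q].
Proof.
have -> : (fun x => c - x) @^-1` `]p, q] = `[c - q, c - p[%classic.
  by apply/seteqP; split => x /=; rewrite !in_itv /=; lra.
rewrite !lebesgue_measure_itv /= !lte_fin ltrD2l ltrN2 -!EFinB.
by case: ifP => // _; congr (_%:E); lra.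
Qed.

Lemma measurable_shift (c : R) : measurable_fun setT (fun x : R => x + c).
Proof. by apply: measurable_funD. Qed.

Lemma measurable_reflect (c : R) : measurable_fun setT (fun x : R => c - x).
Proof. by apply: measurable_funB. Qed.

(** The interval is open because a function of [PaG] is controlled only inside the exchanged
    intervals. *)
Definition itg f q (l : R) : R := (\int[mu]_(t in `]q, (q + l)%R[) f t)%R.
Definition avg f q (l : R) : R := l^-1 * itg f q l.
Definition integrable_oo f q (l : R) : Prop :=
  mu.-integrable `]q, q + l[ (EFin \o f).

Lemma mu_oo q (l : R) : 0 < l -> mu `]q, q + l[%classic = l%:E.
Proof.
move=> l0; rewrite lebesgue_measure_itv /= lte_fin ltrDl l0 -EFinB.
by rewrite addrAC subrr add0r.
Qed.

Lemma cst_oo (c q l : R) : integrable_oo (fun=> c) q l.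
Proof.
apply/integrableP; split; first exact/measurable_EFinP.
rewrite integral_cst //= lebesgue_measure_itv /=; case: ifP => _.
  by rewrite -EFinB -EFinM ltry.
by rewrite mule0 ltry.
Qed.

Lemma avg_near f g q (l c : R) : 0 < l ->
  integrable_oo f q l -> integrable_oo g q l ->
  (forall x, q < x < q + l -> `|f x - c| <= g x) ->
  `|avg f q l - c| <= avg g q l.
Proof.
move=> l0 intf intg fg.
have mD : measurable (`]q, q + l[%classic : set R) by [].
have E (e : R) : c * l + e * itg g q l = itg (fun x => c + e * g x) q l.
  rewrite /itg RintegralD ?RintegralZl ?Rintegral_cst /= ?mu_oo //.
    exact: cst_oo.
  have -> : EFin \o (fun x => e * g x) = (fun x => e%:E * (EFin \o g) x)%E.
    by apply/funext => x; rewrite /= EFinM.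
  exact: integrableZl.
have intE e : integrable_oo (fun x => c + e * g x) q l.
  rewrite /integrable_oo; have -> : EFin \o (fun x => c + e * g x) =
     ((EFin \o cst c) \+ (fun x => e%:E * (EFin \o g) x))%E.
    by apply/funext => x; rewrite /= EFinD EFinM.
  by apply: integrableD => //; [exact: cst_oo|exact: integrableZl].
have h1 : itg f q l <= c * l + 1 * itg g q l.
  rewrite E; apply: le_Rintegral => //; first exact: intE.
  move=> x; rewrite /= in_itv /= => /fg.
  by rewrite ler_norml => /andP[_]; lra.
have h2 : c * l + -1 * itg g q l <= itg f q l.
  rewrite E; apply: le_Rintegral => //; first exact: intE.
  move=> x; rewrite /= in_itv /= => /fg.
  by rewrite ler_norml => /andP[]; lra.
have li : l^-1 * l = 1 by rewrite mulVf // gt_eqF.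
have l'0 : 0 <= l^-1 by rewrite invr_ge0 ltW.
have {}h1 := ler_wpM2l l'0 h1; have {}h2 := ler_wpM2l l'0 h2.
rewrite mulrDr (mulrCA _ c) li mulr1 mul1r in h1.
rewrite mulrDr (mulrCA _ c) li mulr1 mulN1r mulrN in h2.
by rewrite ler_norml /avg; apply/andP; split; lra.
Qed.

Lemma avgZD (e b : R) g q (l : R) : 0 < l -> integrable_oo g q l ->
  avg (fun x => e * g x + b) q l = e * avg g q l + b.
Proof.
move=> l0 intg; rewrite /avg /itg RintegralD //; last 2 first.
- have -> : EFin \o (fun x => e * g x) = (fun x => e%:E * (EFin \o g) x)%E.
    by apply/funext => x; rewrite /= EFinM.
  exact: integrableZl.
- exact: cst_oo.
rewrite RintegralZl // Rintegral_cst //= mu_oo //= mulrDr mulrCA; congr (_ + _).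
by rewrite mulrCA mulVf ?mulr1 // gt_eqF.
Qed.

Lemma integrable_ooZD (e b : R) g q (l : R) : integrable_oo g q l ->
  integrable_oo (fun x => e * g x + b) q l.
Proof.
move=> intg.
rewrite /integrable_oo; have -> : EFin \o (fun x => e * g x + b) =
   ((fun x => e%:E * (EFin \o g) x) \+ (EFin \o cst b))%E.
  by apply/funext => x; rewrite /= EFinD EFinM.
by apply: integrableD => //; [exact: integrableZl|exact: cst_oo].
Qed.

Lemma integrable_ooS f q q' (l l' : R) : q <= q' -> q' + l' <= q + l ->
  integrable_oo f q l -> integrable_oo f q' l'.
Proof.
move=> h1 h2; apply: integrableS => // x; rewrite /= !in_itv /=.
by move=> /andP[h3 h4]; apply/andP; split; lra.
Qed.

(** The oscillation bound is averaged over [x] in the small interval with [y] fixed, then over [y]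
    in the large one. *)
Lemma avg_oscillation f k (P p u dl l : R) : 0 < dl -> 0 < l ->
  u <= p -> p + dl <= u + l ->
  integrable_oo f u l -> integrable_oo k u l ->
  (forall x y, u < x < u + l -> u < y < u + l -> `|f x - f y| <= P * (k x + k y)) ->
  `|avg f p dl - avg f u l| <= P * (avg k p dl + avg k u l).
Proof.
move=> d0 l0 up pu intf intk osc.
have intf' := integrable_ooS up pu intf; have intk' := integrable_ooS up pu intk.
have step y : u < y < u + l -> `|avg f p dl - f y| <= P * avg k p dl + P * k y.
  move=> yI; rewrite -avgZD //; apply: avg_near => //; first exact: integrable_ooZD.
  move=> x /andP[px xp]; rewrite -mulrDr; apply: osc => //; apply/andP; split; lra.
rewrite distrC mulrDr [leRHS]addrC -avgZD //; apply: avg_near => //.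
  exact: integrable_ooZD.
by move=> y yI; rewrite distrC [leRHS]addrC; apply: step.
Qed.

Lemma integrable_shift f q (c l : R) : integrable_oo f (q + c) l ->
  integrable_oo (fun x => f (x + c)) q l.
Proof.
have pre : `]q, q + l[%classic = (fun x => x + c) @^-1` `](q + c), (q + c + l)[.
  apply/seteqP; split => x; rewrite /= !in_itv /= => /andP[h1 h2];
    by apply/andP; split; lra.
move=> /integrableP[mf fi]; apply/integrableP; split.
  apply: (measurable_comp _ _ mf (measurable_funTS (measurable_shift c))) => //.
  by move=> _ [x + <-]; rewrite pre.
move: fi; rewrite pre.
rewrite -(ge0_integral_isometry (measurable_shift c) (shift_isometry c)) //.
by apply: measurableT_comp.
Qed.

Lemma itg_shift f q (c l : R) : integrable_oo f (q + c) l ->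
  itg (fun x => f (x + c)) q l = itg f (q + c) l.
Proof.
have pre : `]q, q + l[%classic = (fun x => x + c) @^-1` `](q + c), (q + c + l)[.
  apply/seteqP; split => x; rewrite /= !in_itv /= => /andP[h1 h2];
    by apply/andP; split; lra.
move=> /integrableP[mf fi]; rewrite /itg /Rintegral pre.
rewrite (integral_isometry (u := fun x => x + c) (measurable_shift c)
  (shift_isometry c) (f := EFin \o f)) //.
Qed.

Lemma Rintegral_sum_oo (I : Type) (r : seq I) (F : I -> R -> R) q (l : R) :
  (forall i, integrable_oo (F i) q l) ->
  integrable_oo (fun x => \sum_(i <- r) F i x) q l /\
  itg (fun x => \sum_(i <- r) F i x) q l = \sum_(i <- r) itg (F i) q l.
Proof.
move=> intF; elim: r => [|i r [IH1 IH2]].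
  have -> : (fun x => \sum_(i <- [::]) F i x) = (fun=> 0).
    by apply/funext => x; rewrite big_nil.
  split; first exact: cst_oo.
  by rewrite big_nil /itg Rintegral_cst // mul0r.
have -> : (fun x => \sum_(j <- i :: r) F j x) = (fun x => F i x + \sum_(j <- r) F j x).
  by apply/funext => x; rewrite big_cons.
split; last by rewrite big_cons -IH2 /itg RintegralD //; exact: intF.
rewrite /integrable_oo; have -> : EFin \o (fun x => F i x + \sum_(j <- r) F j x) =
   ((EFin \o F i) \+ (EFin \o (fun x => \sum_(j <- r) F j x)%R))%E.
  by apply/funext => x; rewrite /= EFinD.
by apply: integrableD => //; exact: intF.
Qed.

End Averages.

(** * Oscillation and integrability of functions in [PaG] *)

Section Oscillation.
Variables (R : realType) (A : finType) (d : nat).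
Implicit Types (T y z : iet R A d) (c : A) (a L : R) (phi : R -> R).
Local Notation mu := (@lebesgue_measure R).

(** A single function on the line gathers all singularities, so that bounds on disjoint levels add
    up to one integral. *)
Definition osc_kernel T a L (x : R) : R := \sum_c
  ((fun x => kern a L (x - left0 T c) + kern a L (left0 T c + len T c - x))
     \_ `]left0 T c, left0 T c + len T c[) x.

Lemma osc_term_ge0 T a L c x : 0 < L ->
  0 <= ((fun x => kern a L (x - left0 T c) + kern a L (left0 T c + len T c - x))
     \_ `]left0 T c, left0 T c + len T c[) x.
Proof.
by move=> L0; rewrite patchE; case: ifP => // _; rewrite addr_ge0 ?kern_ge0.
Qed.

Lemma osc_kernel_ge0 T a L x : 0 < L -> 0 <= osc_kernel T a L x.
Proof. by move=> L0; apply: sumr_ge0 => c _; apply: osc_term_ge0. Qed.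

Lemma osc_kernel_ge T a L c x : 0 < L -> left0 T c < x < left0 T c + len T c ->
  kern a L (x - left0 T c) + kern a L (left0 T c + len T c - x) <= osc_kernel T a L x.
Proof.
move=> L0 xI; rewrite /osc_kernel (bigD1 c) //= patchE mem_set /= ?in_itv //=.
by rewrite lerDl; apply: sumr_ge0 => b _; apply: osc_term_ge0.
Qed.

Lemma measurable_osc_term T a L c : measurable_fun setT
  ((fun x => kern a L (x - left0 T c) + kern a L (left0 T c + len T c - x))
     \_ `]left0 T c, left0 T c + len T c[).
Proof.
apply: (proj1 (measurable_restrictT _ _)) => //; apply: measurable_funTS.
apply: measurable_funD; apply: measurableT_comp; try exact: measurable_kern.
  by apply: measurable_funB.
by apply: measurable_funB.
Qed.

Lemma measurable_osc_kernel T a L : measurable_fun setT (osc_kernel T a L).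
Proof. by apply: measurable_sum => c; apply: measurable_osc_term. Qed.

Lemma integral_osc_kernel a : 0 <= a < 1 -> exists2 C, 0 <= C &
  forall T L, regular T -> 0 < L -> L <= total_len T ->
  (\int[mu]_x (osc_kernel T a L x)%:E <=
    (C * L * total_len T `^ (- a) * bracket a (total_len T / L))%:E)%E.
Proof.
move=> a01; have [C C0 hC] := integral_kern a01.
exists (#|A|%:R * (C + C)); first by rewrite mulr_ge0 ?addr_ge0.
move=> T L rT L0 LX; set X := total_len T.
have mk D : measurable_fun D (fun s => (kern a L s)%:E).
  by apply/measurable_EFinP; apply: measurable_funTS; apply: measurable_kern.
have k0 s : (0 <= (kern a L s)%:E)%E by rewrite lee_fin kern_ge0.
under eq_integral do rewrite /osc_kernel -sumEFin.
rewrite ge0_integral_sum //; last 2 first.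
- by move=> c; apply/measurable_EFinP; apply: measurable_osc_term.
- by move=> c x _; rewrite lee_fin osc_term_ge0.
set B := (C * L * X `^ (- a) * bracket a (X / L)).
have key c : (\int[mu]_x (((fun x => kern a L (x - left0 T c) +
      kern a L (left0 T c + len T c - x))
     \_ `]left0 T c, (left0 T c + len T c)%R[) x)%:E <= (B + B)%:E)%E.
  under eq_integral => x _ do rewrite -[EFin _]/((EFin \o _) x) -restrict_EFin.
  rewrite -integral_mkcond /=.
  under eq_integral do rewrite EFinD.
  set lc := left0 T c; set w : R := len T c.
  have [i1 i2 l0] := rT.
  have wX : w <= X.
    by apply: le_trans (row_right_le c i1 l0); rewrite lerDr; apply: row_left_ge0.
  have p1 : `]lc, (lc + w)%R[%classic = (fun x => x + - lc) @^-1` `]0%R, w[.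
    by apply/seteqP; split => x; rewrite /= !in_itv /=; lra.
  have p2 : `]lc, (lc + w)%R[%classic = (fun x => (lc + w) - x) @^-1` `]0%R, w[.
    by apply/seteqP; split => x; rewrite /= !in_itv /=; lra.
  (* The scale [L] may exceed the length [w] of this interval, so the domain is enlarged to length
     [X], for which [L <= X]. *)
  have bd : (\int[mu]_(s in `]0%R, w[) (kern a L s)%:E <= B%:E)%E.
    apply: le_trans (hC L X L0 LX); apply: ge0_subset_integral => //; first exact: mk.
    by move=> s /=; rewrite !in_itv /= => /andP[-> h]; apply: lt_le_trans wX.
  rewrite ge0_integralD //.
  - rewrite EFinD; apply: leeD.
      rewrite p1 (ge0_integral_isometry (u := fun x => x + - lc) (measurable_shift _)
        (shift_isometry (- lc)) (f := fun s => (kern a L s)%:E)) //.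
    rewrite p2 (ge0_integral_isometry (u := fun x => (lc + w) - x) (measurable_reflect _)
      (reflect_isometry _) (f := fun s => (kern a L s)%:E)) //.
  - apply/measurable_EFinP/measurable_funTS; apply: measurableT_comp.
      exact: measurable_kern.
    by apply: measurable_funB.
  - apply/measurable_EFinP/measurable_funTS; apply: measurableT_comp.
      exact: measurable_kern.
    by apply: measurable_funB.
apply: le_trans (lee_sum _ (fun c _ => key c)) _.
rewrite sumEFin lee_fin sumr_const -[X in X <= _]mulr_natl.
by rewrite /B -/X le_eqVlt; apply/orP; left; apply/eqP; ring.
Qed.

Section PaG.
Variables (T : iet R A d) (a : R) (phi : R -> R).
Hypotheses (rT : regular T) (a01 : 0 <= a < 1) (phiP : PaG T a phi).

Definition pa_real : R := fine (pa T a phi).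

Lemma pa_ge0 : (0 <= pa T a phi)%E.
Proof. by rewrite /pa; apply: bigmax_ge_id. Qed.

Lemma paE : pa T a phi = pa_real%:E.
Proof.
by rewrite /pa_real fineK // ge0_fin_numE ?pa_ge0 //; apply: (pag_fin phiP).
Qed.

Lemma pa_real_ge0 : 0 <= pa_real.
Proof. by rewrite -lee_fin -paE pa_ge0. Qed.

Lemma PaG_derive_bound c t : left0 T c < t < left0 T c + len T c ->
  `|derive1 phi t| <= pa_real *
    ((t - left0 T c) `^ (- (1 + a)) + (left0 T c + len T c - t) `^ (- (1 + a))).
Proof.
move=> /andP[lt tr]; have P0 := pa_real_ge0.
have bd : (maxe (ereal_sup [set (`|sing_left T a phi c t|)%:E | t in `]left0 T c, mid T c]%classic])
    (ereal_sup [set (`|sing_right T a phi c t|)%:E | t in `[mid T c, right0 T c[%classic])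
    <= pa_real%:E)%E.
  rewrite -paE /pa; apply: (le_bigmax_cond _ (fun c => maxe (ereal_sup
    [set (`|sing_left T a phi c t|)%:E | t in `]left0 T c, mid T c]%classic])
    (ereal_sup [set (`|sing_right T a phi c t|)%:E | t in `[mid T c, right0 T c[%classic]))) => //.
have H s : 0 < s -> `|derive1 phi t * s `^ (1 + a)| <= pa_real ->
    `|derive1 phi t| <= pa_real * s `^ (- (1 + a)).
  move=> s0; have sp : 0 < s `^ (1 + a) by apply: powR_gt0.
  by rewrite normrM (gtr0_norm sp) powRN ler_pdivlMr.
move: bd; rewrite ge_max => /andP[b1 b2].
have [tm|mt] := leP t (mid T c).
  apply: (@le_trans _ _ (pa_real * (t - left0 T c) `^ (- (1 + a)))).
    apply: H; first by rewrite subr_gt0.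
    rewrite -lee_fin; apply: le_trans b1; apply: ereal_sup_ubound.
    by exists t => //=; rewrite in_itv /= lt tm.
  by rewrite ler_wpM2l // lerDl powR_ge0.
apply: (@le_trans _ _ (pa_real * (left0 T c + len T c - t) `^ (- (1 + a)))).
  apply: H; first by rewrite subr_gt0.
  rewrite -lee_fin; apply: le_trans b2; apply: ereal_sup_ubound.
  by exists t => //=; rewrite in_itv /= (ltW mt).
by rewrite ler_wpM2l // lerDr powR_ge0.
Qed.

Lemma PaG_oscillation L c (x y : R) : 0 < L ->
  left0 T c < x < left0 T c + len T c -> left0 T c < y < left0 T c + len T c ->
  `|x - y| <= L ->
  `|phi x - phi y| <= pa_real * (osc_kernel T a L x + osc_kernel T a L y).
Proof.
move=> L0; wlog xy : x y / x < y.
  move=> H xI yI d_; have [xy|yx|->] := ltgtP x y.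
  - exact: H.
  - by rewrite distrC [osc_kernel _ _ _ _ + _]addrC; apply: H => //; rewrite distrC.
  - by rewrite subrr normr0 mulr_ge0 ?pa_real_ge0 // addr_ge0 // osc_kernel_ge0.
move=> xI yI d_; rewrite distrC.
have /andP[lx xr] := xI; have /andP[ly yr] := yI.
apply: le_trans (singular_oscillation a01 L0 pa_real_ge0 _ _ lx xy yr _) _.
- by move=> t tI; case: (pag_C1 phiP (b := c) tI).
- by move=> t tI; apply: PaG_derive_bound.
- by move: d_; rewrite ler_norml; lra.
rewrite ler_wpM2l ?pa_real_ge0 //; apply: lerD.
  by apply: le_trans (osc_kernel_ge a L0 xI); rewrite lerDl kern_ge0.
by apply: le_trans (osc_kernel_ge a L0 yI); rewrite lerDr kern_ge0.
Qed.

Lemma osc_kernel_integrable L : 0 < L -> L <= total_len T ->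
  mu.-integrable setT (EFin \o osc_kernel T a L).
Proof.
move=> L0 LX; have [C C0 hC] := integral_osc_kernel a01.
apply/integrableP; split; first by apply/measurable_EFinP; apply: measurable_osc_kernel.
under eq_integral do rewrite /= ger0_norm ?osc_kernel_ge0 //.
by apply: (le_lt_trans (hC T L rT L0 LX)); rewrite ltry.
Qed.

Lemma PaG_measurable c : measurable_fun `]left0 T c, left0 T c + len T c[ phi.
Proof.
by apply: measurable_fun_derivable => t tI; case: (pag_C1 phiP (b := c) tI).
Qed.

(** At the scale of the whole interval, [phi] differs from its value at the midpoint by an
    integrable kernel. *)
Lemma PaG_integrable c : integrable_oo phi (left0 T c) (len T c).
Proof.
have [i1 i2 l0] := rT; have lc : 0 < (len T c : R) by [].
have rX := row_right_le c i1 l0; have r0 := row_left_ge0 (perm_of T).1 c l0.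
have LX : (len T c : R) <= total_len T by move: rX; rewrite -/(total_len T); lra.
set L : R := len T c in lc LX *; set m := left0 T c + L / 2.
have mI : left0 T c < m < left0 T c + L by rewrite /m; apply/andP; split; lra.
pose G x := pa_real * osc_kernel T a L x + (pa_real * osc_kernel T a L m + `|phi m|).
have intG : integrable_oo G (left0 T c) L.
  apply: integrable_ooZD; apply: integrableS (osc_kernel_integrable lc LX) => //.
apply: (le_integrable _ _ _ intG) => //; first by apply/measurable_EFinP; apply: PaG_measurable.
move=> x; rewrite /= in_itv /= => xI; rewrite lee_fin [leRHS]ger0_norm; last first.
  by rewrite !addr_ge0 // mulr_ge0 ?pa_real_ge0 ?osc_kernel_ge0.
have : `|phi x - phi m| <= pa_real * (osc_kernel T a L x + osc_kernel T a L m).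
  apply: (PaG_oscillation lc xI mI); move: xI mI => /andP[? ?] /andP[? ?].
  by rewrite ler_norml; apply/andP; split; lra.
move=> h; have := ler_normD (phi x - phi m) (phi m); rewrite subrK /G; lra.
Qed.

End PaG.
End Oscillation.

(** * Averages along Rokhlin towers *)

Section Means.
Variables (R : realType) (A : finType) (d : nat).
Implicit Types (y z : iet R A d) (b c : A) (W : A -> seq A).
Local Notation mu := (@lebesgue_measure R).

(** Otherwise some point of the base would be carried to the right endpoint of the interval [c],
    outside it, against [ind_visit]. *)
Lemma level_sub y z W a i (c := nth a (W a) i) : regular y -> regular z ->
  induced y z W -> (i < size (W a))%N ->
  left0 y c <= iter i (iet_map y) (left0 z a) /\
  iter i (iet_map y) (left0 z a) + len z a <= left0 y c + len y c.
Proof.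
move=> ry rz ind ilt; have [_ _ l0] := rz.
have v0 := ind_visit ind (left0_itv a rz) ilt; rewrite -/c itvE in v0.
have /andP[v1 v2] := v0; split=> //; rewrite leNgt; apply/negP => lt.
pose s := left0 y c + len y c - iter i (iet_map y) (left0 z a).
have sI : itv z a (left0 z a + s) by rewrite itvE /s; apply/andP; split; lra.
have := ind_visit ind sI ilt; rewrite -/c itvE (iter_shift ry rz ind sI (ltnW ilt)).
by rewrite /s; lra.
Qed.

Section Tower.
Variables (T : iet R A d).
Hypothesis rT : regular T.
Local Notation f := (iet_map T).

(** The mean of the Birkhoff sum over the base, taken level by level; [mean_birkhoff] makes the
    link. *)
Definition tower_mean W y (phi : R -> R) b : R :=
  \sum_(i < size (W b)) avg phi (iter i f (left0 y b)) (len y b).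

Section Kernel.
Variable K : R -> R.
Hypotheses (K0 : forall x, 0 <= K x) (intK : mu.-integrable setT (EFin \o K)).

Lemma kernel_oo q (l : R) : integrable_oo K q l.
Proof. exact: integrableS intK. Qed.

Lemma itg_kernel_ge0 q (l : R) : 0 <= itg K q l.
Proof. by apply: Rintegral_ge0. Qed.

Lemma tower_sum y W : regular y -> induced T y W ->
  \sum_b \sum_(i < size (W b)) itg K (iter i f (left0 y b)) (len y b) <=
  \int[mu]_x K x.
Proof.
move=> ry ind; have [_ _ l0] := ry.
pose F (p : A * nat) : set R :=
  `]iter p.2 f (left0 y p.1), iter p.2 f (left0 y p.1) + len y p.1[%classic.
pose s := [seq (b, i) | b <- index_enum A, i <- iota 0 (size (W b))].
have sP p : p \in s -> (p.2 < size (W p.1))%N.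
  by move=> /allpairsPdep [b [i [_ + ->]]]; rewrite mem_iota.
have us : uniq s.
  apply: allpairs_uniq_dep; first exact: index_enum_uniq.
    by move=> b _; apply: iota_uniq.
  by move=> [b i] [b' i'] _ _ /= [-> ->].
have mF p : measurable (F p) by exact: measurable_itv.
have mK : measurable_fun setT (EFin \o K) by case/integrableP: intK.
have tF : trivIset [set` s] F.
  move=> [b i] [b' i'] /sP /= si /sP /= si' [x [xF xF']].
  (* The iterates are translations on the base, so a point of a level comes from an explicit base
     point. *)
  have H c j : (j < size (W c))%N -> F (c, j) x ->
      itv y c (left0 y c + (x - iter j f (left0 y c))) /\
      iter j f (left0 y c + (x - iter j f (left0 y c))) = x.
    move=> sj; rewrite /F /= in_itv /= => /andP[h1 h2].
    have tI : itv y c (left0 y c + (x - iter j f (left0 y c))).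
      by rewrite itvE; apply/andP; split; lra.
    by split => //; rewrite (iter_shift rT ry ind tI (ltnW sj)); ring.
  have [t1 t2] := H _ _ si xF; have [t1' t2'] := H _ _ si' xF'.
  by have [-> -> _] := towers_disjoint rT ry ind t1 t1' si si' (etrans t2 (esym t2')).
have itgE q (l : R) : (itg K q l)%:E = (\int[mu]_(x in `]q, (q + l)%R[) (K x)%:E)%E.
  by rewrite /itg /Rintegral fineK //; apply: integrable_fin_num => //; apply: kernel_oo.
rewrite -lee_fin /Rintegral fineK; last exact: integrable_fin_num.
have -> : (\sum_b \sum_(i < size (W b)) itg K (iter i f (left0 y b)) (len y b))%:E =
    (\sum_(p <- s) \int[mu]_(x in F p) (EFin \o K) x)%E.
  rewrite /s big_allpairs_dep /= -sumEFin; apply: eq_bigr => b _.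
  rewrite -(big_mkord xpredT (fun i => itg K (iter i f (left0 y b)) (len y b))).
  rewrite /index_iota subn0 -sumEFin; apply: eq_bigr => i _; exact: itgE.
rewrite -(@ge0_integral_bigsetU _ _ _ mu _ F (EFin \o K) s) //.
- apply: ge0_subset_integral => //.
    by apply: bigsetU_measurable => p _; apply: mF.
  by move=> x _; rewrite lee_fin.
- exact: measurable_funTS.
- by move=> x _; rewrite lee_fin.
Qed.

(** Each level over [a] lies in a level of a tower over [y]. The two averages of [phi] differ by at
    most [P] times the sum of the averages of [K] on these levels, and the fine and the coarse
    averages are summed separately, whence the factor 2. *)
Lemma mean_error y z W W' (phi : R -> R) (P : R) a : regular y -> regular z ->
  induced T y W -> induced y z W' -> 0 <= P ->
  (forall c, integrable_oo phi (left0 T c) (len T c)) ->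
  (forall c (s t : R), left0 T c < s < left0 T c + len T c ->
     left0 T c < t < left0 T c + len T c -> `|s - t| <= total_len y ->
     `|phi s - phi t| <= P * (K s + K t)) ->
  `|tower_mean (concat W W') z phi a - \sum_(c <- W' a) tower_mean W y phi c| <=
    2 * P * (\int[mu]_x K x) / len z a.
Proof.
move=> ry rz i1 i2 P0 intphi osc.
have [j1 j2 ly0] := ry; have [_ _ lz0] := rz.
have i3 := induced_trans ry rz i1 i2.
have hv k : (k < size (W' a))%N -> _ :=
  fun h => ind_visit i2 (i := k) (left0_itv a rz) h.
set dl : R := len z a; have d0 : 0 < dl := lz0 a.
set KI := (\int[mu]_x K x)%R.
pose cc i := nth a (W' a) i.
pose q (i j : nat) := iter j f (iter i (iet_map y) (left0 z a)).
have E1 : tower_mean (concat W W') z phi a =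
    \sum_(i < size (W' a)) \sum_(j < size (W (cc i))) avg phi (q i j) dl.
  exact: (sum_flatten i1 hv (fun x => avg phi x dl)).
have E2 (g : A -> R) : \sum_(c <- W' a) g c = \sum_(i < size (W' a)) g (cc i).
  by rewrite (big_nth a) big_mkord.
(* The fine levels all have width [dl] and are disjoint. *)
have E3 : \sum_(i < size (W' a)) \sum_(j < size (W (cc i))) avg K (q i j) dl <=
    KI / dl.
  rewrite -(sum_flatten i1 hv (fun x => avg K x dl)) -mulr_sumr mulrC.
  rewrite ler_wpM2r ?invr_ge0 ?(ltW d0) //; apply: le_trans (tower_sum rz i3).
  rewrite [leRHS](bigD1 a) //= lerDl; apply: sumr_ge0 => b _.
  by apply: sumr_ge0 => i _; apply: itg_kernel_ge0.
pose S c := \sum_(j < size (W c)) itg K (iter j f (left0 y c)) (len y c).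
have S0 c : 0 <= S c by apply: sumr_ge0 => j _; apply: itg_kernel_ge0.
(* A coarse level over [c] is counted once per visit to [c]. The visits times [dl] are at most
   [len y c], so the repetition is absorbed by replacing 1/[len y c] by 1/[dl]. *)
have E4 : \sum_(i < size (W' a)) \sum_(j < size (W (cc i)))
    avg K (iter j f (left0 y (cc i))) (len y (cc i)) <= KI / dl.
  rewrite -(E2 (fun c => \sum_(j < size (W c)) avg K (iter j f (left0 y c)) (len y c))).
  rewrite -sum_count; apply: (@le_trans _ _ (\sum_c S c / dl)).
    apply: ler_sum => c _; rewrite -mulr_sumr -/(S c).
    rewrite mulrA [leRHS]mulrC ler_wpM2r // ler_pdivrMr // ler_pdivlMl // mulrC.
    exact: (count_len_le rz i2).
  rewrite -mulr_suml ler_wpM2r ?invr_ge0 ?(ltW d0) //.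
  exact: (tower_sum ry i1).
rewrite E1 E2 -sumrB; apply: le_trans (ler_norm_sum _ _ _) _.
apply: (@le_trans _ _ (\sum_(i < size (W' a)) \sum_(j < size (W (cc i)))
    P * (avg K (q i j) dl + avg K (iter j f (left0 y (cc i))) (len y (cc i))))).
  apply: ler_sum => i _; rewrite /tower_mean -sumrB.
  apply: le_trans (ler_norm_sum _ _ _) _; apply: ler_sum => j _.
  set c := cc i; set u := iter j f (left0 y c).
  have [u1 u2] := level_sub ry rz i2 (ltn_ord i); rewrite -/(cc i) -/c in u1 u2.
  have [v1 v2] := level_sub rT ry i1 (ltn_ord j).
  have hc := hv _ (ltn_ord i); rewrite -/(cc i) -/c in hc.
  have qE : q i j = iter i (iet_map y) (left0 z a) + (u - left0 y c).
    by rewrite /q (iter_shift rT ry i1 hc (ltnW (ltn_ord j))).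
  set e := nth c (W c) j in v1 v2.
  apply: (avg_oscillation d0 (ly0 c)).
  - by rewrite qE; lra.
  - by rewrite qE -/dl in u2 *; lra.
  - exact: integrable_ooS v1 v2 (intphi e).
  - exact: kernel_oo.
  move=> s t /andP[s1 s2] /andP[t1 t2]; apply: (osc e).
  - by apply/andP; split; rewrite -/u in v1 v2; lra.
  - by apply/andP; split; rewrite -/u in v1 v2; lra.
  have := row_right_le c j1 ly0; have := row_left_ge0 (perm_of y).1 c ly0.
  by rewrite -/(total_len y) => h1 h2; rewrite ler_norml; apply/andP; split; lra.
under eq_bigr do rewrite -mulr_sumr big_split /=.
rewrite -mulr_sumr big_split /=.
apply: le_trans (ler_wpM2l P0 (lerD E3 E4)) _.
by rewrite le_eqVlt; apply/orP; left; apply/eqP; field; rewrite gt_eqF.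
Qed.

End Kernel.

Section MeanProj.
Variables (y : iet R A d) (W : A -> seq A) (phi : R -> R).
Hypotheses (ry : regular y) (ind : induced T y W)
  (intphi : forall c, integrable_oo phi (left0 T c) (len T c)).

Lemma level_integrable b (i : nat) : (i < size (W b))%N ->
  integrable_oo phi (iter i f (left0 y b)) (len y b).
Proof.
by move=> ilt; have [v1 v2] := level_sub rT ry ind ilt; apply: integrable_ooS v1 v2 _.
Qed.

Lemma mean_birkhoff (g : R -> R) b :
  (forall t, left0 y b < t < left0 y b + len y b ->
     g t = \sum_(i < size (W b)) phi (iter i f t)) ->
  mean_proj y g b = tower_mean W y phi b.
Proof.
move=> gE; rewrite /mean_proj ffunE /tower_mean -mulr_sumr; congr (_ * _).
(* On the base each iterate is a fixed translation, so [h] is a sum of translates of [phi] and can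
   be integrated term by term. *)
pose h t := \sum_(i < size (W b)) phi (t + (iter i f (left0 y b) - left0 y b)).
have hE t : left0 y b < t < left0 y b + len y b -> g t = h t.
  move=> tI; rewrite gE // /h; apply: eq_bigr => i _; congr phi.
  apply: (iter_shift rT ry ind) => //; last exact: ltnW.
  by rewrite itvE; case/andP: tI => h1 h2; rewrite (ltW h1).
have sh (i : 'I_(size (W b))) :
    integrable_oo phi (left0 y b + (iter i f (left0 y b) - left0 y b)) (len y b).
  by rewrite addrC subrK; apply: level_integrable.
have [h1 h2] := @Rintegral_sum_oo R _ (index_enum 'I_(size (W b)))
  (fun i t => phi (t + (iter i f (left0 y b) - left0 y b))) (left0 y b) (len y b)
  (fun i => integrable_shift (sh i)).
transitivity (itg h (left0 y b) (len y b)).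
  have mh : measurable_fun `]left0 y b, left0 y b + len y b[ h.
    by have /integrableP[/measurable_EFinP] := h1.
  have hE' : {in `]left0 y b, left0 y b + len y b[%classic, h =1 g}.
    by move=> t; rewrite inE /= in_itv /= => tI; rewrite hE.
  have mg : measurable_fun `]left0 y b, left0 y b + len y b[ g.
    exact: eq_measurable_fun mh.
  rewrite /Rintegral /itg /Rintegral /itv /right0 integral_itv_bndoo; last first.
    exact/measurable_EFinP.
  by congr fine; apply: eq_integral => t tI; rewrite hE'.
rewrite h2; apply: eq_bigr => i _; rewrite itg_shift //.
by rewrite addrC subrK.
Qed.

Lemma tower_mean_linear (s : R) (psi : R -> R) b :
  (forall c, integrable_oo psi (left0 T c) (len T c)) ->
  tower_mean W y (fun t => s * phi t + psi t) b =
  s * tower_mean W y phi b + tower_mean W y psi b.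
Proof.
move=> intpsi; rewrite /tower_mean mulr_sumr -big_split /=; apply: eq_bigr => i _.
have i1 := level_integrable (ltn_ord i).
have [v1 v2] := level_sub rT ry ind (ltn_ord i).
have i2 := integrable_ooS v1 v2 (intpsi _).
rewrite /avg /itg RintegralD //; last first.
  have -> : EFin \o (fun x => s * phi x) = (fun x => s%:E * (EFin \o phi) x)%E.
    by apply/funext => x; rewrite /= EFinM.
  exact: integrableZl.
by rewrite RintegralZl // mulrDr mulrCA.
Qed.

End MeanProj.
End Tower.
End Means.

(** * The correction, its increments and the splitting of the means *)

Section Correction.
Variables (R : realType) (A : finType) (d : nat).
Implicit Types (a : R) (b : A) (h w : RA R A) (phi psi : R -> R).
Local Notation mu := (@lebesgue_measure R).

Variable T : iet R A d.
Hypotheses (T_iet : is_iet T) (kT : keane T) (d0 : (0 < d)%N).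
Local Notation S N := (iter N (@rauzy R A d) T).
Let rT : regular T := iet_regular T_iet.
Let rS := stage_regular T_iet kT d0.

(** Words of one induction may be built step by step or as a concatenation; tower heights are
    determined by the visits. *)
Lemma induced_size (y z : iet R A d) (W W' : A -> seq A) b : regular y -> regular z ->
  induced y z W -> induced y z W' -> size (W b) = size (W' b).
Proof.
move=> ry rz i1 i2; rewrite -!sum_count_size; apply: eq_bigr => c _.
by rewrite -(visits_count _ _ ry rz i1) -(visits_count _ _ ry rz i2).
Qed.

Definition stage_mean N phi : RA R A := [ffun b => tower_mean T (words T N) (S N) phi b].

Lemma total_gt0 : 0 < total_len T.
Proof.
have [b _] := last_letter_ex (iet_card T_iet) (let: And3 i1 _ _ := rT in i1).
have [_ _ l0] := rT; rewrite /total_len (bigD1 b) //=.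
by apply: ltr_pwDl => //; apply: sumr_ge0 => c _; apply: ltW.
Qed.

Lemma total_stage N N' : (N <= N')%N -> total_len (S N') <= total_len (S N).
Proof. by move=> le; apply: ind_total (stage_induced_le T_iet kT d0 le). Qed.

Lemma total_stage_gt0 N : 0 < total_len (S N).
Proof.
have [i1 _ l0] := rS N; have [b _] := last_letter_ex (iet_card T_iet) i1.
rewrite /total_len (bigD1 b) //=.
by apply: ltr_pwDl => //; apply: sumr_ge0 => c _; apply: ltW.
Qed.

Lemma stage_mean_linear a (s : R) phi psi N : 0 <= a < 1 ->
  PaG T a phi -> PaG T a psi ->
  stage_mean N (fun t => s * phi t + psi t) = s *: stage_mean N phi + stage_mean N psi.
Proof.
move=> a01 hphi hpsi; apply/ffunP => b; rewrite !ffunE.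
have [rN ind] := stage_from0 T_iet kT d0 N.
exact: (tower_mean_linear rT rN ind (PaG_integrable rT a01 hphi) _ _ (PaG_integrable rT a01 hpsi)).
Qed.

Lemma stage_meanE a n k phi : 0 <= a < 1 -> n 0%N = 0%N -> PaG T a phi ->
  mean_proj (stage T n k) (special_birkhoff T n k phi) = stage_mean (n k) phi.
Proof.
move=> a01 n0 hphi; apply/ffunP => b; have [rN ind] := stage_from0 T_iet kT d0 (n k).
rewrite [RHS]ffunE; apply: (mean_birkhoff rT rN ind (PaG_integrable rT a01 hphi)).
move=> t /andP[t1 t2]; have tb : itv (S (n k)) b t by rewrite itvE (ltW t1).
rewrite /special_birkhoff (bigD1 b) /=; last by rewrite -itvE.
rewrite [X in _ + X]big1 ?addr0; last first.
  by move=> c /andP[]; rewrite -itvE => tc /eqP[]; apply: (itv_disjoint _ tc tb).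
by rewrite (return_timeE T_iet kT d0).
Qed.

Lemma stage_error a : 0 <= a < 1 -> exists2 D, 0 <= D &
  forall phi N N' kappa, PaG T a phi -> (N <= N')%N ->
  (forall b, total_len (S N') / (len (S N') b : R) <= kappa) ->
  l1norm (stage_mean N' phi - cocy T N N' (stage_mean N phi)) <=
    D * kappa * mxnorm (visit_mx (S N) (S N')) *
    bracket a (total_len T / total_len (S N)) * pa_real T a phi.
Proof.
move=> a01; have [C C0 hC] := @integral_osc_kernel R A d a a01.
set X := total_len T; have X0 : 0 < X := total_gt0.
exists (#|A|%:R * 2 * C * X `^ (- a)); first by rewrite !mulr_ge0 ?powR_ge0.
move=> phi N N' kappa hphi le bal.
set L := total_len (S N); have L0 : 0 < L := total_stage_gt0 N.
have LX : L <= X := total_stage (leq0n N).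
set P := pa_real T a phi; have P0 : 0 <= P := pa_real_ge0 hphi.
have iNN := stage_induced_le T_iet kT d0 le.
have [_ iN] := stage_from0 T_iet kT d0 N; have [_ iN'] := stage_from0 T_iet kT d0 N'.
have ic := induced_trans (rS N) (rS N') iN iNN.
have intK := osc_kernel_integrable rT a01 L0 LX.
set KI := (\int[mu]_x osc_kernel T a L x)%R.
have KIle : KI <= C * L * X `^ (- a) * bracket a (X / L).
  rewrite -lee_fin /KI /Rintegral fineK; last exact: integrable_fin_num.
  exact: hC.
set nm := mxnorm _; set br := bracket a _.
have br0 : 0 <= br by apply: bracket_ge0; rewrite ler_pdivlMr // mul1r.
have bd b : `|(stage_mean N' phi - cocy T N N' (stage_mean N phi)) b : R| <=
    2 * C * X `^ (- a) * kappa * nm * br * P.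
  rewrite (cocyE T_iet kT d0) // !ffunE.
  have -> : tower_mean T (words T N') (S N') phi b =
      tower_mean T (concat (words T N) (words (S N) (N' - N))) (S N') phi b.
    by rewrite /tower_mean (induced_size b rT (rS N') iN' ic).
  under eq_bigr do rewrite ffunE.
  have := mean_error rT (fun x => osc_kernel_ge0 T a x L0) intK b (rS N) (rS N') iN iNN P0
    (PaG_integrable rT a01 hphi).
  move=> h; apply: le_trans (h _) _.
    by move=> c s t sI tI st; apply: (PaG_oscillation a01 hphi L0 sI tI).
  rewrite -/KI; set dl := (len (S N') b : R).
  have dl0 : 0 < dl by have [_ _] := rS N'; apply.
  (* The balance at [N'] compares [dl] with the total length there, and the cocycle compares this
     total length with [L]. *)
  have Ldl : L / dl <= kappa * nm.
    have h1 := total_le_mxnorm (rS N) (rS N') iNN.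
    have nm0 : 0 <= nm by apply: mxnorm_ge0.
    apply: (@le_trans _ _ (nm * total_len (S N') / dl)).
      by rewrite ler_wpM2r ?invr_ge0 // ltW.
    by rewrite -mulrA mulrC ler_wpM2r //; apply: bal.
  apply: (@le_trans _ _ (2 * P * (C * L * X `^ (- a) * br) / dl)).
    by rewrite ler_wpM2r ?invr_ge0 ?(ltW dl0) // ler_wpM2l // mulr_ge0.
  have -> : 2 * P * (C * L * X `^ (- a) * br) / dl =
     (2 * C * X `^ (- a) * br * P) * (L / dl) by ring.
  have -> : 2 * C * X `^ (- a) * kappa * nm * br * P =
     (2 * C * X `^ (- a) * br * P) * (kappa * nm) by ring.
  by rewrite ler_wpM2l // !mulr_ge0 ?powR_ge0.
rewrite /l1norm; apply: le_trans (ler_sum _ (fun b _ => bd b)) _.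
rewrite sumr_const -[X in X <= _]mulr_natl -/nm -/br -/P.
by rewrite le_eqVlt; apply/orP; left; apply/eqP; ring.
Qed.

Section Splitting.
Variables (V W : {vspace RA R A}).
Hypotheses (VWfull : (V + W)%VS = fullv) (VW0 : (V :&: W)%VS = 0%VS).

Definition projW : 'End(RA R A) := daddv_pi W V.

Lemma projW_mem h : projW h \in W.
Proof. exact: memv_pi. Qed.

Lemma projW_compl h : h - projW h \in V.
Proof.
have WV0 : (W :&: V)%VS = 0%VS by rewrite capvC.
have hm : h \in (W + V)%VS by rewrite addvC VWfull memvf.
have {1}<- := daddv_pi_add WV0 hm.
by rewrite addrC addKr; apply: memv_pi.
Qed.

Lemma projW_id h : h \in W -> projW h = h.
Proof. by apply: daddv_pi_id; rewrite capvC. Qed.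

(** Pulling back to time 0 places the vectors of all stages in one space, where they can be
    subtracted and projected. *)
Definition pulled N phi : RA R A := ((cocy T 0 N)^-1)%VF (stage_mean N phi).
Definition corr N phi : RA R A := projW (pulled N phi).

Lemma pulledK N phi : cocy T 0 N (pulled N phi) = stage_mean N phi.
Proof. exact: (cocy_surj T_iet kT d0). Qed.

Lemma pulled_diff N N' phi : (N <= N')%N -> pulled N' phi - pulled N phi =
  ((cocy T 0 N')^-1)%VF (stage_mean N' phi - cocy T N N' (stage_mean N phi)).
Proof.
move=> le; apply: (cocy_inj T_iet kT d0 (leq0n N')).
rewrite (cocy_surj T_iet kT d0) // linearB /= pulledK.
by rewrite -(pulledK N) -(cocy_comp T_iet kT d0).
Qed.

Section Accel.
Variables (n : nat -> nat) (tau c kappa : R).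
Hypotheses (tau0 : 0 <= tau) (c0 : 0 < c) (n0 : n 0%N = 0%N)
  (nS : forall k, (n k < n k.+1)%N)
  (bal : forall k b, total_len (stage T n k) / (len (stage T n k) b : R) <= kappa)
  (ang : forall k, c * Qnorm T n k `^ (- tau) <=
           sin_angle (push T n V k) (push T n W k)).

Lemma n_mono k l : (k <= l)%N -> (n k <= n l)%N.
Proof.
move=> /subnKC <-; elim: (l - k)%N => [|m IH]; first by rewrite addn0.
by rewrite addnS; apply: leq_trans IH (ltnW (nS _)).
Qed.

Lemma QnE k : mxlin (Qmx T n 0 k) = cocy T 0 (n k).
Proof. by rewrite /Qmx /cocy /stage n0. Qed.

Lemma Qnorm_ge1 k : 1 <= Qnorm T n k.
Proof.
have [b _] := last_letter_ex (iet_card T_iet) (let: And3 i1 _ _ := rT in i1).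
apply: (mxnorm_visit_ge1 (rS (n 0%N)) (rS (n k)) _ b).
exact: (stage_induced_le T_iet kT d0 (n_mono (leq0n k))).
Qed.

Lemma push_mem (Z : {vspace RA R A}) k h : h \in Z -> cocy T 0 (n k) h \in push T n Z k.
Proof. by move=> hZ; rewrite /push QnE; apply: memv_img. Qed.

(* The projection onto W^(k) along V^(k), obtained by conjugation by Q(k). *)
Lemma projW_bound k w (u := projW (((cocy T 0 (n k))^-1)%VF w)) :
  l1norm (cocy T 0 (n k) u) <= #|A|%:R / c * Qnorm T n k `^ tau * l1norm w.
Proof.
have Q1 := Qnorm_ge1 k; have Q0 : 0 < Qnorm T n k by lra.
set x := ((cocy T 0 (n k))^-1)%VF w.
have wE : w = cocy T 0 (n k) (x - u) + cocy T 0 (n k) u.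
  by rewrite -linearD subrK /= (cocy_surj T_iet kT d0).
have := sin_angle_proj (push_mem k (projW_compl x)) (push_mem k (projW_mem x)) _ (ang k).
rewrite -/u -wE => /(_ _) h.
have {}h : c * Qnorm T n k `^ (- tau) * l1norm (cocy T 0 (n k) u) <= #|A|%:R * l1norm w.
  by apply: h; rewrite mulr_ge0 ?powR_ge0 // ltW.
have Qt : 0 < Qnorm T n k `^ tau by apply: powR_gt0.
rewrite powRN -mulrA mulrCA ler_pdivrMl // in h.
move: h; rewrite -ler_pdivlMl // => h; apply: le_trans h _.
by rewrite le_eqVlt; apply/orP; left; apply/eqP; ring.
Qed.

Lemma projV_bound k w (u := projW (((cocy T 0 (n k))^-1)%VF w)) :
  l1norm (w - cocy T 0 (n k) u) <= (1 + #|A|%:R / c) * Qnorm T n k `^ tau * l1norm w.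
Proof.
apply: le_trans (l1normB _ _) _; have := projW_bound k w; rewrite -/u.
have : 1 <= Qnorm T n k `^ tau.
  rewrite -(powRr0 (Qnorm T n k)); apply: ler_powR => //; exact: Qnorm_ge1.
have := l1norm_ge0 w; move: (Qnorm T n k `^ tau) (l1norm w) (#|A|%:R / c) => q l e l0 q1 /= h.
have : l <= q * l by rewrite ler_peMl.
by lra.
Qed.

Section Sums.
Variables (a D : R) (phi : R -> R).
Hypotheses (a01 : 0 <= a < 1) (phiP : PaG T a phi) (D0 : 0 <= D)
  (err : forall N N', (N <= N')%N ->
    (forall b, total_len (S N') / (len (S N') b : R) <= kappa) ->
    l1norm (stage_mean N' phi - cocy T N N' (stage_mean N phi)) <=
    D * kappa * mxnorm (visit_mx (S N) (S N')) *
    bracket a (total_len T / total_len (S N)) * pa_real T a phi).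

Let P := pa_real T a phi.
Let P0 : 0 <= P := pa_real_ge0 phiP.

Lemma kappa_ge0 : 0 <= kappa.
Proof.
have [b _] := last_letter_ex (iet_card T_iet) (let: And3 i1 _ _ := rT in i1).
apply: le_trans (bal 0 b); rewrite divr_ge0 //.
  exact: ltW (total_stage_gt0 _).
by apply: ltW; have [_ _] := rS (n 0%N); apply.
Qed.

Lemma ratio_le_Qnorm k : total_len T / total_len (S (n k)) <= Qnorm T n k.
Proof.
rewrite ler_pdivrMr; last exact: total_stage_gt0.
have := total_le_mxnorm (rS (n 0%N)) (rS (n k))
  (stage_induced_le T_iet kT d0 (n_mono (leq0n k))).
by rewrite {1}n0.
Qed.

Lemma ratio_ge1 N : 1 <= total_len T / total_len (S N).
Proof.
rewrite ler_pdivlMr ?mul1r; last exact: total_stage_gt0.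
exact: (total_stage (leq0n N)).
Qed.

Lemma accel_error l : l1norm (stage_mean (n l.+1) phi -
    cocy T (n l) (n l.+1) (stage_mean (n l) phi)) <=
  D * kappa * Znorm T n l.+1 * bracket a (Qnorm T n l) * P.
Proof.
apply: le_trans (err (ltnW (nS l)) (bal l.+1)) _; rewrite ler_wpM2r //.
rewrite ler_wpM2l ?mulr_ge0 ?kappa_ge0 ?mxnorm_ge0 //.
by case/andP: a01 => a0 _; apply: le_bracket => //; [exact: ratio_ge1|exact: ratio_le_Qnorm].
Qed.

(** Since [N] need not be a time of the acceleration, its length ratio is bounded by the one at
    [n l.+1]. Convergence tolerates this larger bracket; the final estimate rests on
    [accel_error]. *)
Lemma between_error N l : (n l <= N)%N -> (N <= n l.+1)%N ->
  l1norm (stage_mean (n l.+1) phi - cocy T N (n l.+1) (stage_mean N phi)) <=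
  D * kappa * Znorm T n l.+1 * bracket a (Qnorm T n l.+1) * P.
Proof.
move=> lN Nl; apply: le_trans (err Nl (bal l.+1)) _; rewrite ler_wpM2r //.
case/andP: (a01) => a0 _; apply: ler_pM.
- by rewrite !mulr_ge0 ?kappa_ge0 ?mxnorm_ge0.
- by apply: bracket_ge0; exact: ratio_ge1.
- rewrite ler_wpM2l ?mulr_ge0 ?kappa_ge0 //.
  exact: (mxnorm_mono T_iet kT d0 lN Nl).
apply: le_bracket => //; first exact: ratio_ge1.
apply: le_trans (ratio_le_Qnorm l.+1).
rewrite ler_wpM2l ?(ltW total_gt0) // lef_pV2 ?posrE ?total_stage_gt0 //.
exact: total_stage.
Qed.

Lemma corr_between N l : (n l <= N)%N -> (N <= n l.+1)%N ->
  l1norm (corr (n l.+1) phi - corr N phi) <=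
  Qinvnorm_on T n W 0 l.+1 * (#|A|%:R / c * Qnorm T n l.+1 `^ tau *
   (D * kappa * Znorm T n l.+1 * bracket a (Qnorm T n l.+1) * P)).
Proof.
move=> lN Nl; rewrite /corr -linearB /= (pulled_diff phi Nl).
set w := (stage_mean _ _ - _); set u := projW _.
have hu : u = ((cocy T 0 (n l.+1))^-1)%VF (cocy T 0 (n l.+1) u).
  by rewrite (cocyK T_iet kT d0).
rewrite hu /Qinvnorm_on QnE.
apply: le_trans (opnorm_onP _ (push_mem l.+1 (projW_mem _))) _.
rewrite ler_wpM2l ?opnorm_on_ge0 //; apply: le_trans (projW_bound _ _) _.
rewrite ler_wpM2l ?mulr_ge0 ?powR_ge0 ?invr_ge0 ?(ltW c0) //.
exact: between_error.
Qed.

(** The [W]-part of a later error is brought back from stage [m.+1] to stage [k] by the inverse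
    cocycle on [W]: one term of [Kseq]. *)
Lemma corr_tail k m : (k <= m)%N ->
  l1norm (cocy T 0 (n k) (corr (n m.+1) phi - corr (n m) phi)) <=
  #|A|%:R / c * (D * kappa) * P *
   (Qinvnorm_on T n W k m.+1 * Znorm T n m.+1 * bracket a (Qnorm T n m)
      * Qnorm T n m.+1 `^ tau).
Proof.
move=> km; rewrite /corr -linearB /= (pulled_diff phi (ltnW (nS m))).
set w := (stage_mean _ _ - _); set u := projW _.
have km1 : (n k <= n m.+1)%N by apply: n_mono; apply: leq_trans km _.
have -> : cocy T 0 (n k) u = ((cocy T (n k) (n m.+1))^-1)%VF (cocy T 0 (n m.+1) u).
  by rewrite (cocy_comp T_iet kT d0 _ (leq0n (n k)) km1) (cocyK T_iet kT d0).
apply: le_trans (opnorm_onP _ (push_mem m.+1 (projW_mem _))) _.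
have -> : opnorm_on (push T n W m.+1) ((cocy T (n k) (n m.+1))^-1)%VF =
   Qinvnorm_on T n W k m.+1 by [].
apply: (@le_trans _ _ (Qinvnorm_on T n W k m.+1 *
   (#|A|%:R / c * Qnorm T n m.+1 `^ tau *
   (D * kappa * Znorm T n m.+1 * bracket a (Qnorm T n m) * P)))).
  rewrite ler_wpM2l ?opnorm_on_ge0 //; apply: le_trans (projW_bound _ _) _.
  rewrite ler_wpM2l ?mulr_ge0 ?powR_ge0 ?invr_ge0 ?(ltW c0) //.
  exact: accel_error.
by rewrite le_eqVlt; apply/orP; left; apply/eqP; ring.
Qed.

(** The [V]-part of an earlier error is carried forward to stage [k] by the cocycle on [V]: one term
    of [Cseq]. *)
Lemma compl_step k l : (l < k)%N ->
  l1norm (cocy T 0 (n k) ((pulled (n l.+1) phi - corr (n l.+1) phi) -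
     (pulled (n l) phi - corr (n l) phi))) <=
  (1 + #|A|%:R / c) * (D * kappa) * P *
   (Qnorm_on T n V l.+1 k * Znorm T n l.+1 * bracket a (Qnorm T n l)
      * Qnorm T n l.+1 `^ tau).
Proof.
move=> lk.
have -> : (pulled (n l.+1) phi - corr (n l.+1) phi) - (pulled (n l) phi - corr (n l) phi) =
   (pulled (n l.+1) phi - pulled (n l) phi) - projW (pulled (n l.+1) phi - pulled (n l) phi).
  have gen (p q r s : RA R A) : (p - q) - (r - s) = (p - r) - (q - s).
    by rewrite !opprB addrACA [- q - r]addrC addrACA.
  by rewrite /corr gen; congr (_ - _); rewrite [RHS]linearB.
rewrite (pulled_diff phi (ltnW (nS l))); set w := (stage_mean _ _ - _).
set x := ((cocy T 0 (n l.+1))^-1)%VF w.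
have lk' := n_mono lk.
rewrite (cocy_comp T_iet kT d0 _ (leq0n (n l.+1)) lk').
apply: le_trans (opnorm_onP _ (push_mem l.+1 (projW_compl _))) _.
have -> : opnorm_on (push T n V l.+1) (cocy T (n l.+1) (n k)) =
   Qnorm_on T n V l.+1 k by [].
have -> : cocy T 0 (n l.+1) (x - projW x) = w - cocy T 0 (n l.+1) (projW x).
  by rewrite linearB /= (cocy_surj T_iet kT d0).
apply: (@le_trans _ _ (Qnorm_on T n V l.+1 k *
   ((1 + #|A|%:R / c) * Qnorm T n l.+1 `^ tau *
   (D * kappa * Znorm T n l.+1 * bracket a (Qnorm T n l) * P)))).
  rewrite ler_wpM2l ?opnorm_on_ge0 //; apply: le_trans (projV_bound _ _) _.
  rewrite ler_wpM2l ?mulr_ge0 ?powR_ge0 ?addr_ge0 ?mulr_ge0 ?invr_ge0 ?(ltW c0) //.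
  exact: accel_error.
by rewrite le_eqVlt; apply/orP; left; apply/eqP; ring.
Qed.

(** The [W]-part telescopes forward from [k] to [m], the [V]-part back from [k] to 0. Stopping at a
    finite [m] leaves the last term, which is small for large [m] if the correction vanishes. *)
Lemma stage_mean_bound k m : (k <= m)%N ->
  l1norm (stage_mean (n k) phi) <=
    (1 + #|A|%:R / c) * (D * kappa) * P *
      (\sum_(k <= i < m) Qinvnorm_on T n W k i.+1 * Znorm T n i.+1 *
          bracket a (Qnorm T n i) * Qnorm T n i.+1 `^ tau
       + Cseq T n a tau V k)
    + Qnorm_on T n V 0 k * l1norm (stage_mean 0 phi - projW (stage_mean 0 phi))
    + l1norm (cocy T 0 (n k) (corr (n m) phi)).
Proof.
move=> km.
set t := fun i => Qinvnorm_on T n W k i.+1 * Znorm T n i.+1 *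
          bracket a (Qnorm T n i) * Qnorm T n i.+1 `^ tau.
have t0 i : 0 <= t i.
  by rewrite !mulr_ge0 ?opnorm_on_ge0 ?mxnorm_ge0 ?powR_ge0 ?bracket_ge0 ?Qnorm_ge1.
set F := (1 + _) * _ * P.
have F0 : 0 <= F.
  by rewrite !mulr_ge0 ?kappa_ge0 // addr_ge0 // divr_ge0 // ltW.
have hU : l1norm (cocy T 0 (n k) (corr (n k) phi)) <=
    F * (\sum_(k <= i < m) t i) + l1norm (cocy T 0 (n k) (corr (n m) phi)).
  have -> : corr (n k) phi = corr (n m) phi -
      \sum_(k <= i < m) (corr (n i.+1) phi - corr (n i) phi).
    by rewrite (telescope_sumr (fun i => corr (n i) phi) km) opprB addrC subrK.
  rewrite linearB /= linear_sum addrC; apply: le_trans (l1normD _ _) _.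
  rewrite l1normN lerD2r; apply: le_trans (l1norm_sum _ _ _) _.
  rewrite mulr_sumr big_nat_cond [leRHS]big_nat_cond; apply: ler_sum => i.
  rewrite andbT => /andP[ki _]; apply: le_trans (corr_tail ki) _.
  apply: ler_wpM2r; first exact: t0.
  apply: ler_wpM2r => //; apply: ler_wpM2r; first by rewrite mulr_ge0 ?kappa_ge0.
  by rewrite lerDr.
have hV : l1norm (cocy T 0 (n k) (pulled (n k) phi - corr (n k) phi)) <=
    F * Cseq T n a tau V k +
    Qnorm_on T n V 0 k * l1norm (stage_mean 0 phi - projW (stage_mean 0 phi)).
  pose e i := pulled (n i) phi - corr (n i) phi.
  have -> : pulled (n k) phi - corr (n k) phi = e 0%N + \sum_(0 <= i < k) (e i.+1 - e i).
    by rewrite (telescope_sumr e (leq0n k)) [RHS]addrC subrK.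
  rewrite linearD /= linear_sum addrC; apply: le_trans (l1normD _ _) _; apply: lerD.
    apply: le_trans (l1norm_sum _ _ _) _.
    (* The sum in [Cseq] starts at 1: its index is the end of a step, that of the telescoping sum
       its beginning. *)
    rewrite /Cseq big_add1 /= mulr_sumr big_nat_cond [leRHS]big_nat_cond.
    apply: ler_sum => i; rewrite andbT => /andP[_ ik].
    exact: compl_step.
  have p0 : pulled (n 0%N) phi = stage_mean 0 phi.
    by rewrite n0 -[RHS](pulledK 0) (cocy_id T_iet kT d0).
  rewrite /e /corr p0.
  have -> : cocy T 0 (n k) = cocy T (n 0%N) (n k) by rewrite n0.
  apply: opnorm_onP; rewrite -[X in X \in _](cocy_id T_iet kT d0 0) -{2}n0.
  exact: push_mem (projW_compl _).
rewrite -(pulledK (n k)) -{1}(subrK (corr (n k) phi) (pulled (n k) phi)) linearD /=.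
apply: le_trans (l1normD _ _) _; apply: le_trans (lerD hV hU) _.
by rewrite mulrDr; lra.
Qed.

End Sums.
End Accel.
End Splitting.
End Correction.

(** * Convergence along an acceleration *)

Section Convergence.
Variables (R : realType).

Section AccelCvg.
Variables (n : nat -> nat) (q : R).
Hypotheses (nS : forall k, (n k < n k.+1)%N) (q01 : 0 <= q < 1).

(** In the last block [N] and the preceding acceleration time are both compared with the end of the
    block, which accounts for the factor 2. *)
Lemma accel_cauchy (v : nat -> R) (B : R) : 0 <= B ->
  (forall l N, (n l <= N)%N -> (N <= n l.+1)%N ->
     `|v (n l.+1) - v N| <= B * q ^+ l.+1) ->
  forall m N, (n m <= N)%N -> `|v N - v (n m)| <= 2 * B / (1 - q) * q ^+ m.
Proof.
move=> B0 hv; have /andP[q0 q1] := q01.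
have K0 m : 0 <= B * q ^+ m by rewrite mulr_ge0 ?exprn_ge0.
have q1' : 0 < 1 - q by rewrite subr_gt0.
(* The geometric series in recursive form: passing one block costs no more than the gain from the
   smaller power of [q]. *)
have step m : B * q ^+ m.+1 + 2 * B / (1 - q) * q ^+ m.+1 <= 2 * B / (1 - q) * q ^+ m.
  have -> : 2 * B / (1 - q) * q ^+ m = (B * q ^+ m) * (2 / (1 - q)) by ring.
  have -> : B * q ^+ m.+1 + 2 * B / (1 - q) * q ^+ m.+1 =
    (B * q ^+ m) * (q + 2 * q / (1 - q)) by rewrite exprS; ring.
  rewrite ler_wpM2l // -(ler_pM2r q1') mulrDl divfK ?gt_eqF // divfK ?gt_eqF //.
  have : 0 <= (1 - q) * (1 - q) by rewrite mulr_ge0 ?(ltW q1').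
  by nra.
have step2 m : B * q ^+ m.+1 + B * q ^+ m.+1 <= 2 * B / (1 - q) * q ^+ m.
  apply: le_trans (step m); rewrite lerD2l.
  have -> : 2 * B / (1 - q) * q ^+ m.+1 = (B * q ^+ m.+1) * (2 / (1 - q)) by ring.
  by rewrite ler_peMr // ler_pdivlMr // mul1r; lra.
(* Induction on the number of blocks, moving the starting time [m] forward. *)
have main k : forall m N, (n m <= N)%N -> (N <= n (m + k))%N ->
    `|v N - v (n m)| <= 2 * B / (1 - q) * q ^+ m.
  elim: k => [|k IH] m N h1 h2.
    have -> : N = n m by apply/eqP; rewrite eqn_leq h1 andbT; rewrite addn0 in h2.
    rewrite subrr normr0; have -> : 2 * B / (1 - q) * q ^+ m = (B * q ^+ m) * (2 / (1 - q)) by ring.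
    by rewrite mulr_ge0 // divr_ge0 // ltW.
  have hm := hv m (n m) (leqnn _) (ltnW (nS m)).
  have [h3|/ltnW h3] := leqP N (n m.+1).
    have hN := hv m N h1 h3; apply: le_trans (step2 m).
    have -> : v N - v (n m) = (v (n m.+1) - v (n m)) - (v (n m.+1) - v N) by ring.
    by apply: le_trans (ler_normB _ _) _; apply: lerD.
  have {}IH := IH m.+1 N h3; apply: le_trans (step m).
  have -> : v N - v (n m) = (v (n m.+1) - v (n m)) + (v N - v (n m.+1)) by ring.
  apply: le_trans (ler_normD _ _) _; apply: lerD => //; apply: IH.
  by rewrite addSnnS.
move=> m N h; apply: (main N) => //.
have ge k : (k <= n k)%N by elim: k => // k IH; apply: leq_ltn_trans IH (nS k).
by apply: leq_trans (ge (m + N)%N); rewrite leq_addl.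
Qed.

Lemma accel_cvg (v : nat -> R) (B : R) : 0 <= B ->
  (forall l N, (n l <= N)%N -> (N <= n l.+1)%N ->
     `|v (n l.+1) - v N| <= B * q ^+ l.+1) ->
  forall m N, (n m <= N)%N ->
    `|v N - limn v| <= 4 * B / (1 - q) * q ^+ m.
Proof.
move=> B0 hv; have hc := accel_cauchy B0 hv; have /andP[q0 q1] := q01.
have q1' : 0 < 1 - q by rewrite subr_gt0.
set K := 2 * B / (1 - q) in hc.
have Kge0 : 0 <= K by rewrite divr_ge0 ?mulr_ge0 // ltW.
have cv : cvgn v.
  apply/cauchy_cvgP; apply: cauchy_exP => e e0.
  have cq : (fun m => K * q ^+ m) @ \oo --> 0.
    rewrite -(mulr0 K); apply: cvgM; first exact: cvg_cst.
    by apply: cvg_expr; rewrite ger0_norm.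
  have [m _ hm] : \forall m \near \oo, K * q ^+ m < e.
    have /cvgrPdist_lt /(_ e e0) [M _ hM] := cq; exists M => // i /hM /=.
    by rewrite sub0r normrN; apply: le_lt_trans; apply: ler_norm.
  exists (v (n m)); exists (n m) => // N /= hN.
  rewrite /ball /= distrC; apply: le_lt_trans (hc m N hN) _.
  by apply: hm => /=.
move=> m N mN.
have lb : `|limn v - v (n m)| <= K * q ^+ m.
  have cv' : (fun N => `|v N - v (n m)|) @ \oo --> `|limn v - v (n m)|.
    by apply: cvg_norm; apply: cvgB; [exact: cv|exact: cvg_cst].
  apply: (cvgr_to_le cv'); exists (n m) => // i /= hi; exact: hc.
have -> : v N - limn v = (v N - v (n m)) - (limn v - v (n m)) by ring.
apply: le_trans (ler_normB _ _) _; apply: le_trans (lerD (hc m N mN) lb) _.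
by rewrite /K le_eqVlt; apply/orP; left; apply/eqP; field; rewrite gt_eqF.
Qed.

End AccelCvg.

Lemma ln_le_powR (x t : R) : 0 < t -> 1 <= x -> ln x <= t^-1 * x `^ t.
Proof.
move=> t0 x1; have x0 : 0 < x by lra.
by rewrite ler_pdivlMl // -ln_powR; apply/ltW/ln_sublinear/powR_gt0.
Qed.

(** A small extra exponent absorbs the logarithm, so that a = 0 and a > 0 are treated alike. *)
Lemma bracket_le_powR (a t x : R) : 0 <= a -> 0 < t -> 1 <= x ->
  bracket a x <= (1 + t^-1) * x `^ (a + t).
Proof.
move=> a0 t0 x1; rewrite /bracket mulrDl mul1r.
have le1 (u v : R) : u <= v -> x `^ u <= x `^ v by move=> uv; apply: ler_powR.
have [->|_] := eqVneq a 0.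
  rewrite add0r; apply: lerD; last exact: ln_le_powR.
  by rewrite -(powRr0 x); apply: le1; apply: ltW.
apply: le_trans (le1 a (a + t) _) _; first by rewrite lerDl ltW.
by rewrite lerDl mulr_ge0 ?powR_ge0 // invr_ge0 ltW.
Qed.

(* If tau is small, the expansion of Q on U_j beats the growth of the error. *)
Lemma growth_bound (a tau C l1 l' : R) (Qi Z Q : nat -> R) (r : nat -> nat) :
  0 <= a < 1 -> 0 < tau -> tau <= 1 -> 0 <= l1 -> 1 <= C ->
  tau * (2 + 5 * l1) < l' - l1 * a ->
  (exists2 L : R, 1 < L & (fun m : nat => (r m)%:R / m%:R : R) @ \oo --> L) ->
  (forall m, (0 < m)%N -> Qi m <= C * expR ((- l' + tau) * (r m)%:R)) ->
  (forall m, 0 <= Qi m) -> (forall m, 0 <= Z m) ->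
  (forall m, Z m.+1 <= C * expR (tau * m%:R)) ->
  (forall m, 1 <= Q m) ->
  (forall m, Q m <= C * expR (l1 * (1 + tau) * m%:R)) ->
  exists B q, [/\ 0 <= B, 0 <= q < 1 &
    forall m, Qi m.+1 * (Q m.+1 `^ tau * (Z m.+1 * bracket a (Q m.+1))) <= B * q ^+ m.+1].
Proof.
move=> /andP[a0 a1] t0 t1 l10 C1 gap [L L1 rL] hQi Qi0 Z0 hZ Q1 hQ.
have C0 : 0 < C by lra.
have tl : - l' + tau <= 0.
  have : 0 <= l1 * a by rewrite mulr_ge0.
  have : 0 <= tau * l1 by rewrite mulr_ge0 // ltW.
  by lra.
(* Since r(0,m)/m tends to L > 1, r(0,m) is at least m up to a constant, and decay in r(0,m) becomes
   decay in m. *)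
have [K hK] : exists K : nat, forall m, (m%:R - K%:R : R) <= (r m)%:R.
  have /cvgrPdist_lt /(_ (L - 1)) : (fun m : nat => (r m)%:R / m%:R : R) @ \oo --> L by [].
  rewrite subr_gt0 => /(_ L1) [K _ hK]; exists K => m.
  have [mK|Km] := ltnP m K.
    by apply: (@le_trans _ _ 0); rewrite ?ler0n // subr_le0 ler_nat ltnW.
  apply: (@le_trans _ _ m%:R); first by rewrite gerBl ler0n.
  case: m Km => [|m] Km; first by rewrite ler0n.
  have := hK m.+1 Km; rewrite /= ltr_norml => /andP[_ h].
  have : 1 <= (r m.+1)%:R / m.+1%:R :> R by move: h; rewrite ltrD2l ltrN2 => /ltW.
  by rewrite ler_pdivlMr ?ltr0n // mul1r.
(* The total exponential rate of the product. As [a] and [tau] are at most 1, it is at most -l' + l1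
   a + tau (2 + 5 l1), which is negative by [gap]. *)
set s := - l' + tau + tau + l1 * (1 + tau) * (a + tau + tau).
have s0 : s < 0.
  rewrite /s; have : 0 <= l1 * tau * (1 - a) by rewrite !mulr_ge0 // ?ltW //; lra.
  have : 0 <= l1 * tau * (1 - tau) by rewrite !mulr_ge0 ?(ltW t0) ?subr_ge0.
  by move: gap; lra.
exists (C * expR (- (- l' + tau) * K%:R) * ((1 + tau^-1) * C `^ (a + tau + tau)) * C), (expR s).
split.
- by rewrite !mulr_ge0 ?expR_ge0 ?powR_ge0 ?addr_ge0 ?invr_ge0 // ltW.
- by rewrite expR_ge0 -expR0 ltr_expR.
move=> m; set M := m.+1.
have b1 : Qi M <= C * expR (- (- l' + tau) * K%:R) * expR ((- l' + tau) * M%:R).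
  apply: le_trans (hQi M isT) _; rewrite -mulrA -expRD ler_wpM2l ?(ltW C0) //.
  rewrite ler_expR; have := hK M; rewrite -subr_ge0 => h.
  have := mulr_le0_ge0 tl h; lra.
have b2 : Z M <= C * expR (tau * M%:R).
  apply: le_trans (hZ m) _; rewrite ler_wpM2l ?(ltW C0) // ler_expR ler_wpM2l ?(ltW t0) //.
  by rewrite ler_nat.
have Q0 : 0 < Q M by apply: lt_le_trans (Q1 M).
have br0 : 0 <= bracket a (Q M) by apply: bracket_ge0.
have b3 : Q M `^ tau * bracket a (Q M) <=
    ((1 + tau^-1) * C `^ (a + tau + tau)) * expR (l1 * (1 + tau) * (a + tau + tau) * M%:R).
  apply: (@le_trans _ _ ((1 + tau^-1) * Q M `^ (a + tau + tau))).
    rewrite [Q M `^ (_ + tau + _)]powRD ?(gt_eqF Q0) ?implybT // mulrA mulrC.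
    by rewrite ler_wpM2r ?powR_ge0 // bracket_le_powR.
  rewrite -mulrA ler_wpM2l ?addr_ge0 ?invr_ge0 ?(ltW t0) //.
  have -> : expR (l1 * (1 + tau) * (a + tau + tau) * M%:R) =
      expR (l1 * (1 + tau) * M%:R) `^ (a + tau + tau).
    by rewrite -expRM; congr expR; ring.
  rewrite -powRM ?expR_ge0 ?(ltW C0) //.
  apply: ge0_ler_powR; rewrite ?nnegrE ?mulr_ge0 ?expR_ge0 ?(ltW C0) ?(ltW Q0) //.
  by rewrite !addr_ge0 // ltW.
rewrite (_ : _ * (_ * _) = Qi M * ((Q M `^ tau * bracket a (Q M)) * Z M)); last by ring.
apply: le_trans (ler_pM _ _ b1 (ler_pM _ _ b3 b2)) _ => //.
- by rewrite !mulr_ge0 ?powR_ge0.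
- by rewrite !mulr_ge0 ?powR_ge0.
rewrite -expRM_natr /s (_ : (_ + l1 * _ * _) * M%:R = (- l' + tau) * M%:R +
  (l1 * (1 + tau) * (a + tau + tau) * M%:R + tau * M%:R)); last by ring.
by rewrite !expRD le_eqVlt; apply/orP; left; apply/eqP; ring.
Qed.

End Convergence.

(** * The correction operator and the estimate *)

Section Final.
Variables (R : realType) (A : finType) (d : nat).
Local Notation mu := (@lebesgue_measure R).

(* The integral of a nonnegative function is a supremum over the simple
   functions below it. *)
Lemma ge0_integral_monotone (D D' : set R) (f : R -> \bar R) :
  (forall x, 0 <= f x)%E -> D `<=` D' ->
  (\int[mu]_(x in D) f x <= \int[mu]_(x in D') f x)%E.
Proof.
move=> f0 DD'; have h (E : set R) x : (0 <= (f \_ E) x)%E.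
  by rewrite patchE; case: ifP.
rewrite integral_mkcond [leRHS]integral_mkcond !ge0_integralTE //.
apply: le_ereal_sup => _ [g /= gf <-]; exists g => //= x; apply: le_trans (gf x) _.
rewrite !patchE; case: ifPn => [/set_mem/DD'/mem_set -> //|_].
by case: ifP.
Qed.

(** Replaces the finite partial sum by the possibly infinite series. *)
Lemma leeD_estimate (F G part Cs P Qn x0 e s : R) (K L : \bar R) :
  0 <= F -> 0 <= G -> 0 <= part -> 0 <= Cs -> 0 <= P -> 0 <= Qn -> 0 <= s ->
  (0 <= K)%E -> (0 <= L)%E -> (part%:E <= K)%E -> (x0%:E <= G%:E * (L * s%:E))%E ->
  ((F * ((part + Cs) * P) + Qn * x0 + e)%:E <=
   (1 + F + G)%:E * ((K + Cs%:E) * P%:E + Qn%:E * (L * s%:E)) + e%:E)%E.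
Proof.
move=> F0 G0 p0 C0 P0 Q0 s0 K0 L0 pK xG.
have FG0 : 0 <= 1 + F + G by rewrite !addr_ge0.
have LS : (0 <= L * s%:E)%E by apply: mule_ge0.
have KC : (0 <= K + Cs%:E)%E by apply: adde_ge0.
rewrite EFinD; apply: leeD; last exact: lexx.
rewrite ge0_muleDr; last 2 first.
- by apply: mule_ge0.
- by apply: mule_ge0.
rewrite EFinD; apply: leeD.
  rewrite EFinM; apply: lee_pmul.
  - by rewrite lee_fin.
  - by rewrite lee_fin mulr_ge0 ?addr_ge0.
  - by rewrite lee_fin; lra.
  rewrite EFinM; apply: lee_wpmul2r; first by rewrite lee_fin.
  by rewrite EFinD; apply: leeD.
rewrite EFinM muleCA; apply: lee_wpmul2l; first by rewrite lee_fin.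
apply: (le_trans xG); apply: lee_wpmul2r; first exact: LS.
by rewrite lee_fin; lra.
Qed.

(** With a single position [omega] vanishes, so [Hspace] would be zero. *)
Lemma dim_gt0 (T : iet R A d) (g : nat) : is_iet T -> (0 < g)%N ->
  \dim (Hspace R (perm_of T)) = (2 * g)%N -> (0 < d)%N.
Proof.
move=> T_iet g0; rewrite lt0n => dimH; apply/eqP => d0; subst d.
have o0 (x y : A) : omega R (perm_of T) x y = 0.
  by rewrite /omega !ord1 ltnn.
have l0 : mxlin (omega R (perm_of T)) = 0.
  apply/lfunP => h; rewrite lfunE /= zero_lfunE; apply/ffunP => x.
  by rewrite !ffunE big1 // => y _; rewrite o0 mul0r.
move: dimH; rewrite /Hspace l0 lim0g dimv0 => /esym/eqP.
by rewrite muln_eq0 /= => /eqP g00; rewrite g00 in g0.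
Qed.

Lemma lyapunov_ge0 (g : nat) (lam : nat -> R) :
  (forall i : nat, (1 <= i <= g)%N -> lam i.+1 < lam i) -> lam g.+1 = 0 ->
  0 <= lam 1%N.
Proof.
move=> dec lg; suff H k : (k <= g)%N -> 0 <= lam (g.+1 - k)%N.
  by have := H g (leqnn g); rewrite subSnn.
elim: k => [|k IH] kg; first by rewrite subn0 lg.
apply: le_trans (IH (ltnW kg)) _; rewrite subSn ?(ltnW kg) //.
rewrite subSS; have := dec (g - k)%N; rewrite subn_gt0 kg leq_subr => /(_ isT).
exact: ltW.
Qed.

Section L1.
Variables (T : iet R A d) (a : R).
Hypotheses (rT : regular T) (a01 : 0 <= a < 1).

Lemma stage_mean0_bound (phi : R -> R) : PaG T a phi ->
  ((l1norm (stage_mean T 0 phi))%:E <=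
    (\sum_b (len T b : R)^-1)%:E * L1norm T phi)%E.
Proof.
move=> hphi; have [_ _ l0] := rT.
have L0 : (0 <= L1norm T phi)%E by apply: integral_ge0 => x _; rewrite lee_fin.
rewrite /l1norm -sumEFin -sumEFin ge0_sume_distrl; last first.
  by move=> b _; rewrite lee_fin invr_ge0 ltW.
apply: lee_sum => b _; rewrite ffunE /tower_mean big_ord_recl big_ord0 addr0 /=.
rewrite /avg normrM gtr0_norm ?invr_gt0 // EFinM.
apply: lee_wpmul2l; first by rewrite lee_fin invr_ge0 ltW.
have intb := PaG_integrable rT a01 hphi b.
rewrite /itg EFin_normr_Rintegral //.
apply: le_trans (le_abse_integral _ _ _) _ => //.
  by case/integrableP: intb.
apply: ge0_integral_monotone; first by move=> x; rewrite lee_fin.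
move=> x; rewrite /= in_itv /= => /andP[x1 x2]; apply: (itv_in_all rT (a := b)).
by rewrite itvE (ltW x1).
Qed.

End L1.

Section Operator.
Variables (T : iet R A d) (a : R) (V W : {vspace RA R A}) (n : nat -> nat) (B q : R).
Hypotheses (T_iet : is_iet T) (kT : keane T) (d0 : (0 < d)%N) (a01 : 0 <= a < 1)
  (VWfull : (V + W)%VS = fullv) (VW0 : (V :&: W)%VS = 0%VS)
  (n0 : n 0%N = 0%N) (nS : forall k, (n k < n k.+1)%N)
  (B0 : 0 <= B) (q01 : 0 <= q < 1)
  (hcorr : forall phi, PaG T a phi -> forall l N, (n l <= N)%N -> (N <= n l.+1)%N ->
    l1norm (corr T V W (n l.+1) phi - corr T V W N phi) <=
      B * pa_real T a phi * q ^+ l.+1).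

Let rT : regular T := iet_regular T_iet.

Definition correction (phi : R -> R) : RA R A :=
  [ffun b => limn (fun N => corr T V W N phi b : R)].

Lemma correction_cvg phi m N : PaG T a phi -> (n m <= N)%N ->
  l1norm (corr T V W N phi - correction phi) <=
    #|A|%:R * (4 * (B * pa_real T a phi) / (1 - q)) * q ^+ m.
Proof.
move=> hphi mN; have BP : 0 <= B * pa_real T a phi by rewrite mulr_ge0 ?pa_real_ge0.
rewrite -mulrA mulr_natl -sumr_const /=; apply: ler_sum => b _; rewrite !ffunE.
apply: (accel_cvg nS q01 BP (v := fun N => corr T V W N phi b : R)) => //.
move=> l M lM Ml; apply: le_trans (hcorr hphi lM Ml).
by have := l1norm_coord (corr T V W (n l.+1) phi - corr T V W M phi) b; rewrite !ffunE.
Qed.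

Lemma correction_small phi (e : R) : PaG T a phi -> 0 < e ->
  exists N0, forall N, (N0 <= N)%N -> l1norm (corr T V W N phi - correction phi) <= e.
Proof.
move=> hphi e0; set K := #|A|%:R * (4 * (B * pa_real T a phi) / (1 - q)).
have cq : (fun m => K * q ^+ m) @ \oo --> 0.
  rewrite -(mulr0 K); apply: cvgM; first exact: cvg_cst.
  by apply: cvg_expr; case/andP: q01 => q0 q1; rewrite ger0_norm.
have /cvgrPdist_lt /(_ e e0) [m _ hm] := cq.
exists (n m) => N mN; apply: le_trans (correction_cvg hphi mN) _.
have := hm m (leqnn m); rewrite /= sub0r normrN => h.
by apply: le_trans (ltW h); apply: ler_norm.
Qed.

Lemma l1norm_small (h : RA R A) : (forall e, 0 < e -> l1norm h <= e) -> h = 0.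
Proof.
move=> hs; apply: l1norm_eq0; apply/eqP; rewrite eq_le l1norm_ge0 andbT.
by apply/ler_addgt0Pr => e e0; rewrite add0r; apply: hs.
Qed.

(** The subspace [W] is closed: the bounded projection fixes every [corr], hence their limit. *)
Lemma correction_mem phi : PaG T a phi -> correction phi \in W.
Proof.
move=> hphi; rewrite -(_ : projW V W (correction phi) = correction phi).
  exact: projW_mem.
apply/eqP; rewrite -subr_eq0; apply/eqP; apply: l1norm_small => e e0.
have [M M0 hM] := lfun_bounded (projW V W).
have [|N /(_ N (leqnn N)) hN] := @correction_small phi (e / (M + 1)) hphi.
  by rewrite divr_gt0 //; lra.
set x := corr T V W N phi in hN; have xW : projW V W x = x.
  by apply: projW_id => //; apply: projW_mem.
have -> : projW V W (correction phi) - correction phi =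
    (x - correction phi) - projW V W (x - correction phi).
  by rewrite [projW V W (_ - _)]linearB /= xW opprB [RHS]addrC addrA subrK.
apply: le_trans (l1normB _ _) _.
apply: le_trans (lerD (lexx _) (hM _)) _.
have -> : e = (e / (M + 1)) + M * (e / (M + 1)).
  by field; rewrite gt_eqF //; lra.
by apply: lerD => //; rewrite ler_wpM2l.
Qed.

Lemma corr_linear (s : R) phi psi N : PaG T a phi -> PaG T a psi ->
  corr T V W N (fun t => s * phi t + psi t) =
  s *: corr T V W N phi + corr T V W N psi.
Proof.
move=> h1 h2; rewrite /corr /pulled (stage_mean_linear T_iet kT d0 s N a01 h1 h2).
by rewrite !linearP.
Qed.

Lemma correction_linear (s : R) phi psi : PaG T a phi -> PaG T a psi ->
  correction (fun t => s * phi t + psi t) =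
  s *: correction phi + correction psi.
Proof.
move=> h1 h2; apply/ffunP => b; rewrite !ffunE.
have cv psi' : PaG T a psi' ->
    (fun N => corr T V W N psi' b : R) @ \oo --> (correction psi' b : R).
  move=> h; apply/cvgrPdist_le => e e0.
  have [N0 hN] := correction_small h e0; exists N0 => // N /= /hN.
  apply: le_trans; rewrite distrC.
  by have := l1norm_coord (corr T V W N psi' - correction psi') b; rewrite !ffunE.
apply: cvg_lim => //.
have -> : (fun N => corr T V W N (fun t => s * phi t + psi t) b : R) =
   (fun N => s * (corr T V W N phi b : R) + (corr T V W N psi b : R)).
  by apply/funext => N; rewrite corr_linear // !ffunE.
have := cv _ h1; have := cv _ h2; rewrite !ffunE => c2 c1.
apply: cvgD; last exact: c2.
by apply: cvgM; [exact: cvg_cst|exact: c1].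
Qed.

(** At time 0 the correction is a projection of the means of [phi], bounded by the L^1 norm; its
    distance to the limit is bounded by [pa]. *)
Lemma correction_bounded : exists M : R, forall phi, PaG T a phi ->
  ((l1norm (correction phi))%:E <= M%:E * PaG_norm T a phi)%E.
Proof.
have [Mp Mp0 hMp] := lfun_bounded (projW V W).
have [_ _ l0] := rT; have /andP[q0 q1] := q01.
set K1 := Mp * \sum_b (len T b : R)^-1; set K2 := #|A|%:R * (4 * B / (1 - q)).
have K10 : 0 <= K1.
  by rewrite mulr_ge0 // sumr_ge0 // => b _; rewrite invr_ge0 ltW.
have K20 : 0 <= K2 by rewrite mulr_ge0 // divr_ge0 ?mulr_ge0 // subr_ge0 ltW.
exists (K1 + K2) => phi hphi.
have P0 := pa_real_ge0 hphi.
have L0 : (0 <= L1norm T phi)%E by apply: integral_ge0 => x _; rewrite lee_fin.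
have h : l1norm (correction phi) <=
    Mp * l1norm (stage_mean T 0 phi) + K2 * pa_real T a phi.
  have -> : correction phi = corr T V W 0 phi - (corr T V W 0 phi - correction phi).
    by rewrite opprB addrC subrK.
  apply: le_trans (l1normB _ _) _; apply: lerD.
    rewrite /corr; apply: le_trans (hMp _) _; rewrite ler_wpM2l //.
    by rewrite -[leRHS](congr1 _ (pulledK T_iet kT d0 0 phi)) (cocy_id T_iet kT d0).
  have := correction_cvg (m := 0) (N := 0) hphi; rewrite n0 => /(_ (leqnn 0)%N) hc.
  rewrite expr0 mulr1 in hc; apply: le_trans hc _; rewrite /K2.
  by rewrite le_eqVlt; apply/orP; left; apply/eqP; ring.
apply: (@le_trans _ _ (Mp * l1norm (stage_mean T 0 phi) + K2 * pa_real T a phi)%:E).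
  by rewrite lee_fin.
rewrite EFinD /PaG_norm ge0_muleDr ?pa_ge0 //; apply: leeD.
  rewrite EFinM; apply: (@le_trans _ _ (K1%:E * L1norm T phi)%E).
    rewrite /K1 EFinM -muleA; apply: lee_wpmul2l; first by rewrite lee_fin.
    exact: (stage_mean0_bound rT a01 hphi).
  by apply: lee_wpmul2r => //; rewrite lee_fin lerDl.
rewrite EFinM (paE hphi); apply: lee_wpmul2r; first by rewrite lee_fin.
by rewrite lee_fin lerDr.
Qed.

Section Estimate.
Variables (n' : nat -> nat) (tau c kappa D : R).
Hypotheses (tau0 : 0 <= tau) (c0 : 0 < c) (n0' : n' 0%N = 0%N)
  (nS' : forall k, (n' k < n' k.+1)%N)
  (bal : forall k b, total_len (stage T n' k) / (len (stage T n' k) b : R) <= kappa)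
  (ang : forall k, c * Qnorm T n' k `^ (- tau) <=
           sin_angle (push T n' V k) (push T n' W k))
  (D0 : 0 <= D)
  (err : forall phi N N' kappa, PaG T a phi -> (N <= N')%N ->
    (forall b, total_len (iter N' (@rauzy R A d) T) / (len (iter N' (@rauzy R A d) T) b : R) <= kappa) ->
    l1norm (stage_mean T N' phi - cocy T N N' (stage_mean T N phi)) <=
    D * kappa * mxnorm (visit_mx (iter N (@rauzy R A d) T) (iter N' (@rauzy R A d) T)) *
    bracket a (total_len T / total_len (iter N (@rauzy R A d) T)) * pa_real T a phi).

Lemma correction_estimate : exists C : R, 1 <= C /\
  forall phi : R -> R, PaG T a phi -> correction phi = 0 -> forall k : nat,
    ((l1norm (mean_proj (stage T n' k) (special_birkhoff T n' k phi)))%:E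
     <= C%:E * ((Kseq T n' a tau W k + (Cseq T n' a tau V k)%:E) * pa T a phi
                + (Qnorm_on T n' V 0 k)%:E
                  * (L1norm T phi * ((total_len T)^-1)%:E)))%E.
Proof.
have [_ _ l0] := rT; have X0 := total_gt0 T_iet.
have [Mp Mp0 hMp] := lfun_bounded (projW V W).
have kap0 := kappa_ge0 T_iet kT d0 bal.
set F := (1 + #|A|%:R / c) * (D * kappa).
have F0 : 0 <= F by rewrite !mulr_ge0 // addr_ge0 // divr_ge0 // ltW.
(* The factor [total_len T] compensates the division of the L^1 norm by |I| in the statement. *)
set G := (1 + Mp) * (\sum_b (len T b : R)^-1) * total_len T.
have s0 : 0 <= \sum_b (len T b : R)^-1.
  by rewrite sumr_ge0 // => b _; rewrite invr_ge0 ltW.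
have G0 : 0 <= G by rewrite !mulr_ge0 ?addr_ge0 // ltW.
exists (1 + F + G); split; first by rewrite -addrA lerDl addr_ge0.
move=> phi hphi h0 k; have P0 := pa_real_ge0 hphi.
rewrite (stage_meanE T_iet kT d0 k a01 n0' hphi) (paE hphi).
set P := pa_real T a phi in P0 *.
have Q1 := Qnorm_ge1 T_iet kT d0 nS'.
have t0 i : 0 <= Qinvnorm_on T n' W k i.+1 * Znorm T n' i.+1 *
    bracket a (Qnorm T n' i) * Qnorm T n' i.+1 `^ tau.
  by rewrite !mulr_ge0 ?opnorm_on_ge0 ?mxnorm_ge0 ?powR_ge0 ?bracket_ge0.
have C0 : 0 <= Cseq T n' a tau V k.
  apply: sumr_ge0 => i _.
  by rewrite !mulr_ge0 ?opnorm_on_ge0 ?mxnorm_ge0 ?powR_ge0 ?bracket_ge0.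
have L0 : (0 <= L1norm T phi)%E by apply: integral_ge0 => x _; rewrite lee_fin.
have K0 : (0 <= Kseq T n' a tau W k)%E by apply: nneseries_ge0 => i _ _; rewrite lee_fin.
have cst0 : 0 <= 1 + F + G by rewrite !addr_ge0.
(* For fixed [k], the margin [e] pays for the correction remaining at a late time. *)
apply/lee_addgt0Pr => e e0.
have [M M0 hM] := lfun_bounded (cocy T 0 (n' k)).
have [|N hN] := @correction_small phi (e / (M + 1)) hphi; first by rewrite divr_gt0 //; lra.
have ge i : (i <= n' i)%N by elim: i => // i IH; apply: leq_ltn_trans IH (nS' i).
have km : (k <= k + N)%N by rewrite leq_addr.
(* The convergence holds over all Rauzy times, so it can be read along [n'], although it was proved
   with [n]. *)
have last : l1norm (cocy T 0 (n' k) (corr T V W (n' (k + N)%N) phi)) <= e.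
  have := hN (n' (k + N)%N) (leq_trans (leq_addl k N) (ge _)); rewrite h0 subr0 => h.
  apply: le_trans (hM _) _; apply: (@le_trans _ _ (M * (e / (M + 1)))).
    by rewrite ler_wpM2l.
  by rewrite mulrCA ler_piMr ?(ltW e0) // ler_pdivrMr; lra.
have := stage_mean_bound T_iet kT d0 VWfull VW0 tau0 c0 n0' nS' bal ang a01 hphi D0
  (fun N N' le => err hphi le) km.
set part := \sum_(k <= i < k + N) _ => bound.
have part0 : 0 <= part by apply: sumr_ge0 => i _; apply: t0.
have partK : (part%:E <= Kseq T n' a tau W k)%E.
  rewrite /part -sumEFin; apply: nneseries_lim_ge => i _ _; rewrite lee_fin //.
set x0 := l1norm (stage_mean T 0 phi - _) in bound.
have x0le : (x0%:E <= G%:E * (L1norm T phi * ((total_len T)^-1)%:E))%E.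
  apply: (@le_trans _ _ ((1 + Mp) * l1norm (stage_mean T 0 phi))%:E).
    rewrite lee_fin mulrDl mul1r; apply: le_trans (l1normB _ _) _.
    by rewrite lerD2l.
  rewrite muleA [X in (_ <= X)%E]muleAC -EFinM /G mulfK ?gt_eqF // !EFinM -muleA.
  apply: lee_wpmul2l; first by rewrite lee_fin addr_ge0.
  exact: (stage_mean0_bound rT a01 hphi).
apply: (@le_trans _ _ ((F * ((part + Cseq T n' a tau V k) * P) + Qnorm_on T n' V 0 k * x0) + e)%:E).
  rewrite lee_fin; apply: le_trans bound _; rewrite -/F -/P.
  apply: lerD => //; apply: lerD => //.
  by rewrite le_eqVlt; apply/orP; left; apply/eqP; ring.
apply: leeD_estimate => //; first exact: opnorm_on_ge0.
by rewrite invr_ge0 ltW.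
Qed.

End Estimate.
End Operator.
End Final.

Theorem theorem6p1 (R : realType) (A : finType) (d : nat) (T : iet R A d)
    (g : nat) (N : iet R A d -> nat) (mu : probability (iet_space R A d) R)
    (lam : nat -> R) (F E U : nat -> {vspace RA R A})
    (T_iet : is_iet T)
    (dimH : \dim (Hspace R (perm_of T)) = (2 * g)%N)
    (refN : reference_acceleration (perm_of T) N mu)
    (lyap : lyapunov_exponents N g lam mu)
    (T_FDC : FDC T g lam E U N F)
    (a : R) (a01 : 0 <= a < 1)
    (j : nat) (j_range : (2 <= j <= g.+1)%N)
    (a_lam : lam j <= lam 1%N * a < lam j.-1) :
  exists h : (R -> R) -> RA R A,
    bounded_linear_operator T a (U j) h /\
    forall (tau : R) (n : nat -> nat), 0 < tau ->
      FDC_acceleration T g lam E U tau n ->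
      exists C : R, 1 <= C /\
        forall phi : R -> R, PaG T a phi -> h phi = 0 -> forall k : nat,
          ((l1norm (mean_proj (stage T n k) (special_birkhoff T n k phi)))%:E
           <= C%:E * ((Kseq T n a tau (U j) k + (Cseq T n a tau (E j) k)%:E)
                        * pa T a phi
                      + (Qnorm_on T n (E j) 0 k)%:E
                        * (L1norm T phi * ((total_len T)^-1)%:E)))%E.
Proof.
have [kT _ [_ _ _ EU] acc] := T_FDC; have [dec lg _] := lyap.
have /andP[j2 jg] := j_range.
have g0 : (0 < g)%N by rewrite -ltnS; apply: leq_trans jg.
have d0 := dim_gt0 T_iet g0 dimH.
have l10 := lyapunov_ge0 dec lg.
have [EUfull EU0] : (E j + U j)%VS = fullv /\ (E j :&: U j)%VS = 0%VS.
  by apply: EU; rewrite jg (ltnW j2).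
have [D D0 err] := stage_error T_iet kT d0 a01.
have /andP[_ gap0] := a_lam.
set gap := lam j.-1 - lam 1%N * a.
have gp : 0 < gap by rewrite subr_gt0.
(* The factor 2 makes t (2 + 5 lam_1) at most half the gap, hence strictly below it, as
   [growth_bound] demands. *)
pose w := 2 * (2 + 5 * lam 1%N); have w0 : 0 < w by rewrite /w; lra.
pose t := Num.min 1 (gap / w).
have t0 : 0 < t by rewrite /t lt_min ltr01 divr_gt0.
have t1 : t <= 1 by rewrite /t ge_min lexx.
have tw : t * w <= gap by rewrite -ler_pdivlMr // /t ge_min lexx orbT.
(* This acceleration serves only to construct the operator; the estimate uses the one belonging to
   the given [tau]. *)
have [n [c [C [kappa [delta [r data]]]]]] := acc t t0.
have [n0 nS] := fdc_accel data.
have [B1 [q [B10 q01 hB1]]] : exists B q, [/\ 0 <= B, 0 <= q < 1 &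
    forall m, Qinvnorm_on T n (U j) 0 m.+1 * (Qnorm T n m.+1 `^ t *
      (Znorm T n m.+1 * bracket a (Qnorm T n m.+1))) <= B * q ^+ m.+1].
  apply: (@growth_bound R a t C (lam 1%N) (lam j.-1) (Qinvnorm_on T n (U j) 0)
    (Znorm T n) (Qnorm T n) (rsum r 0)) => //.
  - exact: fdc_C data.
  - rewrite -/gap; have -> : t * (2 + 5 * lam 1%N) = t * w / 2 by rewrite /w; field.
    by lra.
  - by have [L /andP[L1 _] hL] := fdc_rlim data; exists L.
  - by move=> m m0; apply: (fdc_U data m0 j_range).
  - by move=> m; apply: opnorm_on_ge0.
  - by move=> m; apply: mxnorm_ge0.
  - exact: fdc_Z data.
  - by move=> m; apply: (Qnorm_ge1 T_iet kT d0 nS).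
  - by move=> m; have /andP[] := fdc_Q data m.
have c0 := fdc_c data; have bal := fdc_bal data.
have ang k : c * Qnorm T n k `^ (- t) <= sin_angle (push T n (E j) k) (push T n (U j) k).
  exact: (fdc_angle data).
have kap0 := kappa_ge0 T_iet kT d0 bal.
set B := #|A|%:R / c * (D * kappa) * B1.
have B0 : 0 <= B by rewrite !mulr_ge0 // invr_ge0 ltW.
have hcorr phi : PaG T a phi -> forall l M, (n l <= M)%N -> (M <= n l.+1)%N ->
    l1norm (corr T (E j) (U j) (n l.+1) phi - corr T (E j) (U j) M phi) <=
      B * pa_real T a phi * q ^+ l.+1.
  move=> hphi l M lM Ml.
  apply: le_trans (corr_between T_iet kT d0 EUfull EU0 c0 n0 nS bal ang a01 hphi D0
    (fun N1 N2 le => err phi N1 N2 kappa hphi le) lM Ml) _.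
  have P0 := pa_real_ge0 hphi.
  have e0 : 0 <= #|A|%:R / c * (D * kappa) * pa_real T a phi.
    by rewrite !mulr_ge0 // invr_ge0 ltW.
  have := ler_wpM2l e0 (hB1 l); move: (Qinvnorm_on _ _ _ _ _) (Qnorm _ _ _ `^ _).
  by move=> x1 x2; congr (_ <= _); rewrite ?/B; ring.
exists (correction T (E j) (U j)); split.
  split.
  - by move=> phi; apply: (correction_mem EU0 nS B0 q01 hcorr).
  - move=> s phi psi h1 h2.
    exact: (correction_linear T_iet kT d0 a01 nS B0 q01 hcorr).
  - exact: (correction_bounded T_iet kT d0 a01 n0 nS B0 q01 hcorr).
move=> tau n' tau0 [c' [C' [kappa' [delta' [r' data']]]]].
have [n0' nS'] := fdc_accel data'.
apply: (correction_estimate T_iet kT d0 a01 EUfull EU0 nS B0 q01 hcorr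
  (ltW tau0) (fdc_c data') n0' nS' (fdc_bal data') _ D0 err).
by move=> k; apply: (fdc_angle data').
Qed.
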